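(* Let $\widehat T$ be the Random Split Random Forest (RSRF) tree of even depth $k$ with width parameter $W\in\mathbb N$ and let $\hat m_{\widehat T}$ be the corresponding tree estimator (see context). Suppose the following hold, with constants not depending on $n$. (C1-RSRF) There exist $\alpha_1\ge 1$ and $\delta\in(0,1]$ such that for any rectangular cell $t=t^{(1)}\times\dots\times t^{(d)}\subseteq[0,1]^d$, $$\operatorname{Var}(m(X)\mid X\in t)\le\alpha_1\sup_{\mathbf c_1,\mathbf c_2}\mathbf S_t(\mathbf c\mid\mathbf c_1,\mathbf c_2)\quad\text{with probability at least }\delta,$$ where the supremum is over split points $\mathbf c_1,\mathbf c_2\in\{1,\dots,d\}\times[0,1]$ and $\mathbf c=(\gamma,U)$ is random with $\mathbb P(\gamma=j)=1/d$ for $j\in\{1,\dots,d\}$ and, conditionally on $\gamma=j$, $U$ uniform on $t^{(j)}$. (C2) $X_1$ has a Lebesgue density on $[0,1]^d$ that is bounded away from $0$ and $\infty$. (C3) $\varepsilon_1,\dots,\varepsilon_n,X_1,\dots,X_n,X$ are independent, $X$ is distributed as $X_1$, $d=O(n^{K_0})$ for some $K_0>0$, the $\varepsilon_i$ are identically distributed with a distribution symmetric around $0$, and $\mathbb E|\varepsilon_1|^q<\infty$ for some sufficiently large $q>0$. (C4) $\sup_{x\in[0,1]^d}|m(x)|<\infty$. Assume that $W\ge\frac{-2\log(2)}{\log(1-\delta)}$. Then for each sequence $k=k_n$ with $k_n\to\infty$ and $k_n<\frac14\log_2(n)$, $$\lim_{n\to\infty}\mathbb E\big[(m(X)-\hat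 m_{\widehat T}(X))^2\big]=0 .$$
   Context: Model: $Y_i=m(X_i)+\varepsilon_i$, $i=1,\dots,n$, with i.i.d. data, $m:[0,1]^d\to\mathbb R$ measurable, $X_i$ taking values in $[0,1]^d$, $\varepsilon_i$ of mean zero. The dimension $d$ may depend on $n$. ''Sufficiently large $q$'' means: there is a threshold $q_0$, depending only on the other constants of the setting, such that it suffices that $\mathbb E|\varepsilon_1|^q<\infty$ for some $q\ge q_0$. For $\delta=1$ the condition on $W$ is void. A rectangular cell is a product $t=t^{(1)}\times\dots\times t^{(d)}\subseteq[0,1]^d$ of intervals of positive length. A cell $t$ is split at $(j,c)\in\{1,\dots,d\}\times[0,1]$ into $t_1=\{x\in t:x_j\le c\}$ and $t_2=t\setminus t_1$. Impurity decrease: for a partition $P=\{t_1,\dots,t_L\}$ of $t$, $\mathbf S(t;P)=\sum_{l=1}^L\mathbb P(X\in t_l\mid X\in t)[\mu(t_l)-\mu(t)]^2$ with $\mu(A)=\mathbb E[m(X)\mid X\in A]$ (terms with $\mathbb P(X\in t_l)=0$ are $0$). $\mathbf S_t(\mathbf c\mid\mathbf c_1,\mathbf c_2)$ denotes $\mathbf S(t;P)$ for the partition $P$ of $t$ into four sets obtained by splitting $t$ at $\mathbf c$ into $t_1,t_2$ and then splitting $t_1$ at $\mathbf c_1$ and $t_2$ at $\mathbf c_2$; it is set to $-\infty$ if one of the four sets is empty. Empirical version: $\widehat{\mathbf S}(t;P)=\sum_{l=1}^L\frac{\# t_l}{\# t}[\hat\mu(t_l)-\hat\mu(t)]^2$,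 where $\# t=\#\{i:X_i\in t\}$, $\hat\mu(t)=(\# t)^{-1}\sum_{i:X_i\in t}Y_i$, with $0/0=0$. Sample-CART split of a cell $t$: split $t$ at a pair $(j,s)$, $j\in\{1,\dots,d\}$, $s\in\{x_j:x\in t\}$ (both daughters of positive Lebesgue measure), that maximizes $\widehat{\mathbf S}(t;\{t_1,t_2\})$, ties broken at random. RSRF tree of depth $k\in 2\mathbb N$ with width $W$: start with $T_0=\{[0,1]^d\}$. For $l=0,2,\dots,k-2$ and each $t\in T_l$: (a) draw $W$ pairs $(j^w,c^w)$ independently, with $j^w$ uniform on $\{1,\dots,d\}$ and $c^w$ uniform on $t^{(j^w)}$ given $j^w$; (b) for each $w=1,\dots,W$ split $t$ at $(j^w,c^w)$ into $t_1^w,t_2^w$ and then split each of $t_1^w$ and $t_2^w$ by a Sample-CART split, giving the partition $P^w=\{t^w_{1,1},t^w_{1,2},t^w_{2,1},t^w_{2,2}\}$; (c) choose $w_{\mathrm{best}}\in\arg\max_w\widehat{\mathbf S}(t;P^w)$; (d) add the four sets of $P^{w_{\mathrm{best}}}$ to $T_{l+2}$. Set $\widehat T=T_k$. The random draws are independent of the data and across cells. The estimator is $\hat m_{\widehat T}(x)=\sum_{t\in\widehat T}\big(\frac{1}{\# t}\sum_{i:X_i\in t}Y_i\big)\mathbf 1_{x\in t}$. *)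

(* Defs.v *)
From HB Require Import structures.
From mathcomp Require Import all_boot all_order all_algebra.
From mathcomp Require Import all_classical all_reals all_analysis.

Set Implicit Arguments.
Unset Strict Implicit.
Unset Printing Implicit Defensive.

Import Order.TTheory GRing.Theory Num.Theory.
Import numFieldNormedType.Exports.

Local Open Scope classical_set_scope.
Local Open Scope ring_scope.

Section lebesgue_tuple.
Context {R : realType}.

Definition tcons d (p : R * d.-tuple R) : d.+1.-tuple R :=
  [the d.+1.-tuple R of p.1 :: p.2].

Let measurable_tcons d : measurable_fun setT (@tcons d).
Proof. exact: measurable_cons. Qed.

HB.instance Definition _ d := isMeasurableFun.Build _ _ _ _ (@tcons d)
  (@measurable_tcons d).

Section step.
Variables (d : nat) (mu : {sigma_finite_measure set (d.-tuple R) -> \bar R}).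

Definition lebesgue_tcons : set (d.+1.-tuple R) -> \bar R :=
  pushforward (lebesgue_measure \x mu)%E (@tcons d).

Let lebesgue_tcons0 : lebesgue_tcons set0 = 0%E.
Proof. by rewrite /lebesgue_tcons /pushforward preimage_set0 measure0. Qed.

Let lebesgue_tcons_ge0 A : (0 <= lebesgue_tcons A)%E.
Proof. exact: (measure_ge0 (lebesgue_measure \x mu)%E). Qed.

Let lebesgue_tcons_sigma_additive : semi_sigma_additive lebesgue_tcons.
Proof.
move=> F mF tF mUF; rewrite /lebesgue_tcons /pushforward preimage_bigcup.
apply: (@measure_semi_sigma_additive _ _ _ (lebesgue_measure \x mu)%E).
- by move=> n; rewrite -[X in measurable X]setTI; exact: measurable_tcons.
- apply/trivIsetP => /= i j _ _ ij; rewrite -preimage_setI.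
  by move/trivIsetP : tF => /(_ _ _ _ _ ij) ->//; rewrite preimage_set0.
- by rewrite -preimage_bigcup -[X in measurable X]setTI; exact: measurable_tcons.
Qed.

HB.instance Definition _ := isMeasure.Build _ _ _ lebesgue_tcons
  lebesgue_tcons0 lebesgue_tcons_ge0 lebesgue_tcons_sigma_additive.

Let lebesgue_tcons_sigma_finite : sigma_finite setT lebesgue_tcons.
Proof.
have [F FT /all_and2[mF Foo]] := sigma_finiteT (@lebesgue_measure R).
have [G GT /all_and2[mG Goo]] := sigma_finiteT mu.
have /card_esym/ppcard_eqP[h] := card_nat2.
pose H i := (h i).1; pose K i := (h i).2.
exists (fun i => [set x | F (H i) (thead x) /\ G (K i) [tuple of behead x]]).
  apply/esym; rewrite -subTset => x _ /=.
  have : (\bigcup_i F i) (thead x) by rewrite -FT.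
  have : (\bigcup_i G i) [tuple of behead x] by rewrite -GT.
  move=> [k _ Gk] [l _ Fl]; exists (h^-1%FUN (l, k)) => //=.
  by rewrite /H /K invK ?inE.
move=> i; split.
  apply: measurableI.
    rewrite -[X in measurable X]setTI; apply: (@measurable_tnth _ R d.+1 ord0) => //.
    exact: mF.
  by rewrite -[X in measurable X]setTI; exact: measurable_behead.
rewrite /lebesgue_tcons /pushforward.
rewrite (_ : _ @^-1` _ = F (H i) `*` G (K i)); last first.
  apply/seteqP; split => -[a x] /=; rewrite theadE.
    by move=> [Fa Gx]; split => //; congr (G _ _): Gx; exact: val_inj.
  by move=> [Fa Gx]; split => //; congr (G _ _): Gx; exact: val_inj.
by rewrite product_measure1E// lte_mul_pinfty// ?ge0_fin_numE//; [exact: Foo|exact: Goo].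
Qed.

HB.instance Definition _ := Measure_isSigmaFinite.Build _ _ _ lebesgue_tcons
  lebesgue_tcons_sigma_finite.

End step.

(* Lebesgue measure on R^d, points being d-tuples: the image under tcons of the
   product of the Lebesgue measures on R and on R^(d-1). *)
Fixpoint lebesgue_tuple d : {sigma_finite_measure set (d.-tuple R) -> \bar R} :=
  if d is d'.+1 then lebesgue_tcons (lebesgue_tuple d')
  else \d_([tuple] : 0.-tuple R).

End lebesgue_tuple.

Section cells.
Context {R : realType} {d : nat}.
Implicit Types (x : d.-tuple R) (i : interval R).

Definition cell := 'I_d -> interval R.

Definition in_cell (t : cell) x : bool := [forall j, tnth x j \in t j].

Definition cell_set (t : cell) : set (d.-tuple R) := [set x | in_cell t x].

Definition unit_cell : cell := fun=> `[0, 1].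

(* Products of intervals of positive length included in [0, 1]^d. *)
Definition rectangular (t : cell) := forall j,
  [set` t j] `<=` `[0, 1] /\ (0 < lebesgue_measure [set` t j])%E.

Definition split_point := ('I_d * R)%type.

(* false: {x in t | x_j <= c}; true: its complement in t *)
Definition daughter (t : cell) (c : split_point) (right : bool) : cell :=
  fun j => if j == c.1 then
    Order.meet (t j) (if right then `]c.2, +oo[ else `]-oo, c.2])
  else t j.

(* (c, (c1, c2)): split at c, then the daughters at c1 and c2 respectively *)
Definition double_split := (split_point * (split_point * split_point))%type.

Definition granddaughter (t : cell) (s : double_split) (b : bool * bool) :=
  daughter (daughter t s.1 b.1) (if b.1 then s.2.2 else s.2.1) b.2.

Definition granddaughters (t : cell) (s : double_split) : seq cell :=
  [seq granddaughter t s b |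
    b <- [:: (false, false); (false, true); (true, false); (true, true)]].

Definition left_end i := if i is Interval (BSide _ a) _ then a else 0.
Definition right_end i := if i is Interval _ (BSide _ b) then b else 0.

Definition cell_of (cl cr : 'I_d -> bool) (a b : d.-tuple R) : cell :=
  fun j => Interval (BSide (cl j) (tnth a j)) (BSide (cr j) (tnth b j)).

End cells.
Arguments cell : clear implicits.
Arguments split_point : clear implicits.
Arguments double_split : clear implicits.

Section population_impurity.
Context {R : realType} {d : nat}.
Variables (law : probability (d.-tuple R) R) (m : d.-tuple R -> R).

(* E[g(X) | X in A] for X distributed as law; 0 when P(X in A) = 0 *)
Definition cond_mean (g : d.-tuple R -> R) (A : set (d.-tuple R)) : R :=
  (\int[law]_(x in A) g x) / fine (law A).

Definition cond_variance (A : set (d.-tuple R)) : R :=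
  cond_mean (fun x => (m x - cond_mean m A) ^+ 2) A.

Definition impurity_decrease (t : cell R d) (P : seq (cell R d)) : R :=
  \sum_(s <- P)
    fine (law (cell_set s `&` cell_set t)) / fine (law (cell_set t)) *
    (cond_mean m (cell_set s) - cond_mean m (cell_set t)) ^+ 2.

Definition double_split_decrease (t : cell R d) (s : double_split R d) : \bar R :=
  if all (fun A => cell_set A != set0) (granddaughters t s)
  then (impurity_decrease t (granddaughters t s))%:E else -oo%E.

Definition unit_split : set (split_point R d) := [set c | 0 <= c.2 <= 1].

(* -oo when t cannot be split into four nonempty sets starting from c *)
Definition best_decrease (t : cell R d) (c : split_point R d) : \bar R :=
  ereal_sup [set double_split_decrease t (c, (c1, c2)) |
              c1 in unit_split & c2 in unit_split].

(* P(c in E) for c = (gamma, U), gamma uniform on the coordinates and,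
   given gamma = j, U uniform on the j-th side of t *)
Definition random_split_prob (t : cell R d) (E : set (split_point R d)) : \bar R :=
  (\sum_(j < d) (d%:R^-1)%:E *
     (lebesgue_measure ([set` t j] `&` [set u | E (j, u)]) *
      ((fine (lebesgue_measure [set` t j]))^-1)%:E))%E.

Definition random_split_condition (alpha1 delta : R) :=
  forall t : cell R d, rectangular t ->
    (delta%:E <= random_split_prob t
       [set c | (cond_variance (cell_set t))%:E <=
                alpha1%:E * best_decrease t c])%E.

End population_impurity.

Section sample_impurity.
Context {R : realType} {n d : nat}.

(* Below, 0/0 = 0 is the library convention 0^-1 = 0. *)
Definition sample := n.-tuple (d.-tuple R * R).

Implicit Types (z : sample) (t : cell R d).

Definition cell_count z t : nat := count (fun p => in_cell t p.1) z.

Definition cell_average z t : R :=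
  (\sum_(p <- z | in_cell t p.1) p.2) / (cell_count z t)%:R.

Definition sample_decrease z t (P : seq (cell R d)) : R :=
  \sum_(s <- P) (cell_count z s)%:R / (cell_count z t)%:R *
    (cell_average z s - cell_average z t) ^+ 2.

Definition cart_admissible t (c : split_point R d) :=
  (exists2 x, cell_set t x & tnth x c.1 = c.2) /\
  forall b, (0 < lebesgue_tuple d (cell_set (daughter t c b)))%E.

Definition is_cart_split z t (c : split_point R d) :=
  cart_admissible t c /\
  forall c', cart_admissible t c' ->
    sample_decrease z t [:: daughter t c' false; daughter t c' true] <=
    sample_decrease z t [:: daughter t c false; daughter t c true].

End sample_impurity.
Arguments sample : clear implicits.

(* Randomized choice of a Sample-CART split. The last argument is an
   independent uniform seed used to break ties, so that every law of
   tie-breaking is covered. Cells are measured through the endpoints of their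
   sides, for each fixed choice cl, cr of open/closed ends. On cells with a
   degenerate side (which occur with probability 0) the value is irrelevant. *)
Record cart_rule (R : realType) (n d : nat) := CartRule {
  cart_split :> sample R n d -> cell R d -> R -> split_point R d ;
  cart_splitP : forall z t v, rectangular t -> is_cart_split z t (cart_split z t v) ;
  cart_coord_measurable : forall cl cr (j : 'I_d),
    measurable [set p : sample R n d * (d.-tuple R * d.-tuple R) * R |
      (cart_split p.1.1 (cell_of cl cr p.1.2.1 p.1.2.2) p.2).1 = j] ;
  cart_point_measurable : forall cl cr,
    measurable_fun setT
      (fun p : sample R n d * (d.-tuple R * d.-tuple R) * R =>
        (cart_split p.1.1 (cell_of cl cr p.1.2.1 p.1.2.2) p.2).2) }.

Definition double_split_of (R : realType) (d : nat)
    (J : 'I_d * ('I_d * 'I_d)) (c : R * (R * R)) : double_split R d :=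
  ((J.1, c.1), ((J.2.1, c.2.1), (J.2.2, c.2.2))).

(* Choice of w_best among W candidate double splits, with the same conventions. *)
Record best_rule (R : realType) (n d W : nat) := BestRule {
  best_index :> sample R n d -> cell R d -> ('I_W -> double_split R d) -> R -> 'I_W ;
  best_indexP : forall z t s v w,
    sample_decrease z t (granddaughters t (s w)) <=
    sample_decrease z t (granddaughters t (s (best_index z t s v))) ;
  best_measurable : forall cl cr (J : 'I_W -> 'I_d * ('I_d * 'I_d)) (w : 'I_W),
    measurable [set p : sample R n d * (d.-tuple R * d.-tuple R) *
                        W.-tuple (R * (R * R)) * R |
      best_index p.1.1.1 (cell_of cl cr p.1.1.2.1 p.1.1.2.2)
        (fun w' => double_split_of (J w') (tnth p.1.2 w')) p.2 = w] }.

(* Nodes at depth 2l of the tree: lists of l pairs of left/right choices, the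
   most recent pair first. *)
Definition node := seq (bool * bool).

(* One row of the triangular array: the data for sample size n, an independent
   test point Xnew, the random draws attached to the nodes of the tree (unif and
   coord define the W random split points), the seeds that break ties, and the
   tie-breaking rules. *)
Record rsrf_model (R : realType) (n W : nat) := RsrfModel {
  display : measure_display ;
  Omega : measurableType display ;
  Pr : probability Omega R ;
  ndim : nat ;
  m : ndim.-tuple R -> R ;
  X : 'I_n -> {RV Pr >-> ndim.-tuple R} ;
  Xnew : {RV Pr >-> ndim.-tuple R} ;
  eps : 'I_n -> {RV Pr >-> R} ;
  coord : node -> 'I_W -> Omega -> 'I_ndim ;
  unif : node -> 'I_W -> {RV Pr >-> R} ;
  cart_seed : node -> 'I_W -> bool -> {RV Pr >-> R} ;
  best_seed : node -> {RV Pr >-> R} ;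
  cart : cart_rule R n ndim ;
  best : best_rule R n ndim W }.
Arguments m {R n W} _ _.
Arguments coord {R n W} _ _ _ _.

Section rsrf.
Context {R : realType} {n W : nat}.
Variable S : rsrf_model R n W.
Implicit Types (omega : Omega S) (a : node).

Definition Y (i : 'I_n) omega : R := m S (X S i omega) + eps S i omega.

Definition data omega : sample R n (ndim S) :=
  [tuple (X S i omega, Y i omega) | i < n].

(* The w-th candidate at node a with cell t: given the coordinate j, the point
   c^w is uniform on t^(j), being the affine image of a uniform variable. *)
Definition candidate a omega (t : cell R (ndim S)) (w : 'I_W) :
    double_split R (ndim S) :=
  let j := coord S a w omega in
  let c := (j, left_end (t j) +
               unif S a w omega * (right_end (t j) - left_end (t j))) in
  let sub b := cart S (data omega) (daughter t c b) (cart_seed S a w b omega) in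
  (c, (sub false, sub true)).

Fixpoint tree_cell a omega : cell R (ndim S) :=
  if a is b :: a' then
    let t := tree_cell a' omega in
    let s := candidate a' omega t in
    granddaughter t (s (best S (data omega) t s (best_seed S a' omega))) b
  else unit_cell.

(* For even k. Two nodes of the same depth have disjoint cells. *)
Definition tree_estimator (k : nat) omega (x : (ndim S).-tuple R) : R :=
  \sum_(a : (k./2).-tuple (bool * bool))
    cell_average (data omega) (tree_cell a omega) *
    (in_cell (tree_cell a omega) x)%:R.

Definition rsrf_risk (k : nat) : \bar R :=
  ('E_(Pr S)[fun omega =>
     ((m S (Xnew S omega) - tree_estimator k omega (Xnew S omega)) ^+ 2)%R])%E.

(* The independent sources of randomness, each with the events it generates. *)
Inductive source :=
| SrcX of 'I_n | SrcEps of 'I_n | SrcXnew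
| SrcCoord of node & 'I_W | SrcUnif of node & 'I_W
| SrcCart of node & 'I_W & bool | SrcBest of node.

Definition source_events (s : source) : set (set (Omega S)) :=
  match s with
  | SrcX i => preimage_set_system setT (X S i) measurable
  | SrcEps i => preimage_set_system setT (eps S i) measurable
  | SrcXnew => preimage_set_system setT (Xnew S) measurable
  | SrcCoord a w => preimage_set_system setT (coord S a w) setT
  | SrcUnif a w => preimage_set_system setT (unif S a w) measurable
  | SrcCart a w b => preimage_set_system setT (cart_seed S a w b) measurable
  | SrcBest a => preimage_set_system setT (best_seed S a) measurable
  end.

Definition sources_independent :=
  forall (N : nat) (s : 'I_N -> source) (E : 'I_N -> set (Omega S)),
    injective s -> (forall i, source_events (s i) (E i)) ->
    Pr S (\bigcap_(i in [set: 'I_N]) E i) = (\prod_(i < N) Pr S (E i))%E.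

Definition is_uniform01 (U : {RV (Pr S) >-> R}) :=
  forall B, measurable B ->
    Pr S (U @^-1` B) = lebesgue_measure (B `&` `[0, 1]%classic).

Definition draws_law :=
  [/\ forall a w j, measurable (coord S a w @^-1` [set j]) /\
        Pr S (coord S a w @^-1` [set j]) = ((ndim S)%:R^-1)%:E,
      forall a w, is_uniform01 (unif S a w),
      forall a w b, is_uniform01 (cart_seed S a w b) &
      forall a, is_uniform01 (best_seed S a)].

Definition regression_setting :=
  [/\ measurable_fun (cell_set unit_cell) (m S),
      forall omega, cell_set unit_cell (Xnew S omega),
      forall i omega, cell_set unit_cell (X S i omega),
      forall i B, measurable B -> Pr S (X S i @^-1` B) = Pr S (Xnew S @^-1` B) &
      forall i, ('E_(Pr S)[eps S i] = 0)%E].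

Definition density_bounded (fmin fmax : R) :=
  exists f : (ndim S).-tuple R -> R,
    [/\ measurable_fun setT f,
        forall x, cell_set unit_cell x -> fmin <= f x <= fmax &
        forall B, measurable B ->
          Pr S (Xnew S @^-1` B) =
          (\int[lebesgue_tuple (ndim S)]_(x in B `&` cell_set unit_cell) (f x)%:E)%E].

Definition noise_symmetric :=
  (forall i j B, measurable B ->
     Pr S (eps S i @^-1` B) = Pr S (eps S j @^-1` B)) /\
  (forall i B, measurable B ->
     Pr S (eps S i @^-1` B) = Pr S ((fun omega => - eps S i omega) @^-1` B)).

Definition noise_moment_le (q B : R) :=
  forall i, ('E_(Pr S)[fun omega => (`|eps S i omega| `^ q)%R] <= B%:E)%E.

Definition regression_bounded (M : R) :=
  forall x, cell_set unit_cell x -> `|m S x| <= M.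

End rsrf.

(* Main.v *)
Require Import Defs.
From HB Require Import structures.
From mathcomp Require Import all_boot all_order all_algebra.
From mathcomp Require Import all_classical all_reals all_analysis.
From mathcomp Require Import measurable_realfun.
From mathcomp Require Import ring lra.

Set Implicit Arguments.
Unset Strict Implicit.
Unset Printing Implicit Defensive.

Import Order.TTheory GRing.Theory Num.Theory.
Import numFieldNormedType.Exports.

Local Open Scope classical_set_scope.
Local Open Scope ring_scope.


(** Why the risk vanishes. Integrated over a cell t, the squared error of the
    tree is the dispersion of t, namely its probability times the conditional
    variance of m, plus that probability times the squared difference between
    the mean of m on t and the average of the observations in t
    ([integrated_error]). The sum of the dispersions over the leaves is made
    small by the splitting, the sum of the second terms by concentration.

    The dispersion decreases geometrically. Multiplied by the probability of the
    cell that is split, an impurity decrease is a difference of scores s^2/p,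
    where p is the mass and s the first moment of a cell
    ([cmass_impurity_decrease]); the same identity holds for the sample. The
    score is Lipschitz in (p, s) uniformly in p as long as means stay bounded
    ([score_lipschitz]), so that a uniform deviation r of masses and moments
    changes each decrease by a multiple of r, however small the cell is. For a
    cell t and its first candidate split, the condition on random splits says
    that with probability at least delta some completion of this candidate
    decreases the dispersion of t by the fraction 1/alpha1. The CART
    completions are at least as good on the sample, and so is the candidate
    that is finally selected; both comparisons carry over to the population up
    to that multiple of r ([greedy_double_score]). The draw of the candidate is
    independent of the data and of the draws made at shorter nodes, which
    determine t ([first_split_probability]). Hence the expected total dispersion
    D_l at depth 2l satisfies
      D_(l+1) <= (1 - delta/alpha1) D_l + error,
    and D_L is at most (1 - delta/alpha1)^L M^2 plus the accumulated error
    ([dispersion_decay]).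

    Concentration holds uniformly over the cells of the tree, although these
    depend on the data. A cell of depth k is the intersection of the unit cube
    with k half-spaces parallel to the axes. When the bounds of the half-spaces
    are restricted to a grid of mesh 1/n, there are at most (2 d (n+3))^k such
    cells, each with an exponential tail bound ([deviating_prob]), and d^k is
    only exp(O(log(n)^2)). Moving a bound to the grid changes what lies in a slab
    of width 1/n, whose probability is O(1/n) because X has a bounded density
    and whose sample count is controlled on the grid as well
    ([cuts_sample_close]). The noise is first truncated at a level y; by symmetry
    the truncated noise is centred ([total_deviation_mean]). Large noises are
    rare by the moment condition ([large_noise_prob]), which also bounds their
    contribution to the risk ([noise_excess_integral]).

    All this gives the explicit bound [risk_le_bound]. With y = n^(1/32) and
    deviations r = y^(-14), a tree of depth k < log2(n)/4 has at most y^8 leaves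
    and every term of the bound except the first is O(y^(-2)), provided that the
    noise has a moment of order 66 ([risk_bound_le]). *)

(** * Lebesgue measure of boxes *)

(** Quadratic upper bound for the moment generating function of a bounded
    centred variable: after integration the linear term disappears. *)
Lemma expR_le1D2sqr (R : realType) (x : R) :
  `|x| <= 2^-1 -> expR x <= 1 + x + 2 * x ^+ 2.
Proof.
rewrite ler_norml => /andP[x1 x2].
have h : 1 - x <= expR (- x) by have := expR_ge1Dx (- x).
have p : 0 < 1 - x by lra.
have : expR x <= (1 - x)^-1.
  by rewrite -[x in expR x]opprK expRN lef_pV2// posrE ?expR_gt0.
move=> /le_trans; apply; rewrite -[(1 - x)^-1]mul1r ler_pdivrMr//.
have : 0 <= x ^+ 2 * (1 - 2 * x) by rewrite mulr_ge0 ?sqr_ge0//; lra.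
by rewrite !expr2; lra.
Qed.

Section lebesgue_boxes.
Context {R : realType}.

(** The Lebesgue measure on tuples is built by adding coordinates at the head,
    so that the product formula for boxes goes by induction on the dimension. *)
Lemma cell_set_tcons d (t : cell R d.+1) :
  @tcons R d @^-1` cell_set t =
  [set` t ord0] `*` cell_set (fun j => t (lift ord0 j)).
Proof.
apply/seteqP; split => -[a x] /=.
  move=> /forallP h; split; first by have := h ord0.
  by apply/forallP => j; have := h (lift ord0 j); rewrite tnthS.
move=> [h0 /forallP h]; apply/forallP => j.
by case: (unliftP ord0 j) => [i|] ->; rewrite ?tnthS//; exact: h.
Qed.

Lemma measurable_cell_set d (t : cell R d) : measurable (cell_set t).
Proof.
have -> : cell_set t = \bigcap_(j in [set: 'I_d]) [set x | tnth x j \in t j].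
  apply/seteqP; split => x; first by move=> /forallP h j _; exact: h.
  by move=> h; apply/forallP => j; exact: h.
apply: fin_bigcap_measurable => // j _.
rewrite -[X in measurable X]setTI.
by apply: (@measurable_tnth _ R d j measurableT [set` t j]); exact: measurable_itv.
Qed.

Lemma lebesgue_tuple_cell d (t : cell R d) :
  lebesgue_tuple d (cell_set t) = (\prod_(j < d) lebesgue_measure [set` t j])%E.
Proof.
elim: d t => [|d IH] t.
  rewrite big_ord0 /= /dirac indicE mem_set//.
  by apply/forallP; case.
rewrite big_ord_recl /= /lebesgue_tcons /pushforward cell_set_tcons.
rewrite product_measure1E ?IH//; last exact: measurable_cell_set.
Qed.

End lebesgue_boxes.

(** The type of values is the one on which the Borel structure is declared, as
    the push-forward of the Lebesgue measure requires. *)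
Definition affine_map (R : realType) (a l : R) (v : measurableTypeR R) :
  measurableTypeR R := a + v * l.

Lemma measurable_affine_map (R : realType) (a l : R) :
  measurable_fun setT (affine_map a l).
Proof. by apply: measurable_funD => //; exact: measurable_funM. Qed.

HB.instance Definition _ (R : realType) (a l : R) :=
  isMeasurableFun.Build _ _ _ _ (affine_map a l) (@measurable_affine_map R a l).

Lemma lebesgue_measure_le (R : realType) (A B : set R) :
  A `<=` B -> (lebesgue_measure A <= lebesgue_measure B)%E.
Proof. exact: (le_outer_measure ((@wlength R idfun)^*)%mu). Qed.

(** Turns a uniform draw on [0, 1] into a uniform draw on the side [a, a + l]
    of a cell. *)
Lemma lebesgue_measure_affine (R : realType) (a l : R) (E : set R) :
  0 < l -> measurable E ->
  lebesgue_measure (affine_map a l @^-1` E `&` `[0, 1]) =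
  (lebesgue_measure (E `&` `[a, (a + l)%R]) * (l^-1)%:E)%E.
Proof.
move=> l0.
pose M := mscale (NngNum (ltW l0)) (pushforward lebesgue_measure (affine_map a l)).
have key A : measurable A ->
    lebesgue_measure A = (l%:E * lebesgue_measure (affine_map a l @^-1` A))%E.
  move=> mA.
  have := @lebesgue_measure_unique R (M (@measurable_affine_map R a l)) _ A mA => -> //.
  move=> _ [[x y] /= xy <-].
  rewrite /M /mscale /= /pushforward.
  have -> : affine_map a l @^-1` `]x, y] = `](x - a) / l, (y - a) / l]%classic.
    apply/seteqP; split => v /=; rewrite !in_itv/= /affine_map;
    by rewrite ltr_pdivrMr// ler_pdivlMr// ltrBlDl lerBrDl.
  rewrite !lebesgue_measure_itv/= !lte_fin ltr_pM2r ?invr_gt0// ltrD2r.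
  case: ifPn => _; last by rewrite mule0.
  by rewrite -!EFinD -EFinM; congr EFin; field; rewrite gt_eqF.
move=> mE; rewrite [in RHS]key; last exact: measurableI.
rewrite muleC muleA -EFinM mulVf ?gt_eqF// mul1e; congr (lebesgue_measure _).
apply/seteqP; split => v /= [Ev]; rewrite !in_itv/= /affine_map => h; split => //.
  by move/andP: h => [h1 h2]; rewrite lerDl lerD2l mulr_ge0 ?ler_piMl// ltW.
move: h; rewrite lerDl lerD2l pmulr_lge0// => /andP[-> h /=].
by move: h; rewrite -{2}(mul1r l) ler_pM2r.
Qed.

(** * Independence of generated sigma-algebras *)

Section independence.
Context d (Omega : measurableType d) (R : realType) (P : probability Omega R).
Variables (I : Type) (ev : I -> set (set Omega)).
Hypotheses (evm : forall i, ev i `<=` measurable) (evT : forall i, ev i setT)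
  (evI : forall i, setI_closed (ev i)).
Hypothesis indep : forall (N : nat) (s : 'I_N -> I) (E : 'I_N -> set Omega),
  injective s -> (forall i, ev (s i) (E i)) ->
  P (\bigcap_(i in [set: 'I_N]) E i) = (\prod_(i < N) P (E i))%E.
Implicit Types (D : set I) (A B : set Omega).

(** Only a generating family: the information carried by D is the sigma-
    algebra that these events generate. *)
Definition events_of D : set (set Omega) := \bigcup_(i in D) ev i.

(** Finite subfamilies are duplicate-free sequences, whose handling needs a
    decidable equality on indices. *)
Let J : choiceType := {classic I}.

Let cap (l : seq J) (E : J -> set Omega) : set Omega :=
  \bigcap_(i in [set` l]) E i.

(** Finite intersections: a pi-system with the same generated sigma-algebra,
    on which independence is an instance of the product rule. *)
Let cylinders D : set (set Omega) :=
  [set A | exists (l : seq J) (E : J -> set Omega),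
    [/\ uniq l, forall i, i \in l -> D i, forall i, ev i (E i) & A = cap l E]].

Let cap_prob l E : uniq l -> (forall i : J, ev i (E i)) ->
  P (cap l E) = (\prod_(i <- l) P (E i))%E.
Proof.
move=> ul evE.
have := @indep (size l) (tnth (in_tuple l)) (fun i => E (tnth (in_tuple l) i)).
rewrite -(big_tuple _ _ (in_tuple l) xpredT (fun i => P (E i))) => <- //.
- congr (P _); apply/seteqP; split => x /= h i.
    by move=> _; apply: h; exact: mem_tnth.
  by move=> il; have /tnthP[j ->] := (il : i \in in_tuple l); exact: h.
- by have /tuple_uniqP : uniq (in_tuple l) by [].
Qed.


Let cylindersI D : setI_closed (cylinders D).
Proof.
move=> _ _ [l1 [E1 [u1 D1 ev1 ->]]] [l2 [E2 [u2 D2 ev2 ->]]].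
exists (undup (l1 ++ l2)), (fun i => (if i \in l1 then E1 i else setT) `&`
  (if i \in l2 then E2 i else setT)); split.
- exact: undup_uniq.
- by move=> i; rewrite mem_undup mem_cat => /orP[/D1|/D2].
- by move=> i; apply: evI; case: ifPn.
- apply/seteqP; split => x /=.
    move=> [h1 h2] i _; split; case: ifPn => // il; [exact: h1|exact: h2].
  move=> h; split => i /= il.
    by have := h i; rewrite /= mem_undup mem_cat il => /(_ isT)[].
  by have := h i; rewrite /= mem_undup mem_cat il orbT => /(_ isT)[].
Qed.

Let cylindersT D : cylinders D setT.
Proof.
exists [::], (fun=> setT); split => //.
by apply/seteqP; split => // x _ i.
Qed.

Let cylinders_measurable D : cylinders D `<=` measurable.
Proof.
move=> _ [l [E [_ _ evE ->]]]; apply: fin_bigcap_measurable => // i _.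
exact/evm/evE.
Qed.

Let events_cylinders D : <<s events_of D >> `<=` <<s cylinders D >>.
Proof.
apply: smallest_sub; first exact: smallest_sigma_algebra.
move=> A [i Di evA]; apply: sub_sigma_algebra.
exists [:: i : J], (fun j : J => if j == (i : J) then A else setT); split => //.
- by move=> j; rewrite inE => /eqP ->.
- by move=> j; case: eqVneq => [->|_].
- apply/seteqP; split => x /=.
    by move=> Ax j; rewrite /= inE => ->.
  by move=> /(_ i); rewrite /= inE eqxx => /(_ isT).
Qed.

Lemma events_of_measurable D : <<s events_of D >> `<=` measurable.
Proof.
apply: smallest_sub; first exact: sigma_algebra_measurable.
by move=> A [i _]; exact: evm.
Qed.

(** Both sides are finite measures in A that agree on the pi-system G, hence
    on the sigma-algebra that it generates. *)
Let indep_extend (G : set (set Omega)) B :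
  G `<=` measurable -> setI_closed G -> G setT -> measurable B ->
  (forall A, G A -> P (A `&` B) = (P A * P B)%E) ->
  forall A, <<s G >> A -> P (A `&` B) = (P A * P B)%E.
Proof.
move=> Gm GI GT mB h A GA.
pose m2 := mscale (NngNum (fine_ge0 (measure_ge0 P B))) P.
have PB : (fine (P B))%:E = P B by rewrite fineK ?fin_num_measure.
have m2E C : m2 C = (P C * P B)%E.
  by rewrite /m2 /mscale /= PB muleC.
rewrite -m2E; apply: (@g_sigma_algebra_measure_unique _ R Omega G Gm (fun=> setT)
  (fun=> GT) _ (mrestr P mB) m2 GI _ _ A GA).
- by rewrite bigcup_const.
- by move=> C GC; exact: etrans (h _ GC) (esym (m2E C)).
- move=> _; suff : (P (setT `&` B) < +oo)%E by [].
  by rewrite setTI; apply: le_lt_trans (ltry 1); exact: probability_le1.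
Qed.

(** Both generating families are first closed under finite intersections; the
    uniqueness of measures is then used on each side. *)
Lemma independent_sigma D1 D2 A B : D1 `&` D2 = set0 ->
  <<s events_of D1 >> A -> <<s events_of D2 >> B ->
  P (A `&` B) = (P A * P B)%E.
Proof.
move=> D12 /events_cylinders DA DB.
have mB := events_of_measurable DB.
apply: (@indep_extend (cylinders D1)) => // {DA}A [l1 [E1 [u1 L1 ev1 ->]]].
rewrite setIC muleC; move: DB => /events_cylinders DB.
have mA : measurable (cap l1 E1).
  by apply: (cylinders_measurable (D := D1)); exists l1, E1.
apply: (@indep_extend (cylinders D2)) => // {mB DB}B [l2 [E2 [u2 L2 ev2 ->]]].
have dis i : i \in l1 -> i \in l2 -> False.
  by move=> /L1 d1 /L2 d2; suff : set0 (i : I) by []; rewrite -D12.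
pose E i := if i \in l1 then E1 i else E2 i.
have evE i : ev i (E i) by rewrite /E; case: ifPn.
have -> : cap l2 E2 `&` cap l1 E1 = cap (l1 ++ l2) E.
  apply/seteqP; split => x /=.
    move=> [h2 h1] i; rewrite /= mem_cat /E => /orP[il|il].
      by rewrite il; exact: h1.
    by case: ifPn => [/dis/(_ il)|] // _; exact: h2.
  move=> h; split => i /= il; have := h i; rewrite /= mem_cat il ?orbT /E => /(_ isT).
    by case: ifPn => // /dis/(_ il).
  by rewrite il.
rewrite !cap_prob// ?cat_uniq ?u1 ?u2 ?andbT; last first.
  by apply/hasPn => i i2; apply/negP => i1; exact: (dis i).
rewrite big_cat/= muleC; congr (_ * _)%E; apply: eq_big_seq => i il.
  by rewrite /E; case: ifPn => // /dis/(_ il).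
by rewrite /E il.
Qed.

End independence.

Section fubini_independent.
Local Open Scope ereal_scope.
Context d d1 d2 (Omega : measurableType d) (T1 : measurableType d1)
  (T2 : measurableType d2) (R : realType) (P : probability Omega R).

(** By independence the joint law is the product of the marginal laws, to
    which the theorem of Tonelli applies. *)
Lemma ge0_integral_independent (f : {mfun Omega >-> T1}) (g : {mfun Omega >-> T2})
    (H : T1 * T2 -> \bar R) :
  (forall A B, measurable A -> measurable B ->
    P (f @^-1` A `&` g @^-1` B) = P (f @^-1` A) * P (g @^-1` B)) ->
  measurable_fun setT H -> (forall z, 0 <= H z) ->
  \int[P]_w H (f w, g w) = \int[P]_w \int[distribution P g]_y H (f w, y).
Proof.
move=> fg mH H0.
have mfg : measurable_fun setT (fun w => (f w, g w)) by exact: measurable_fun_pair.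
pose fgm : {mfun Omega >-> (T1 * T2)%type} := HB.pack_for {mfun Omega >-> (T1 * T2)%type}
  (fun w => (f w, g w)) (isMeasurableFun.Build _ _ _ _ _ mfg).
transitivity (\int[distribution P fgm]_z H z).
  by rewrite ge0_integral_distribution.
(* the joint law and the product agree on rectangles *)
transitivity (\int[distribution P f \x distribution P g]_z H z).
  apply: eq_measure_integral => A mA _; apply/esym.
  by apply: product_measure_unique => // B C mB mC; rewrite /= -fg.
rewrite fubini_tonelli1// ge0_integral_distribution//.
  exact: (measurable_fun_fubini_tonelli_F H).
by move=> x; apply: integral_ge0.
Qed.

End fubini_independent.

Section sub_sigma.
Context d (Omega : measurableType d).

Lemma measurable_fun_sub_sigma d' (U : measurableType d') (G : set (set Omega))
    (h : Omega -> U) : G `<=` measurable ->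
  measurable_fun (setT : set (g_sigma_algebraType G)) h ->
  measurable_fun (setT : set Omega) h.
Proof.
move=> Gm mh _ B mB.
have : <<s G >> (setT `&` h @^-1` B) by exact: (mh measurableT).
by apply: smallest_sub => //; exact: sigma_algebra_measurable.
Qed.

Lemma measurable_set_sub_sigma (G : set (set Omega)) (A : set Omega) :
  G `<=` measurable -> measurable (A : set (g_sigma_algebraType G)) ->
  measurable A.
Proof. by move=> Gm; apply: smallest_sub => //; exact: sigma_algebra_measurable. Qed.

(** Substitution under the integral sign for a variable independent of a
    sigma-algebra G1: the first component is the identity, seen as a
    measurable map to the sample space equipped with G1. It plays the role of
    a conditional expectation given G1. *)
Lemma ge0_integral_indep_sub_sigma d' (U : measurableType d') (R : realType)
    (P : probability Omega R)
    (G1 G2 : set (set Omega)) (g : {mfun Omega >-> U})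
    (H : g_sigma_algebraType G1 * U -> \bar R) :
  G1 `<=` measurable ->
  (forall A B, <<s G1 >> A -> <<s G2 >> B -> P (A `&` B) = (P A * P B)%E) ->
  measurable_fun (setT : set (g_sigma_algebraType G2)) g ->
  measurable_fun setT H -> (forall z, 0 <= H z)%E ->
  (\int[P]_w H (w, g w) = \int[P]_w \int[distribution P g]_y H (w, y))%E.
Proof.
move=> G1m ind mg mH H0.
have mid : measurable_fun (setT : set Omega) (fun w => w : g_sigma_algebraType G1).
  by apply: (measurable_fun_sub_sigma G1m); exact: measurable_id.
pose idm := HB.pack_for {mfun Omega >-> g_sigma_algebraType G1}
  (fun w : Omega => w : g_sigma_algebraType G1) (isMeasurableFun.Build _ _ _ _ _ mid).
apply: (@ge0_integral_independent _ _ _ _ _ _ _ P idm g H) => // A B mA mB.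
apply: ind; first exact: mA.
by have := mg measurableT B mB; rewrite setTI.
Qed.

End sub_sigma.

(** * The score of a pair of mass and moment *)

Section split_score.
Context {R : realFieldType}.
Implicit Types (p s r B : R).

Definition score p s : R := s ^+ 2 / p.

Lemma score0 s : score 0 s = 0.
Proof. by rewrite /score invr0 mulr0. Qed.

Lemma score_ge0 p s : 0 <= p -> 0 <= score p s.
Proof. by move=> p0; rewrite divr_ge0 ?sqr_ge0. Qed.

(** All bounds on scores are polynomial in the mean u; when p vanishes so does
    s, and the convention s / 0 = 0 fits. *)
Let mean_spec B p s : 0 <= B -> 0 <= p -> `|s| <= B * p ->
  exists u, [/\ s / p = u, `|u| <= B, s = p * u & score p s = p * u ^+ 2].
Proof.
move=> B0 p0 h; exists (s / p).
have sE : s = p * (s / p).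
  have [p0'|pn0] := eqVneq p 0; last by rewrite mulrCA divff ?mulr1.
  by move: h; rewrite p0' mulr0 normr_le0 => /eqP ->; rewrite mul0r.
split=> //.
  have [->|pn0] := eqVneq p 0; first by rewrite invr0 mulr0 normr0.
  by rewrite normrM normfV (ger0_norm p0) ler_pdivrMr// lt_neqAle eq_sym pn0.
by rewrite /score !expr2 [RHS]mulrA -sE mulrA.
Qed.

Lemma score_le B p s : 0 <= p -> `|s| <= B * p -> score p s <= B ^+ 2 * p.
Proof.
move=> p0 h; have [->|pn0] := eqVneq p 0; first by rewrite score0 mulr0.
have pp : 0 < p by rewrite lt_neqAle eq_sym pn0.
rewrite /score ler_pdivrMr//.
have : `|s| ^+ 2 <= (B * p) ^+ 2 by rewrite lerXn2r// nnegrE (le_trans _ h).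
by rewrite real_normK ?num_real// exprMn (expr2 p) mulrA.
Qed.

(** The Lipschitz constant does not degenerate as p tends to 0, since means
    are bounded by B: this is what makes small cells harmless. *)
Lemma score_lipschitz B r p s p' s' : 0 <= B -> 0 <= p -> 0 <= p' ->
  `|s| <= B * p -> `|s'| <= B * p' -> `|p - p'| <= r -> `|s - s'| <= r ->
  `|score p s - score p' s'| <= (2 * B + B ^+ 2) * r.
Proof.
move=> B0 p0 p'0 hs hs' hp hss.
have r0 : 0 <= r by exact: le_trans hp.
have [u [_ uB su ->]] := mean_spec B0 p0 hs.
have [v [_ vB sv ->]] := mean_spec B0 p'0 hs'.
have -> : p * u ^+ 2 - p' * v ^+ 2 =
    (s - s') * u + v * (s - s') - u * v * (p - p') by rewrite su sv; ring.
apply: (le_trans (ler_normB _ _)).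
have -> : (2 * B + B ^+ 2) * r = r * B + B * r + B * B * r by rewrite expr2; ring.
rewrite lerD//.
  by apply: (le_trans (ler_normD _ _)); rewrite lerD// normrM ler_pM.
by rewrite !normrM ler_pM// ?mulr_ge0// ler_pM.
Qed.

(** The factor p compensates for the division by p, so that the bound is
    uniform over cells of arbitrarily small mass. *)
Lemma mean_deviation B r p s p' s' : 0 <= B -> 0 <= p -> 0 <= p' ->
  `|s| <= B * p -> `|s'| <= B * p' -> `|p - p'| <= r -> `|s - s'| <= r ->
  p * (s / p - s' / p') ^+ 2 <= 2 * B * (1 + B) * r.
Proof.
move=> B0 p0 p'0 hs hs' hp hss.
have r0 : 0 <= r by exact: le_trans hp.
have [u [-> uB su _]] := mean_spec B0 p0 hs.
have [v [-> vB sv _]] := mean_spec B0 p'0 hs'.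
apply: (le_trans (ler_norm _)).
have -> : p * (u - v) ^+ 2 = ((s - s') - (p - p') * v) * (u - v).
  by rewrite su sv; ring.
rewrite normrM.
have h1 : `|u - v| <= 2 * B.
  by apply: (le_trans (ler_normB _ _)); rewrite mulr_natl mulr2n lerD.
have h2 : `|(s - s') - (p - p') * v| <= (1 + B) * r.
  apply: (le_trans (ler_normB _ _)); have -> : (1 + B) * r = r + r * B by ring.
  by rewrite lerD// normrM ler_pM.
have -> : 2 * B * (1 + B) * r = ((1 + B) * r) * (2 * B) by ring.
by rewrite ler_pM.
Qed.

(** The inequality of Cauchy and Schwarz: refining a partition never lowers
    the total score. *)
Lemma score_superadditive B p s p' s' : 0 <= B -> 0 <= p -> 0 <= p' ->
  `|s| <= B * p -> `|s'| <= B * p' ->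
  score (p + p') (s + s') <= score p s + score p' s'.
Proof.
move=> B0 p0 p'0 hs hs'.
have [u [_ _ su e1]] := mean_spec B0 p0 hs.
have [v [_ _ sv e2]] := mean_spec B0 p'0 hs'.
have [q0|qn0] := eqVneq (p + p') 0.
  by rewrite q0 score0 addr_ge0 ?score_ge0.
have q0 : 0 < p + p' by rewrite lt_neqAle eq_sym qn0 addr_ge0.
rewrite e1 e2 /score ler_pdivrMr// -subr_ge0 su sv.
have -> : (p * u ^+ 2 + p' * v ^+ 2) * (p + p') - (p * u + p' * v) ^+ 2 =
    p * p' * (u - v) ^+ 2 by ring.
by rewrite mulr_ge0 ?sqr_ge0 ?mulr_ge0.
Qed.

(** Both impurity decreases, of the distribution and of the sample, are
    differences of scores once multiplied by the weight of the split cell. *)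
Lemma weighted_decrease (T : Type) B (P : seq T) (p s : T -> R) (q z : R) :
  0 <= B -> (forall t, 0 <= p t) -> (forall t, `|s t| <= B * p t) ->
  q = \sum_(t <- P) p t -> z = \sum_(t <- P) s t ->
  q * \sum_(t <- P) p t / q * (s t / p t - z / q) ^+ 2 =
  \sum_(t <- P) score (p t) (s t) - score q z.
Proof.
move=> B0 p0 sB qE zE.
have q0 : 0 <= q by rewrite qE sumr_ge0.
have zB : `|z| <= B * q.
  rewrite zE qE mulr_sumr; apply: (le_trans (ler_norm_sum _ _ _)).
  by apply: ler_sum => t _.
have [v [-> _ zv ->]] := mean_spec B0 q0 zB.
have [q00|qn0] := eqVneq q 0.
  have : \sum_(t <- P) score (p t) (s t) <= B ^+ 2 * q.
    by rewrite qE mulr_sumr; apply: ler_sum => t _; exact: score_le.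
  rewrite q00 !mul0r mulr0 subr0 => le0; apply/eqP; rewrite eq_le le0 andbT.
  by apply: sumr_ge0 => t _; exact: score_ge0.
rewrite mulr_sumr.
transitivity (\sum_(t <- P) (score (p t) (s t) - 2 * v * s t + v ^+ 2 * p t)).
  apply: eq_bigr => t _; rewrite mulrA (mulrC q) divfK//.
  by have [u [-> _ -> ->]] := mean_spec B0 (p0 t) (sB t); ring.
rewrite big_split sumrB/= -!mulr_sumr -qE -zE zv; ring.
Qed.

End split_score.

(** * Masses and moments of sets *)

Section moments.
Context dT (T : measurableType dT) (R : realType) (law : probability T R).
Variables (m : T -> R) (M : R).
Hypotheses (mm : measurable_fun setT m) (mM : forall x, `|m x| <= M).
Implicit Types (A B U : set T).

Definition mass A : R := fine (law A).
Definition moment A : R := \int[law]_(x in A) m x.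
Definition moment2 A : R := \int[law]_(x in A) (m x) ^+ 2.
(** The law of A times the conditional variance of m given A. In this form a
    split lowers the sum over the parts by exactly the gain of score. *)
Definition dispersion A : R := moment2 A - score (mass A) (moment A).

Let M0 : 0 <= M.
Proof. exact: (le_trans (normr_ge0 _) (mM point)). Qed.

Lemma mass_ge0 A : 0 <= mass A.
Proof. exact: fine_ge0. Qed.

Lemma massK A : measurable A -> (mass A)%:E = law A.
Proof. by move=> mA; rewrite fineK// fin_num_measure. Qed.

Lemma mass_le A B : measurable A -> measurable B -> A `<=` B -> mass A <= mass B.
Proof.
by move=> mA mB AB; rewrite fine_le ?fin_num_measure// le_measure// inE.
Qed.

Lemma mass_le1 A : measurable A -> mass A <= 1.
Proof. by move=> mA; rewrite -lee_fin massK// probability_le1. Qed.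

Lemma bounded_integrable A (g : T -> R) (C : R) : measurable A ->
  measurable_fun setT g -> (forall x, `|g x| <= C) ->
  law.-integrable A (EFin \o g).
Proof.
move=> mA mg gC; apply: measurable_bounded_integrable => //.
- by rewrite (le_lt_trans (probability_le1 _ mA))// ltry.
- exact: measurable_funTS.
- exists C; split; first exact: num_real.
  by move=> D CD x _ /=; rewrite (le_trans (gC x))// ltW.
Qed.

Lemma Rintegral_le_mass A (g : T -> R) (C : R) : measurable A ->
  measurable_fun setT g -> (forall x, `|g x| <= C) ->
  `|\int[law]_(x in A) g x| <= C * mass A.
Proof.
move=> mA mg gC; have ig := bounded_integrable mA mg gC.
apply: (le_trans (le_normr_Rintegral mA ig)).
rewrite -Rintegral_cst//; apply: le_Rintegral => //.
- apply: (bounded_integrable (C := C)) => //.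
    exact: measurableT_comp.
  by move=> x; rewrite normr_id.
- by apply: (bounded_integrable (C := `|C|)).
Qed.

Lemma moment_le A : measurable A -> `|moment A| <= M * mass A.
Proof. by move=> mA; exact: Rintegral_le_mass. Qed.

Let m2M x : `|m x ^+ 2| <= M ^+ 2.
Proof. by rewrite normrX lerXn2r// nnegrE. Qed.

Let mm2 : measurable_fun setT (fun x => m x ^+ 2).
Proof. exact: measurable_funX. Qed.

Lemma moment2_le A : measurable A -> moment2 A <= M ^+ 2 * mass A.
Proof.
by move=> mA; apply: (le_trans (ler_norm _)); exact: Rintegral_le_mass.
Qed.

Section additivity.
Variables (A B : set T).
Hypotheses (mA : measurable A) (mB : measurable B) (AB : A `&` B = set0).

Lemma massU : mass (A `|` B) = mass A + mass B.
Proof. by rewrite /mass measureU// fineD// fin_num_measure. Qed.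

Let disj : [disjoint A & B].
Proof. by apply/eqP. Qed.

Let RintegralU (g : T -> R) (C : R) :
  measurable_fun setT g -> (forall x, `|g x| <= C) ->
  \int[law]_(x in A `|` B) g x = \int[law]_(x in A) g x + \int[law]_(x in B) g x.
Proof.
move=> mg gC; apply: Rintegral_setU => //.
by apply: bounded_integrable gC => //; exact: measurableU.
Qed.

Lemma momentU : moment (A `|` B) = moment A + moment B.
Proof. exact: RintegralU mM. Qed.

Lemma moment2U : moment2 (A `|` B) = moment2 A + moment2 B.
Proof. exact: RintegralU m2M. Qed.

End additivity.

Lemma Rintegral_sqr_sub A (c : R) : measurable A ->
  \int[law]_(x in A) (m x - c) ^+ 2 =
  moment2 A - 2 * c * moment A + c ^+ 2 * mass A.
Proof.
move=> mA.
have i1 := bounded_integrable mA mm mM.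
have i2 : law.-integrable A (EFin \o (fun x => m x ^+ 2)).
  exact: bounded_integrable m2M.
have i3 : law.-integrable A (EFin \o (fun x => 2 * c * m x)).
  apply: (bounded_integrable (C := `|2 * c| * M)) => //.
    exact: measurable_funM.
  by move=> x; rewrite normrM ler_wpM2l.
have i4 : law.-integrable A (EFin \o (fun=> c ^+ 2)).
  by apply: (bounded_integrable (C := `|c ^+ 2|)).
have i5 : law.-integrable A (EFin \o (fun x => m x ^+ 2 - 2 * c * m x)).
  by have := integrableB mA i2 i3; apply: eq_integrable.
transitivity (\int[law]_(x in A) ((m x ^+ 2 - 2 * c * m x) + c ^+ 2)).
  by apply: eq_Rintegral => x _; ring.
by rewrite RintegralD// RintegralB// RintegralZl// Rintegral_cst.
Qed.

(** Decomposition into variance and squared bias, which is what separates the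
    two parts of the risk. *)
Lemma Rintegral_sqr_sub_mean A (c : R) : measurable A ->
  \int[law]_(x in A) (m x - c) ^+ 2 =
  dispersion A + mass A * (moment A / mass A - c) ^+ 2.
Proof.
move=> mA; rewrite Rintegral_sqr_sub// /dispersion /score.
have [p0|pn0] := eqVneq (mass A) 0.
  have := moment_le mA; rewrite p0 mulr0 normr_le0 => /eqP ->.
  by rewrite invr0; ring.
by field.
Qed.

Lemma dispersionE A : measurable A ->
  dispersion A = \int[law]_(x in A) (m x - moment A / mass A) ^+ 2.
Proof. by move=> mA; rewrite Rintegral_sqr_sub_mean// subrr expr0n mulr0 addr0. Qed.

Lemma dispersion_ge0 A : measurable A -> 0 <= dispersion A.
Proof.
by move=> mA; rewrite dispersionE//; apply: Rintegral_ge0 => x _; exact: sqr_ge0.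
Qed.

Lemma dispersion_le A : measurable A -> dispersion A <= M ^+ 2 * mass A.
Proof.
move=> mA; apply: (le_trans _ (moment2_le mA)).
by rewrite /dispersion gerBl// score_ge0// mass_ge0.
Qed.

(** Each of the two sets differs from their common part only inside U, which
    contributes at most M times its mass to either moment. *)
Lemma mass_moment_close A B U : measurable A -> measurable B -> measurable U ->
  A `\` U = B `\` U ->
  `|mass A - mass B| <= mass U /\ `|moment A - moment B| <= 2 * M * mass U.
Proof.
move=> mA mB mU AB.
have dis C D : (C `&` U) `&` (D `\` U) = set0.
  by apply/seteqP; split => // x [[_ u] [_ nu]].
have mI C : measurable C -> measurable (C `&` U) by move=> ?; exact: measurableI.
have mD C : measurable C -> measurable (C `\` U) by move=> ?; exact: measurableD.
have dec C : measurable C -> mass C = mass (C `&` U) + mass (C `\` U) /\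
    moment C = moment (C `&` U) + moment (C `\` U).
  move=> mC; split.
    by rewrite -(massU (mI C mC) (mD C mC) (dis C C)) setUIDK.
  by rewrite -(momentU (mI C mC) (mD C mC) (dis C C)) setUIDK.
have sub C : measurable C -> mass (C `&` U) <= mass U.
  by move=> mC; apply: mass_le (mI C mC) mU _; exact: subIsetr.
have [-> ->] := dec A mA; have [-> ->] := dec B mB; rewrite AB.
have e (x y z : R) : x + z - (y + z) = x - y by ring.
rewrite !e; split.
  rewrite ler_norml; have := mass_ge0 (A `&` U); have := mass_ge0 (B `&` U).
  by have := sub A mA; have := sub B mB => *; apply/andP; split; lra.
apply: (le_trans (ler_normB _ _)).
have hA := moment_le (mI A mA); have hB := moment_le (mI B mB).
have hA' := ler_wpM2l M0 (sub A mA); have hB' := ler_wpM2l M0 (sub B mB).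
lra.
Qed.

End moments.

(** * Impurity decrease as a gain of score *)

Section cell_splitting.
Context {R : realType} {d : nat}.
Implicit Types (t : cell R d) (c : split_point R d) (x : d.-tuple R).

Lemma in_daughter t c b x :
  in_cell (daughter t c b) x = in_cell t x && (b (+) (tnth x c.1 <= c.2)).
Proof.
have sideE : (tnth x c.1 \in (if b then `]c.2, +oo[ else `]-oo, c.2] : interval R))
    = b (+) (tnth x c.1 <= c.2).
  by case: b; rewrite in_itv/= ?andbT// ltNge.
apply/forallP/andP => [h|[/forallP h1 h2] j].
  split.
    apply/forallP => j; have := h j; rewrite /daughter.
    by case: eqP => // _; rewrite in_itvI => /andP[].
  by have := h c.1; rewrite /daughter eqxx in_itvI => /andP[_]; rewrite sideE.
rewrite /daughter; case: eqVneq => [->|_]; last exact: h1.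
by rewrite in_itvI h1 sideE h2.
Qed.

Lemma cell_set_daughters t c :
  cell_set t = cell_set (daughter t c false) `|` cell_set (daughter t c true).
Proof.
apply/seteqP; split => x /=; rewrite /cell_set/= !in_daughter/=.
  by move=> ->; case: (tnth x c.1 <= c.2); [left|right].
by move=> [|] /andP[].
Qed.

Lemma cell_set_daughtersI t c :
  cell_set (daughter t c false) `&` cell_set (daughter t c true) = set0.
Proof.
apply/seteqP; split => // x []; rewrite /cell_set/= !in_daughter/=.
by move=> /andP[_ ->]; rewrite andbF.
Qed.

Lemma daughter_sub t c b : cell_set (daughter t c b) `<=` cell_set t.
Proof. by move=> x; rewrite /cell_set/= in_daughter => /andP[]. Qed.


End cell_splitting.

(** Both the law with its first moment, and the sample with its counts and
    totals, are pairs of additive functions of cells; the algebra of splits is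
    done for both at once. *)
Section additive_weights.
Context {R : realType} {d : nat}.
Variables (w v : cell R d -> R) (B : R).
Hypotheses (B0 : 0 <= B) (w0 : forall t, 0 <= w t)
  (vB : forall t, `|v t| <= B * w t).
Hypothesis wD : forall t c, w t = w (daughter t c false) + w (daughter t c true).
Hypothesis vD : forall t c, v t = v (daughter t c false) + v (daughter t c true).
Implicit Types (t : cell R d) (c : split_point R d) (s : double_split R d).

Definition cell_score t := score (w t) (v t).

Definition split_score t c :=
  cell_score (daughter t c false) + cell_score (daughter t c true).

Definition double_score t s :=
  split_score (daughter t s.1 false) s.2.1 +
  split_score (daughter t s.1 true) s.2.2.

Lemma double_scoreE t s :
  \sum_(u <- granddaughters t s) cell_score u = double_score t s.
Proof. by rewrite !big_cons big_nil addr0 /double_score /split_score !addrA. Qed.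

Lemma cell_score_le_split t c : cell_score t <= split_score t c.
Proof.
by rewrite /cell_score (wD t c) (vD t c); exact: (score_superadditive B0).
Qed.

Lemma split_score_le_double t s : split_score t s.1 <= double_score t s.
Proof. by apply: lerD; exact: cell_score_le_split. Qed.

Lemma weighted_split_decrease t c :
  w t * \sum_(u <- [:: daughter t c false; daughter t c true])
     w u / w t * (v u / w u - v t / w t) ^+ 2 = split_score t c - cell_score t.
Proof.
rewrite (weighted_decrease B0 w0 vB) !big_cons !big_nil ?addr0//.
Qed.

Lemma weighted_double_decrease t s :
  w t * \sum_(u <- granddaughters t s)
     w u / w t * (v u / w u - v t / w t) ^+ 2 = double_score t s - cell_score t.
Proof.
rewrite (weighted_decrease B0 w0 vB) ?double_scoreE//.
- by rewrite !big_cons big_nil addr0 addrA -!wD.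
- by rewrite !big_cons big_nil addr0 addrA -!vD.
Qed.

End additive_weights.

Section population_scores.
Context {R : realType} {d : nat} (law : probability (d.-tuple R) R).
Variables (m : d.-tuple R -> R) (M : R).
Hypotheses (mm : measurable_fun setT m) (mM : forall x, `|m x| <= M).
Implicit Types (t : cell R d) (c : split_point R d) (s : double_split R d).

Definition cmass t := mass law (cell_set t).
Definition cmoment t := moment law m (cell_set t).

Lemma cmass_ge0 t : 0 <= cmass t. Proof. exact: mass_ge0. Qed.

Lemma cmoment_le t : `|cmoment t| <= M * cmass t.
Proof. exact: (moment_le law mm mM (measurable_cell_set t)). Qed.

Lemma cmassD t c : cmass t = cmass (daughter t c false) + cmass (daughter t c true).
Proof.
rewrite /cmass (cell_set_daughters t c) massU//; try exact: measurable_cell_set.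
exact: cell_set_daughtersI.
Qed.

Lemma cmomentD t c :
  cmoment t = cmoment (daughter t c false) + cmoment (daughter t c true).
Proof.
rewrite /cmoment (cell_set_daughters t c) (momentU law mm mM)//; try exact: measurable_cell_set.
exact: cell_set_daughtersI.
Qed.

(** After multiplication by the mass of the cell, an impurity decrease is a
    gain of score, a form that has no denominators tending to 0. *)
Lemma cmass_impurity_decrease t s : 0 <= M ->
  cmass t * impurity_decrease law m t (granddaughters t s) =
  double_score cmass cmoment t s - cell_score cmass cmoment t.
Proof.
move=> M0.
rewrite -(weighted_double_decrease M0 cmass_ge0 cmoment_le cmassD cmomentD).
congr (_ * _); rewrite /impurity_decrease !big_cons !big_nil.
have e b : cell_set (granddaughter t s b) `&` cell_set t = cell_set (granddaughter t s b).
  by apply/setIidPl/(subset_trans (daughter_sub (c := _) (b := _)))/daughter_sub.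
by rewrite !e.
Qed.

Lemma cmass_cond_variance t :
  cmass t * cond_variance law m (cell_set t) = dispersion law m (cell_set t).
Proof.
have mt := measurable_cell_set t.
rewrite (dispersionE law mm mM mt) /cond_variance /cond_mean -/(mass law (cell_set t)).
rewrite -/(moment law m (cell_set t)) -/(cmass t).
have [p0|pn0] := eqVneq (cmass t) 0; last by rewrite mulrC divfK.
rewrite p0 mul0r (Rintegral_sqr_sub_mean law mm mM)//.
have : dispersion law m (cell_set t) <= M ^+ 2 * cmass t by exact: dispersion_le.
have := dispersion_ge0 law mm mM mt; rewrite -/(cmass t) p0 mulr0 mul0r addr0.
by move=> h1 h2; apply/esym/eqP; rewrite eq_le h1 h2.
Qed.

End population_scores.

(** * Sample scores and greedy choices *)

Lemma score_scale (R : realFieldType) (a p s : R) : a != 0 ->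
  score (p / a) (s / a) = score p s / a.
Proof.
move=> a0; rewrite /score; have [->|p0] := eqVneq p 0.
  by rewrite mul0r invr0 !mulr0 mul0r.
by field; rewrite a0 p0.
Qed.

Section sample_scores.
Context {R : realType} {n d : nat} (z : sample R n d) (B : R).
Hypothesis B0 : 0 <= B.
Hypothesis zB : forall p, p \in (z : seq _) -> `|p.2| <= B.
Implicit Types (t : cell R d) (c : split_point R d) (s : double_split R d).

Definition count_in t : R := (cell_count z t)%:R.
Definition total_in t : R := \sum_(p <- z | in_cell t p.1) p.2.

Lemma count_inE t : count_in t = \sum_(p <- z | in_cell t p.1) 1.
Proof. by rewrite /count_in /cell_count -sum1_count natr_sum. Qed.

Lemma count_in_ge0 t : 0 <= count_in t. Proof. exact: ler0n. Qed.

Lemma total_in_le t : `|total_in t| <= B * count_in t.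
Proof.
rewrite count_inE mulr_sumr; apply: (le_trans (ler_norm_sum _ _ _)).
rewrite big_seq_cond [leRHS]big_seq_cond; apply: ler_sum => p /andP[pz _]; rewrite mulr1; exact: zB.
Qed.

Let sumD (F : d.-tuple R * R -> R) t c :
  \sum_(p <- z | in_cell t p.1) F p =
  \sum_(p <- z | in_cell (daughter t c false) p.1) F p +
  \sum_(p <- z | in_cell (daughter t c true) p.1) F p.
Proof.
rewrite (bigID (fun p => tnth p.1 c.1 <= c.2))/=; congr (_ + _);
by apply: eq_bigl => p; rewrite in_daughter.
Qed.

Lemma count_inD t c :
  count_in t = count_in (daughter t c false) + count_in (daughter t c true).
Proof. by rewrite !count_inE (sumD _ t c). Qed.

Lemma total_inD t c :
  total_in t = total_in (daughter t c false) + total_in (daughter t c true).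
Proof. exact: sumD. Qed.

Lemma cart_split_maximizes t c c' : is_cart_split z t c ->
  cart_admissible t c' ->
  split_score count_in total_in t c' <= split_score count_in total_in t c.
Proof.
move=> [_ /(_ c')] h /h {}h.
have := ler_wpM2l (count_in_ge0 t) h.
rewrite (weighted_split_decrease B0 count_in_ge0 total_in_le count_inD total_inD).
rewrite (weighted_split_decrease B0 count_in_ge0 total_in_le count_inD total_inD).
by rewrite lerD2r.
Qed.

Lemma sample_decrease_double_score t s s' :
  sample_decrease z t (granddaughters t s) <=
    sample_decrease z t (granddaughters t s') ->
  double_score count_in total_in t s <= double_score count_in total_in t s'.
Proof.
move=> h; have := ler_wpM2l (count_in_ge0 t) h.
rewrite (weighted_double_decrease B0 count_in_ge0 total_in_le count_inD total_inD).
rewrite (weighted_double_decrease B0 count_in_ge0 total_in_le count_inD total_inD).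
by rewrite lerD2r.
Qed.

End sample_scores.

Section admissible_splits.
Context {R : realType} {d : nat}.
Implicit Types (t : cell R d) (c : split_point R d).

(** An empirical split point must be a coordinate of a point of the cell.
    Replacing one coordinate of a point gives another point of the same cell,
    since sides are intervals. *)
Lemma cell_intermediate t c : cell_set (daughter t c false) !=set0 ->
  cell_set (daughter t c true) !=set0 ->
  exists2 x, cell_set t x & tnth x c.1 = c.2.
Proof.
move=> [x]; rewrite /cell_set/= in_daughter => /andP[/forallP xt /= xc].
move=> [y]; rewrite /cell_set/= in_daughter => /andP[/forallP yt /= yc].
exists [tuple (if j == c.1 then c.2 else tnth x j) | j < d]; last first.
  by rewrite tnth_mktuple eqxx.
apply/forallP => j; rewrite tnth_mktuple; case: eqVneq => [->|_]; last exact: xt.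
apply: (@interval_is_interval _ (t c.1) _ _ (xt c.1) (yt c.1)).
by rewrite xc/= ltW// ltNge.
Qed.

Lemma rectangular_daughter t c b : rectangular t ->
  (0 < lebesgue_tuple d (cell_set (daughter t c b)))%E ->
  rectangular (daughter t c b).
Proof.
move=> rt; rewrite lebesgue_tuple_cell => pos j; split.
  move=> x /= xj; apply: (rt j).1 => /=; move: xj; rewrite /daughter.
  by case: eqVneq => [->|//]; rewrite in_itvI => /andP[].
rewrite lt_neqAle measure_ge0 andbT; apply/eqP => h.
move: pos; rewrite (bigD1 j)//= -h mul0e.
by rewrite ltxx.
Qed.

Variables (law : probability (d.-tuple R) R) (m : d.-tuple R -> R) (M : R).
Hypotheses (mm : measurable_fun setT m) (mM : forall x, `|m x| <= M).
Hypothesis law_null : forall t, lebesgue_tuple d (cell_set t) = 0%E ->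
  law (cell_set t) = 0%E.

(** A split is inadmissible only when a daughter is Lebesgue negligible; this
    daughter then has no mass and the other one carries the whole score. *)
Lemma inadmissible_split_score t c : ~ cart_admissible t c ->
  split_score (cmass law) (cmoment law m) t c =
  cell_score (cmass law) (cmoment law m) t.
Proof.
move=> nadm.
have null0 b : cmass law (daughter t c b) = 0 ->
    cmoment law m (daughter t c b) = 0.
  by move=> h; have := cmoment_le law mm mM (daughter t c b); rewrite h mulr0 normr_le0 => /eqP.
suff [b mb] : exists b, cmass law (daughter t c b) = 0.
  rewrite /split_score /cell_score [in RHS](cmassD law t c).
  rewrite [in RHS](cmomentD law mm mM t c).
  case: b mb => mb; rewrite mb (null0 _ mb) score0; first by rewrite !addr0.
  by rewrite !add0r.
apply: contrapT => /forallNP h; apply: nadm.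
have ne b : cell_set (daughter t c b) !=set0.
  by apply/set0P/eqP => e; apply: (h b); rewrite /cmass /mass e measure0.
split; first exact: cell_intermediate.
move=> b; rewrite lt_neqAle measure_ge0 andbT; apply/eqP => /esym e.
by apply: (h b); rewrite /cmass /mass law_null.
Qed.

End admissible_splits.

Section greedy_split.
Context {R : realType} {n d : nat} (z : sample R n d) (B r : R).
Hypotheses (n0 : (0 < n)%N) (B0 : 0 <= B).
Hypothesis zB : forall p, p \in (z : seq _) -> `|p.2| <= B.
Variables (law : probability (d.-tuple R) R) (m : d.-tuple R -> R) (M : R).
Hypotheses (mm : measurable_fun setT m) (mM : forall x, `|m x| <= M) (MB : M <= B).
Hypothesis law_null : forall t, lebesgue_tuple d (cell_set t) = 0%E ->
  law (cell_set t) = 0%E.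
Implicit Types (t : cell R d) (c : split_point R d) (s : double_split R d).

(** Masses and moments only, from which closeness of scores and of averages
    follows at a Lipschitz cost. *)
Definition sample_close t :=
  `|count_in z t / n%:R - cmass law t| <= r /\
  `|total_in z t / n%:R - cmoment law m t| <= r.

Let rho := (2 * B + B ^+ 2) * r.
Let pop := cell_score (cmass law) (cmoment law m).
Let emp := cell_score (count_in z) (total_in z).

Let nR0 : (0 : R) < n%:R. Proof. by rewrite ltr0n. Qed.

Let cmB t : `|cmoment law m t| <= B * cmass law t.
Proof.
by apply: (le_trans (cmoment_le law mm mM t)); rewrite ler_wpM2r// cmass_ge0.
Qed.

Let totB t : `|total_in z t / n%:R| <= B * (count_in z t / n%:R).
Proof.
rewrite normrM normfV (gtr0_norm nR0) mulrA; apply: ler_wpM2r.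
  by rewrite invr_ge0 ltW.
exact: total_in_le.
Qed.

Lemma sample_close_score t : sample_close t -> `|emp t / n%:R - pop t| <= rho.
Proof.
move=> [h1 h2]; rewrite /emp /cell_score -score_scale ?gt_eqF//.
apply: score_lipschitz => //; first by rewrite divr_ge0 ?count_in_ge0// ltW.
exact: cmass_ge0.
Qed.

(** On the sample, the chosen double split beats the candidate completed by
    its two CART splits, and each of these beats every admissible split;
    closeness carries both comparisons over to the law. A split that is not
    admissible leaves the score unchanged, hence is beaten as well. *)
Lemma greedy_double_score t (c0 : split_point R d) (c : bool -> split_point R d)
    (sbest : double_split R d) :
  (forall b, is_cart_split z (daughter t c0 b) (c b)) ->
  sample_decrease z t (granddaughters t (c0, (c false, c true))) <=
    sample_decrease z t (granddaughters t sbest) ->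
  (forall s b, sample_close (granddaughter t s b)) ->
  forall c1 c2, double_score (cmass law) (cmoment law m) t (c0, (c1, c2)) <=
    double_score (cmass law) (cmoment law m) t sbest + 8 * rho.
Proof.
move=> cart /(sample_decrease_double_score B0 zB) best close c1 c2.
have close1 s b := sample_close_score (close s b).
pose sp u e := split_score (cmass law) (cmoment law m) u e.
have M0 : 0 <= M by exact: (le_trans (normr_ge0 _) (mM point)).
have side b e : (forall e b', sample_close (daughter (daughter t c0 b) e b')) ->
    sp (daughter t c0 b) e <=
    split_score (count_in z) (total_in z) (daughter t c0 b) (c b) / n%:R + 2 * rho.
  move=> cl; have cl' e' b' := sample_close_score (cl e' b').
  (* an inadmissible e has the score of the unsplit daughter, which any split improves *)
  have [adm|nadm] := pselect (cart_admissible (daughter t c0 b) e).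
    have := cart_split_maximizes B0 zB (cart b) adm.
    rewrite -(ler_pM2r (x := n%:R^-1)) ?invr_gt0// => h.
    have := cl' e false; have := cl' e true; rewrite !ler_norml.
    move: h; rewrite /sp /split_score !mulrDl -/(emp _) -/(pop _) -/(emp _) -/(pop _).
    rewrite -!/(emp _) -!/(pop _).
    move=> h /andP[h1 h2] /andP[h3 h4]; lra.
  rewrite /sp (inadmissible_split_score mm mM law_null nadm).
  have := cell_score_le_split M0 (cmass_ge0 law) (cmoment_le law mm mM)
    (cmassD law) (cmomentD law mm mM) (daughter t c0 b) (c b).
  have := cl' (c b) false; have := cl' (c b) true; rewrite !ler_norml.
  rewrite /split_score !mulrDl -!/(emp _) -!/(pop _).
  by move=> /andP[h1 h2] /andP[h3 h4] h; lra.
have s1 := side false c1 (fun e b' => close (c0, (e, e)) (false, b')).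
have s2 := side true c2 (fun e b' => close (c0, (e, e)) (true, b')).
move: best; rewrite -(ler_pM2r (x := n%:R^-1)) ?invr_gt0//.
move: s1 s2; rewrite /sp /double_score /= !mulrDl => s1 s2 best.
have := close1 sbest (false, false); have := close1 sbest (false, true).
have := close1 sbest (true, false); have := close1 sbest (true, true).
rewrite !ler_norml; move: best s1 s2.
rewrite /granddaughter/= /split_score -!/(emp _) -!/(pop _).
move=> best s1 s2 /andP[_ h1] /andP[_ h3] /andP[_ h5] /andP[_ h7].
lra.
Qed.

End greedy_split.

(** * Half-spaces and their grid *)

Section cuts.
Context {R : realType} {d : nat}.
Implicit Types (x : d.-tuple R).

Definition halfspace := (split_point R d * bool)%type.
Implicit Types (q : halfspace) (s : seq halfspace).

Definition satisfies q x : bool := q.2 (+) (tnth x q.1.1 <= q.1.2).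

(** Most recent cut first, like the choices that label a node. *)
Definition cuts s : cell R d := foldr (fun q t => daughter t q.1 q.2) unit_cell s.

Lemma in_cuts s x : in_cell (cuts s) x =
  in_cell unit_cell x && all (satisfies^~ x) s.
Proof.
elim: s => [|q s IH] /=; first by rewrite andbT.
by rewrite in_daughter IH -!andbA; congr (_ && _); rewrite andbC.
Qed.

Lemma daughter_cuts s c b : daughter (cuts s) c b = cuts ((c, b) :: s).
Proof. by []. Qed.

Lemma granddaughter_cuts s (e : double_split R d) b :
  granddaughter (cuts s) e b =
  cuts (((if b.1 then e.2.2 else e.2.1), b.2) :: (e.1, b.1) :: s).
Proof. by []. Qed.

(** The shift by one puts a grid point below 0 and, with i up to N + 2, one
    above 1, so that cuts outside [0, 1], which leave the cube whole on one
    side, are represented as well. *)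
Definition grid_point (N i : nat) : R := (i%:R - 1) / N%:R.

Definition grid_index (N : nat) (c : R) : nat :=
  if c < 0 then 0 else if 1 <= c then N.+1 else (Num.truncn (c * N%:R)).+1.

Section grid.
Variable N : nat.
Hypothesis N0 : (0 < N)%N.

Let NR : (0 : R) < N%:R. Proof. by rewrite ltr0n. Qed.

Lemma grid_index_lt c : (grid_index N c < N.+2)%N.
Proof.
rewrite /grid_index; case: (ltP c 0) => // c0; case: (leP 1 c) => // c1.
have h0 : 0 <= c * N%:R by rewrite mulr_ge0// ltW.
have /andP[h _] := truncn_itv h0.
have : (Num.truncn (c * N%:R))%:R < N%:R :> R.
  by apply: (le_lt_trans h); rewrite gtr_pMl.
by rewrite ltr_nat ltnS => /ltnW.
Qed.

Lemma grid_indexP c (y : R) : 0 <= y <= 1 ->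
  (y <= grid_point N (grid_index N c) -> y <= c) /\
  (y <= c -> y <= grid_point N (grid_index N c).+1).
Proof.
move=> /andP[y0 y1]; rewrite /grid_index; case: (ltP c 0) => c0.
  rewrite /grid_point sub0r mulN1r; split => [h|h]; last by have := le_trans y0 h; rewrite leNgt c0.
  by have := le_trans y0 h; rewrite leNgt oppr_lt0 invr_gt0 NR.
case: (leP 1 c) => c1.
  split => _; first exact: le_trans y1 c1.
  apply: (le_trans y1); rewrite /grid_point ler_pdivlMr// mul1r.
  by rewrite -[N.+2%:R]natr1 addrK ler_nat.
have h0 : 0 <= c * N%:R by rewrite mulr_ge0// ltW.
have /andP[h1 h2] := truncn_itv h0.
rewrite /grid_point -![_.+1%:R]natr1 !addrK; split => h.
  by apply: (le_trans h); rewrite ler_pdivrMr.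
apply: (le_trans h); rewrite ler_pdivlMr//; apply: ltW; apply: (lt_le_trans h2).
by rewrite natr1.
Qed.

Lemma grid_pointS i : grid_point N i.+1 - grid_point N i = N%:R^-1.
Proof. by rewrite /grid_point -mulrBl -natr1 -[RHS]mul1r; congr (_ / _); ring. Qed.

Definition on_grid (g : 'I_d * 'I_N.+3 * bool) : halfspace :=
  ((g.1.1, grid_point N g.1.2), g.2).

Definition grid_cut q : halfspace := ((q.1.1, grid_point N (grid_index N q.1.2)), q.2).

(** Written as two cuts, so that its weight in the sample can be compared with
    that of grid cells. *)
Definition slab q : seq halfspace :=
  [:: ((q.1.1, grid_point N (grid_index N q.1.2)), true);
      ((q.1.1, grid_point N (grid_index N q.1.2).+1), false)].

Lemma grid_cut_slab q x : in_cell unit_cell x ->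
  satisfies q x != satisfies (grid_cut q) x -> in_cell (cuts (slab q)) x.
Proof.
move=> xu; have xq : 0 <= tnth x q.1.1 <= 1.
  by have /forallP/(_ q.1.1) := xu; rewrite in_itv.
have [h1 h2] := grid_indexP q.1.2 xq.
rewrite in_cuts xu /= andbT /satisfies/= => h.
case: (leP (tnth x q.1.1) (grid_point N (grid_index N q.1.2))) h => [/[dup]/h1 ->|]; first by rewrite eqxx.
case: (leP (tnth x q.1.1) q.1.2) => [/h2 -> //|]; by rewrite eqxx.
Qed.

Lemma grid_cuts_slab s x :
  in_cell (cuts s) x != in_cell (cuts (map grid_cut s)) x ->
  has (fun q => in_cell (cuts (slab q)) x) s.
Proof.
rewrite !in_cuts; case xu : (in_cell unit_cell x) => //=.
elim: s => //= q s IH.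
have [e|ne _] := eqVneq (satisfies q x) (satisfies (grid_cut q) x).
  rewrite e; case: (satisfies _ x) => //= /IH ->; exact: orbT.
by rewrite grid_cut_slab.
Qed.

End grid.

End cuts.
Arguments halfspace : clear implicits.

(** * From grid cells to all cells *)

Section discretization.
Context {R : realType} {n d : nat} (z : sample R n d) (B r0 f : R).
Hypotheses (n0 : (0 < n)%N) (B1 : 1 <= B) (f0 : 0 <= f).
Hypothesis zB : forall p, p \in (z : seq _) -> `|p.2| <= B.
Variables (law : probability (d.-tuple R) R) (m : d.-tuple R -> R) (M : R).
Hypotheses (mm : measurable_fun setT m) (mM : forall x, `|m x| <= M) (MB : M <= B).
Variables (N K : nat).
Hypotheses (N0 : (0 < N)%N) (K0 : (0 < K)%N) (d0 : (0 < d)%N).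
Hypothesis law_slab : forall q : halfspace R d, cmass law (cuts (slab N q)) <= f / N%:R.
Hypothesis grid_close : forall g : K.-tuple ('I_d * 'I_N.+3 * bool),
  sample_close z r0 law m (cuts (map (@on_grid R d N) g)).
Implicit Types (s : seq (halfspace R d)) (q : halfspace R d).

Let nR0 : (0 : R) < n%:R. Proof. by rewrite ltr0n. Qed.

Let close_ext r t t' : in_cell t =1 in_cell t' ->
  sample_close z r law m t -> sample_close z r law m t'.
Proof.
move=> tt' [h1 h2]; have e : cell_set t = cell_set t'.
  by apply/seteqP; split => x; rewrite /cell_set/= tt'.
rewrite /sample_close /cmass /cmoment -e; split.
  move: h1; rewrite /count_in /cell_count.
  by rewrite (eq_count (a2 := fun p => in_cell t' p.1))// => p; exact: tt'.
by move: h2; rewrite /total_in (eq_bigl (fun p => in_cell t' p.1)).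
Qed.

Let r0_ge0 : 0 <= r0.
Proof.
have [h _] := grid_close [tuple of nseq K (Ordinal d0, ord0, true)].
exact: (le_trans (normr_ge0 _) h).
Qed.

Let grid_closeK s : size s = K ->
  sample_close z r0 law m (cuts (map (grid_cut N) s)).
Proof.
move=> sK; have gi q : (grid_index N q.1.2 < N.+3)%N.
  exact: ltn_trans (grid_index_lt N0 _) (ltnSn _).
pose g := [seq (q.1.1, Ordinal (gi q), q.2) | q <- s].
have gK : size g == K by rewrite size_map sK.
have := grid_close (Tuple gK).
by rewrite /= /g -map_comp.
Qed.

Let grid_close1 j (i : nat) : (i < N.+3)%N ->
  sample_close z r0 law m (cuts [:: ((j, grid_point N i), false)]).
Proof.
move=> iN; have := grid_close [tuple of nseq K (j, Ordinal iN, false)].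
apply: close_ext => x; rewrite !in_cuts; congr (_ && _).
by rewrite map_nseq all_nseq /= andbT eqn0Ngt K0 /=.
Qed.

(** A slab is the difference of two half-cubes with bounds on the grid, each
    of which is close to its population version. *)
Let count_slab q : count_in z (cuts (slab N q)) / n%:R <= f / N%:R + 2 * r0.
Proof.
set i := grid_index N q.1.2; set j := q.1.1.
have iN := grid_index_lt N0 q.1.2; rewrite -/i in iN.
have [h1 _] := @grid_close1 j i (ltn_trans iN (ltnSn _)).
have [h2 _] := @grid_close1 j i.+1 iN.
pose U := cuts [:: ((j, @grid_point R N i.+1), false)].
pose c := (j, @grid_point R N i).
have e : in_cell (daughter U c false) =1 in_cell (cuts [:: (c, false)]).
  move=> x; rewrite daughter_cuts !in_cuts; congr (_ && _) => /=.
  rewrite !andbT /satisfies/=; case: (leP (tnth x j)) => //= h.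
  by apply: (le_trans h); rewrite -subr_ge0 grid_pointS// invr_ge0.
have cE := count_inD z U c; have pE := cmassD law U c.
have e1 : count_in z (daughter U c false) = count_in z (cuts [:: (c, false)]).
  by rewrite /count_in /cell_count (eq_count (a2 := fun p => in_cell (cuts [:: (c, false)]) p.1))// => p; exact: e.
have e2 : cmass law (daughter U c false) = cmass law (cuts [:: (c, false)]).
  by rewrite /cmass; congr (mass _ _); apply/seteqP; split => x; rewrite /cell_set/= e.
have := law_slab q; rewrite /slab -/i -/j -!/(c, true) -/(cuts _).
rewrite -[cuts _]/(daughter U c true) => h3.
rewrite e1 in cE; rewrite e2 in pE.
have -> : count_in z (daughter U c true) = count_in z U - count_in z (cuts [:: (c, false)]).
  by rewrite cE; ring.
rewrite mulrBl; move: h1 h2; rewrite !ler_norml -/U -/c => /andP[a1 _] /andP[_ a2].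
lra.
Qed.

Let indicator_slab s x :
  `|(in_cell (cuts s) x)%:R - (in_cell (cuts (map (grid_cut N) s)) x)%:R| <=
  \sum_(q <- s) (in_cell (cuts (slab N q)) x)%:R :> R.
Proof.
have [->|ne] := eqVneq (in_cell (cuts s) x) (in_cell (cuts (map (grid_cut N) s)) x).
  by rewrite subrr normr0 sumr_ge0.
have /(grid_cuts_slab N0)/hasP[q qs xq] := ne.
rewrite (big_rem q)//= xq; apply: (@le_trans _ _ 1).
  by do 2 case: in_cell; rewrite ?subr0 ?sub0r ?subrr ?normrN ?normr1 ?normr0.
by rewrite lerDl sumr_ge0.
Qed.

Let sample_discretization s :
  `|count_in z (cuts s) - count_in z (cuts (map (grid_cut N) s))| <=
     \sum_(q <- s) count_in z (cuts (slab N q)) /\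
  `|total_in z (cuts s) - total_in z (cuts (map (grid_cut N) s))| <=
     B * \sum_(q <- s) count_in z (cuts (slab N q)).
Proof.
have gen (F : d.-tuple R * R -> R) (C : R) :
    (forall p, p \in (z : seq _) -> `|F p| <= C) ->
  `|\sum_(p <- z | in_cell (cuts s) p.1) F p -
    \sum_(p <- z | in_cell (cuts (map (grid_cut N) s)) p.1) F p| <=
     C * \sum_(q <- s) count_in z (cuts (slab N q)).
  move=> FC.
  rewrite (big_mkcond (fun p => in_cell (cuts s) p.1)).
  rewrite (big_mkcond (fun p => in_cell (cuts (map _ _)) p.1)) -sumrB.
  apply: (le_trans (ler_norm_sum _ _ _)).
  under [X in _ <= _ * X]eq_bigr do rewrite count_inE big_mkcond.
  rewrite exchange_big/= mulr_sumr big_seq_cond [leRHS]big_seq_cond.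
  apply: ler_sum => p /andP[pz _].
  have -> : (if in_cell (cuts s) p.1 then F p else 0) -
      (if in_cell (cuts (map (grid_cut N) s)) p.1 then F p else 0) =
      F p * ((in_cell (cuts s) p.1)%:R - (in_cell (cuts (map (grid_cut N) s)) p.1)%:R).
    by do 2 case: in_cell; rewrite /= ?mulr0n ?mulr1n; ring.
  rewrite normrM; apply: ler_pM => //; first exact: FC.
  apply: (le_trans (indicator_slab s p.1)); apply: ler_sum => q _.
  by case: in_cell.
split; last exact: gen.
rewrite !count_inE; apply: (le_trans (gen (fun=> 1) 1 _)); last by rewrite mul1r.
by move=> p _; rewrite normr1.
Qed.

Let law_slabs s (U := \big[setU/set0]_(q <- s) cell_set (cuts (slab N q))) :
  measurable U /\ mass law U <= (size s)%:R * (f / N%:R).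
Proof.
have mU s' : measurable (\big[setU/set0]_(q <- s') cell_set (cuts (slab N q))).
  by apply: bigsetU_measurable => q _; exact: measurable_cell_set.
split; first exact: mU.
rewrite /U; elim: s {U} => [|q s IH]; first by rewrite big_nil /mass measure0 mul0r.
rewrite big_cons -natr1 mulrDl mul1r addrC.
apply: le_trans (lerD (law_slab q) IH).
rewrite -lee_fin EFinD !massK; [|exact: mU|exact: measurable_cell_set|].
  by apply: measureU2; [exact: measurable_cell_set|exact: mU].
by apply: measurableU; [exact: measurable_cell_set|exact: mU].
Qed.

Let law_discretization s :
  `|cmass law (cuts s) - cmass law (cuts (map (grid_cut N) s))| <=
     (size s)%:R * (f / N%:R) /\
  `|cmoment law m (cuts s) - cmoment law m (cuts (map (grid_cut N) s))| <=
     2 * M * ((size s)%:R * (f / N%:R)).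
Proof.
have [mU Ule] := law_slabs s.
set U := \big[setU/set0]_(q <- s) _ in mU Ule.
have M0 : 0 <= M by exact: (le_trans (normr_ge0 _) (mM point)).
have [||||h1 h2] := @mass_moment_close _ _ _ law m M mm mM (cell_set (cuts s))
  (cell_set (cuts (map (grid_cut N) s))) U.
- exact: measurable_cell_set.
- exact: measurable_cell_set.
- exact: mU.
- suff e x : ~ U x -> in_cell (cuts s) x = in_cell (cuts (map (grid_cut N) s)) x.
    apply/seteqP; split => x -[xs nU].
      split; last exact: nU.
      by rewrite /cell_set/= -(e x nU).
    split; last exact: nU.
    by rewrite /cell_set/= (e x nU).
  move=> nU; apply: contrapT => /eqP/(grid_cuts_slab N0)/hasP[q qs xq].
  by apply: nU; rewrite /U -bigcup_seq; exists q.
split; first exact: le_trans Ule.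
by apply: (le_trans h2); rewrite ler_wpM2l// mulr_ge0.
Qed.

(** The constant collects K slabs, each with population weight at most f / N
    and sample weight at most f / N + 2 r0, and the deviation r0 of the grid
    cell itself. *)
Let closeK s : size s = K ->
  sample_close z (B * (3 * K%:R + 1) * (r0 + f / N%:R)) law m (cuts s).
Proof.
move=> sK; have [g1 g2] := grid_closeK sK.
have [l1 l2] := law_discretization s; have [c1 c2] := sample_discretization s.
have sl : \sum_(q <- s) count_in z (cuts (slab N q)) / n%:R <=
    K%:R * (f / N%:R + 2 * r0).
  apply: (@le_trans _ _ (\sum_(q <- s) (f / N%:R + 2 * r0))).
    by apply: ler_sum => q _; exact: count_slab.
  rewrite big_const_seq iter_addr_0 count_predT sK -[_ *+ K]mulr_natl. exact: lexx.
rewrite -mulr_suml in sl.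
move: l1 l2; rewrite sK; set e := f / N%:R in sl *.
have e0 : 0 <= e by rewrite divr_ge0.
set S := \sum_(q <- s) _ in c1 c2 sl.
have S0 : 0 <= S by apply: sumr_ge0 => q _; exact: count_in_ge0.
move=> l1 l2.
have B0 : 0 <= B by apply: le_trans B1.
have Kr : 0 <= K%:R * r0 by rewrite mulr_ge0.
have Ke : 0 <= K%:R * e by rewrite mulr_ge0.
have c1' : `|count_in z (cuts s) / n%:R - count_in z (cuts (map (grid_cut N) s)) / n%:R|
    <= K%:R * (e + 2 * r0).
  rewrite -mulrBl normrM normfV (gtr0_norm nR0); apply: le_trans sl.
  by rewrite ler_pM2r ?invr_gt0.
have c2' : `|total_in z (cuts s) / n%:R - total_in z (cuts (map (grid_cut N) s)) / n%:R|
    <= B * (K%:R * (e + 2 * r0)).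
  rewrite -mulrBl normrM normfV (gtr0_norm nR0).
  apply: le_trans (ler_wpM2l B0 sl); rewrite mulrA.
  by rewrite ler_pM2r ?invr_gt0.
have MK : M * (K%:R * e) <= B * (K%:R * e) by rewrite ler_wpM2r.
have Br : r0 <= B * r0 by rewrite ler_peMl.
split.
  apply: (@le_trans _ _ (1 * ((3 * K%:R + 1) * (r0 + e)))); last first.
    by rewrite -mulrA ler_wpM2r// mulr_ge0 ?addr_ge0// mulr_ge0.
  rewrite mul1r; move: c1' g1 l1; rewrite !ler_norml.
  by move=> /andP[? ?] /andP[? ?] /andP[? ?]; apply/andP; split; nra.
have -> : B * (3 * K%:R + 1) * (r0 + e) =
    B * (K%:R * (e + 2 * r0)) + B * (K%:R * r0) + 2 * (B * (K%:R * e)) + B * r0 + B * e by ring.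
have Be : 0 <= B * e by rewrite mulr_ge0.
have BKr : 0 <= B * (K%:R * r0) by rewrite mulr_ge0.
rewrite -mulrA in l2.
move: c2' g2 l2; rewrite !ler_norml.
by move=> /andP[? ?] /andP[? ?] /andP[? ?]; apply/andP; split; lra.
Qed.

(** Moving every cut to the grid only changes what lies in K thin slabs, whose
    weights are themselves controlled on the grid. *)
Lemma cuts_sample_close s : (size s <= K)%N ->
  sample_close z (B * (3 * K%:R + 1) * (r0 + f / N%:R)) law m (cuts s).
Proof.
(* shorter sequences are completed by copies of the half-space x_0 <= 1, which contains the cube *)
move=> sK; pose q1 : halfspace R d := ((Ordinal d0, 1), false).
apply: (@close_ext _ (cuts (s ++ nseq (K - size s) q1))).
  move=> x; rewrite !in_cuts all_cat; case xu : (in_cell unit_cell x) => //=.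
  rewrite all_nseq /satisfies/=; have /forallP/(_ (Ordinal d0)) := xu.
  by rewrite in_itv/= => /andP[_ ->]; rewrite orbT andbT.
by apply: closeK; rewrite size_cat size_nseq subnKC.
Qed.

End discretization.

(** * Random cells *)

Section finite_choice.
Context {dT : measure_display} {T : measurableType dT}.

(** Measurability for the discrete structure, stated by preimages of points
    because the target carries no sigma-algebra. *)
Definition measurable_finite (I : finType) (g : T -> I) :=
  forall i, measurable [set w | g w = i].

Lemma measurable_finite_cst (I : finType) (i : I) : measurable_finite (fun=> i).
Proof.
move=> j; have [->|ij] := eqVneq i j.
  by rewrite (_ : [set w | _] = setT)//; apply/seteqP; split.
rewrite (_ : [set w | _] = set0)//; apply/seteqP; split => // w /= e.
by move: ij; rewrite e eqxx.
Qed.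

(** Everything that is chosen among finitely many alternatives is measurable
    piece by piece. *)
Lemma measurable_fun_glue (I : finType) (g : T -> I) dU (U : measurableType dU)
    (F : I -> T -> U) : measurable_finite g ->
  (forall i, measurable_fun setT (F i)) -> measurable_fun setT (fun w => F (g w) w).
Proof.
move=> mg mF _ B mB; rewrite setTI.
have -> : (fun w => F (g w) w) @^-1` B =
    \bigcup_(i in [set: I]) ([set w | g w = i] `&` F i @^-1` B).
  by apply/seteqP; split => [w Bw|w [i _ [/= <-]]] //; exists (g w).
apply: fin_bigcup_measurable => // i _; apply: measurableI; first exact: mg.
by rewrite -[X in measurable X]setTI; exact: mF.
Qed.

Lemma measurable_finite_glue (I J : finType) (g : T -> I) (F : I -> T -> J) :
  measurable_finite g -> (forall i, measurable_finite (F i)) ->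
  measurable_finite (fun w => F (g w) w).
Proof.
move=> mg mF j.
have -> : [set w | F (g w) w = j] =
    \bigcup_(i in [set: I]) ([set w | g w = i] `&` [set w | F i w = j]).
  by apply/seteqP; split => [w /= Fw|w [i _ [/= <-]]] //; exists (g w).
apply: fin_bigcup_measurable => // i _.
by apply: measurableI; [exact: mg|exact: mF].
Qed.

Lemma measurable_finite_comp (I J : finType) (g : T -> I) (h : I -> J) :
  measurable_finite g -> measurable_finite (h \o g).
Proof.
move=> mg.
by apply: (measurable_finite_glue (F := fun i _ => h i)) => // i; exact: measurable_finite_cst.
Qed.

Lemma measurable_finite_pair (I J : finType) (g : T -> I) (h : T -> J) :
  measurable_finite g -> measurable_finite h ->
  measurable_finite (fun w => (g w, h w)).
Proof.
move=> mg mh; apply: (measurable_finite_glue (F := fun i w => (i, h w))) => // i.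
exact: (measurable_finite_comp (pair i) mh).
Qed.

Lemma measurable_finite_ffun (I J : finType) (g : I -> T -> J) :
  (forall i, measurable_finite (g i)) ->
  measurable_finite (fun w => [ffun i => g i w]).
Proof.
move=> mg f.
have -> : [set w | [ffun i => g i w] = f] =
    \bigcap_(i in [set: I]) [set w | g i w = f i].
  apply/seteqP; split => w /=; first by move=> <- i _; rewrite /= ffunE.
  by move=> h; apply/ffunP => i; rewrite ffunE; exact: h.
by apply: fin_bigcap_measurable => // i _; exact: mg.
Qed.

Lemma measurable_finite_bool (g : T -> bool) : measurable_fun setT g <->
  measurable_finite g.
Proof.
split => [mg b|mg].
  by have := mg measurableT [set b] I; rewrite setTI.
by apply: (measurable_fun_bool true); have := mg true; rewrite setTI.
Qed.

Lemma measurable_finite_eq (I : finType) (g : T -> I) (i : I) :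
  measurable_finite g -> measurable_fun setT (fun w => g w == i).
Proof.
move=> mg; apply/measurable_finite_bool.
exact: (measurable_finite_comp (fun j => j == i) mg).
Qed.

End finite_choice.

Lemma itv_meet_le (R : realType) (l r : bool) (a b c : R) :
  Order.meet (Interval (BSide l a) (BSide r b)) `]-oo, c] =
  Interval (BSide l a) (BSide ((b <= c) && r) (Num.min b c)).
Proof.
rewrite (_ : Order.meet _ _ = Interval (Order.join (BSide l a) -oo%O)
  (Order.meet (BSide r b) (BSide false c)))//; congr Interval.
by rewrite meetEtotal minEle bnd_simp minEle; case: ifP.
Qed.

Lemma itv_meet_gt (R : realType) (l r : bool) (a b c : R) :
  Order.meet (Interval (BSide l a) (BSide r b)) `]c, +oo[ =
  Interval (BSide ((c < a) && l) (Num.max a c)) (BSide r b).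
Proof.
rewrite (_ : Order.meet _ _ = Interval (Order.join (BSide l a) (BSide false c))
  (Order.meet (BSide r b) +oo%O))//; congr Interval.
by rewrite joinEtotal maxEle bnd_simp maxEle ltNge; case: ifP.
Qed.

Section random_cells.
Context {R : realType} {d : nat} {dT : measure_display} {T : measurableType dT}.
Implicit Types (t : T -> cell R d).

Definition sides (cl cr : 'I_d -> bool) (a b : 'I_d -> R) : cell R d :=
  fun j => Interval (BSide (cl j) (a j)) (BSide (cr j) (b j)).

(** The pattern of open and closed ends and the ends themselves depend
    measurably on the randomness; this form is stable under measurable splits. *)
Definition random_cell t := exists (cl cr : 'I_d -> T -> bool) (a b : 'I_d -> T -> R),
  [/\ forall j, measurable_fun setT (cl j), forall j, measurable_fun setT (cr j),
      forall j, measurable_fun setT (a j), forall j, measurable_fun setT (b j) &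
      forall w, t w = sides (cl^~ w) (cr^~ w) (a^~ w) (b^~ w)].

Lemma random_cell_unit : random_cell (fun=> unit_cell).
Proof.
exists (fun _ _ => true), (fun _ _ => false), (fun _ _ => 0), (fun _ _ => 1).
by split => // j; exact: measurable_cst.
Qed.

(** Splitting intersects one side with a half-line, which replaces an end by a
    minimum or a maximum and updates its type by a comparison. *)
Lemma random_cell_daughter t (J : T -> 'I_d) (c : T -> R) b :
  random_cell t -> measurable_finite J -> measurable_fun setT c ->
  random_cell (fun w => daughter (t w) (J w, c w) b).
Proof.
move=> [cl [cr [lo [hi [mcl mcr mlo mhi tE]]]]] mJ mc.
have mif dU (U : measurableType dU) (f g : T -> U) j : measurable_fun setT f ->
    measurable_fun setT g ->
    measurable_fun setT (fun w => if j == J w then f w else g w).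
  move=> mf mg; apply: measurable_fun_ifT => //.
  by under eq_fun do rewrite eq_sym; exact: measurable_finite_eq.
exists (fun j w => if j == J w then if b then (c w < lo j w) && cl j w else cl j w else cl j w).
exists (fun j w => if j == J w then if b then cr j w else (hi j w <= c w) && cr j w else cr j w).
exists (fun j w => if j == J w then if b then Num.max (lo j w) (c w) else lo j w else lo j w).
exists (fun j w => if j == J w then if b then hi j w else Num.min (hi j w) (c w) else hi j w).
split.
- move=> j; apply: mif => //; case: b => //.
  by apply: measurable_and => //; exact: measurable_fun_ltr.
- move=> j; apply: mif => //; case: b => //.
  by apply: measurable_and => //; exact: measurable_fun_ler.
- by move=> j; apply: mif => //; case: b => //; exact: measurable_maxr.
- by move=> j; apply: mif => //; case: b => //; exact: measurable_minr.
- move=> w; apply/funext => j; rewrite /daughter tE /sides/=.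
  by case: eqP => // _; case: b; rewrite ?itv_meet_le ?itv_meet_gt.
Qed.

Lemma random_cell_ends t j : random_cell t ->
  measurable_fun setT (fun w => left_end (t w j)) /\
  measurable_fun setT (fun w => right_end (t w j)).
Proof.
move=> [cl [cr [lo [hi [mcl mcr mlo mhi tE]]]]].
by split; under eq_fun do rewrite tE/=; [exact: mlo|exact: mhi].
Qed.

Lemma random_cell_glue (I : finType) (g : T -> I) (t : I -> T -> cell R d) :
  measurable_finite g -> (forall i, random_cell (t i)) ->
  random_cell (fun w => t (g w) w).
Proof.
move=> mg /choice[cl] /choice[cr] /choice[lo] /choice[hi] mt.
exists (fun j w => cl (g w) j w), (fun j w => cr (g w) j w),
  (fun j w => lo (g w) j w), (fun j w => hi (g w) j w); split => [j|j|j|j|w].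
- by apply: (measurable_fun_glue (F := fun i => cl i j)) => // i; have [] := mt i.
- by apply: (measurable_fun_glue (F := fun i => cr i j)) => // i; have [] := mt i.
- by apply: (measurable_fun_glue (F := fun i => lo i j)) => // i; have [] := mt i.
- by apply: (measurable_fun_glue (F := fun i => hi i j)) => // i; have [] := mt i.
- by have [_ _ _ _ ->] := mt (g w).
Qed.

(** Joint measurability in the randomness and the point, the condition for
    exchanging integrals over both. *)
Lemma measurable_in_random_cell t : random_cell t ->
  measurable_fun setT (fun p : T * d.-tuple R => in_cell (t p.1) p.2).
Proof.
move=> [cl [cr [lo [hi [mcl mcr mlo mhi tE]]]]].
have mx j : measurable_fun setT (fun p : T * d.-tuple R => tnth p.2 j).
  apply: (measurableT_comp (f := fun x : d.-tuple R => tnth x j)) => //.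
  exact: measurable_tnth.
have mf dU (U : measurableType dU) (f : T -> U) : measurable_fun setT f ->
    measurable_fun setT (fun p : T * d.-tuple R => f p.1).
  by move=> h; apply: (measurableT_comp (f := f)).
have mj j : measurable_fun setT (fun p : T * d.-tuple R => tnth p.2 j \in t p.1 j).
  under eq_fun do rewrite tE /sides in_itv /=.
  apply: measurable_and.
    have -> : (fun p : T * d.-tuple R => lo j p.1 < tnth p.2 j ?<= if cl j p.1) =
        (fun p => if cl j p.1 then lo j p.1 <= tnth p.2 j else lo j p.1 < tnth p.2 j).
      by apply/funext => p; case: (cl j p.1).
    apply: measurable_fun_ifT; first exact: mf.
      by apply: measurable_fun_ler => //; exact: mf.
    by apply: measurable_fun_ltr => //; exact: mf.
  have -> : (fun p : T * d.-tuple R => tnth p.2 j < hi j p.1 ?<= if ~~ cr j p.1) =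
      (fun p => if cr j p.1 then tnth p.2 j < hi j p.1 else tnth p.2 j <= hi j p.1).
    by apply/funext => p; case: (cr j p.1).
  apply: measurable_fun_ifT; first exact: mf.
    by apply: measurable_fun_ltr => //; exact: mf.
  by apply: measurable_fun_ler => //; exact: mf.
apply: (measurable_fun_bool true); rewrite setTI.
have -> : (fun p : T * d.-tuple R => in_cell (t p.1) p.2) @^-1` [set true] =
    \bigcap_(j in [set: 'I_d]) [set p | tnth p.2 j \in t p.1 j].
  apply/seteqP; split => p /=; first by move=> /forallP h j _; exact: h.
  by move=> h; apply/forallP => j; exact: h.
apply: fin_bigcap_measurable => // j _.
by have := mj j measurableT [set true] I; rewrite setTI.
Qed.

End random_cells.

Lemma random_cell_comp (R : realType) d dT (T : measurableType dT) dT'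
    (T' : measurableType dT') (t : T -> cell R d) (f : T' -> T) :
  random_cell t -> measurable_fun setT f -> random_cell (t \o f).
Proof.
move=> [cl [cr [lo [hi [mcl mcr mlo mhi tE]]]]] mf.
exists (fun j => cl j \o f), (fun j => cr j \o f), (fun j => lo j \o f),
  (fun j => hi j \o f).
by split => [j|j|j|j|w]; [exact: measurableT_comp..|exact: tE].
Qed.

Section random_cell_moments.
Context {R : realType} {d : nat} {dT : measure_display} {T : measurableType dT}.
Variables (law : probability (d.-tuple R) R) (m : d.-tuple R -> R) (M : R).
Hypotheses (mm : measurable_fun setT m) (mM : forall x, `|m x| <= M).
Variable t : T -> cell R d.
Hypothesis mt : random_cell t.

Lemma measurable_integral_random_cell (g : d.-tuple R -> R) :
  measurable_fun setT g -> (forall x, 0 <= g x) ->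
  measurable_fun setT (fun w => \int[law]_(x in cell_set (t w)) g x).
Proof.
move=> mg g0.
pose F (p : T * d.-tuple R) : \bar R := ((in_cell (t p.1) p.2)%:R * g p.2)%:E.
have mF : measurable_fun setT F.
  apply/measurable_EFinP/measurable_funM.
    have -> : (fun p : T * d.-tuple R => (in_cell (t p.1) p.2)%:R : R) =
        (fun p => if in_cell (t p.1) p.2 then 1 else 0).
      by apply/funext => p; case: in_cell.
    apply: measurable_fun_ifT => //; exact: measurable_in_random_cell.
  exact: (measurableT_comp (f := g)).
have F0 p : (0 <= F p)%E by rewrite lee_fin mulr_ge0.
have := measurable_fun_fubini_tonelli_F (m2 := law) F mF F0.
move=> /(measurableT_comp (@fine_measurable R setT measurableT)).
apply: eq_measurable_fun => w _ /=; rewrite /Rintegral /fubini_F [in RHS]integral_mkcond.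
congr fine; apply: eq_integral => x _; rewrite /F patchE /=.
case: (boolP (in_cell (t w) x)) => h; first by rewrite mem_set// mul1r.
by rewrite memNset ?mul0r//; exact/negP.
Qed.

Lemma measurable_cmass : measurable_fun setT (fun w => cmass law (t w)).
Proof.
have := measurable_integral_random_cell (@measurable_cst _ _ _ _ setT (1 : R)) (fun=> ler01).
apply: eq_measurable_fun => w _.
by rewrite /cmass /mass Rintegral_cst ?mul1r//; exact: measurable_cell_set.
Qed.

Lemma measurable_cmoment : measurable_fun setT (fun w => cmoment law m (t w)).
Proof.
have mmM : measurable_fun setT (fun x => m x + M) by apply: measurable_funD.
have m0 x : 0 <= m x + M by have := mM x; rewrite ler_norml => /andP[? _]; lra.
have h := measurable_integral_random_cell mmM m0.
have : measurable_fun setT (fun w =>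
    \int[law]_(x in cell_set (t w)) (m x + M) - M * cmass law (t w)).
  by apply: measurable_funB => //; apply: measurable_funM => //; exact: measurable_cmass.
apply: eq_measurable_fun => w _.
have mc := measurable_cell_set (t w).
rewrite RintegralD//; first by rewrite Rintegral_cst// addrK.
  exact: bounded_integrable mM.
by apply: (bounded_integrable law (C := `|M|)).
Qed.

Lemma measurable_cscore :
  measurable_fun setT (fun w => cell_score (cmass law) (cmoment law m) (t w)).
Proof.
have : measurable_fun setT (fun w =>
    cmoment law m (t w) ^+ 2 * (cmass law (t w)) `^ (- 1)).
  apply: measurable_funM; first by apply: measurable_funX; exact: measurable_cmoment.
  by apply: (measurableT_comp (f := fun x : R => x `^ (- 1))); [exact: measurable_powR|exact: measurable_cmass].
by apply: eq_measurable_fun => w _; rewrite powR_inv1// cmass_ge0.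
Qed.

Lemma measurable_dispersion :
  measurable_fun setT (fun w => dispersion law m (cell_set (t w))).
Proof.
apply: measurable_funB; last exact: measurable_cscore.
by apply: measurable_integral_random_cell; [exact: measurable_funX|move=> x; exact: sqr_ge0].
Qed.

End random_cell_moments.

(** * Measurability of the tree *)

Section measurable_rules.
Context {R : realType} {n d : nat} {dT : measure_display} {T : measurableType dT}.
Variables (z : T -> sample R n d) (t : T -> cell R d).
Hypotheses (mz : measurable_fun setT z) (mt : random_cell t).

(** The rules are measurable in the ends of the sides for each pattern of open
    and closed ends; there are finitely many patterns, which are glued. *)
Let ends : exists (pat : T -> {ffun 'I_d -> bool} * {ffun 'I_d -> bool})
    (A B : T -> d.-tuple R),
  [/\ measurable_finite pat, measurable_fun setT A, measurable_fun setT B &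
    forall w, t w = cell_of (pat w).1 (pat w).2 (A w) (B w)].
Proof.
have [cl [cr [lo [hi [mcl mcr mlo mhi tE]]]]] := mt.
exists (fun w => ([ffun j => cl j w], [ffun j => cr j w])).
exists (fun w => [tuple lo j w | j < d]), (fun w => [tuple hi j w | j < d]).
split.
- by apply: measurable_finite_pair; apply: measurable_finite_ffun => j;
    exact/measurable_finite_bool.
- by apply/measurable_fun_tnthP => j; apply: eq_measurable_fun (mlo j) => w _; rewrite /= tnth_mktuple.
- by apply/measurable_fun_tnthP => j; apply: eq_measurable_fun (mhi j) => w _; rewrite /= tnth_mktuple.
- move=> w; rewrite tE; apply/funext => j.
  by rewrite /sides /cell_of !tnth_mktuple !ffunE.
Qed.

Lemma measurable_cart (cr : cart_rule R n d) (v : T -> R) : measurable_fun setT v ->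
  measurable_finite (fun w => (cr (z w) (t w) (v w)).1) /\
  measurable_fun setT (fun w => (cr (z w) (t w) (v w)).2).
Proof.
move=> mv; have [pat [A [B [mpat mA mB tE]]]] := ends.
have mQ : measurable_fun setT (fun w => (z w, (A w, B w), v w)).
  by do 2 (apply: measurable_fun_pair => //); exact: measurable_fun_pair.
split.
  rewrite (_ : (fun w => _) = (fun w => (cr (z w) (cell_of (pat w).1 (pat w).2 (A w) (B w)) (v w)).1)); last by apply/funext => w; rewrite tE.
  apply: (measurable_finite_glue (g := pat) (F := fun p w =>
    (cr (z w) (cell_of p.1 p.2 (A w) (B w)) (v w)).1)) => // p i.
  by have := mQ measurableT _ (@cart_coord_measurable _ _ _ cr p.1 p.2 i); rewrite setTI.
rewrite (_ : (fun w => _) = (fun w => (cr (z w) (cell_of (pat w).1 (pat w).2 (A w) (B w)) (v w)).2)); last by apply/funext => w; rewrite tE.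
apply: (measurable_fun_glue (g := pat) (F := fun p w =>
  (cr (z w) (cell_of p.1 p.2 (A w) (B w)) (v w)).2)) => // p.
exact: (measurableT_comp (@cart_point_measurable _ _ _ cr p.1 p.2) mQ).
Qed.

Definition random_split (c : T -> split_point R d) :=
  measurable_finite (fun w => (c w).1) /\ measurable_fun setT (fun w => (c w).2).

Lemma random_cell_split (u : T -> cell R d) (c : T -> split_point R d) b :
  random_cell u -> random_split c -> random_cell (fun w => daughter (u w) (c w) b).
Proof.
move=> mu [m1 m2]; have := random_cell_daughter b mu m1 m2.
by rewrite (_ : (fun w => daughter _ _ _) = (fun w => daughter (u w) (c w) b)).
Qed.

Lemma measurable_best (W : nat) (best : best_rule R n d W)
    (s : T -> 'I_W -> double_split R d) (v : T -> R) :
  (forall w', random_split (fun w => (s w w').1)) ->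
  (forall w', random_split (fun w => (s w w').2.1)) ->
  (forall w', random_split (fun w => (s w w').2.2)) ->
  measurable_fun setT v ->
  measurable_finite (fun w => best (z w) (t w) (s w) (v w)).
Proof.
move=> s0 s1 s2 mv; have [pat [A [B [mpat mA mB tE]]]] := ends.
pose J w := [ffun w' : 'I_W => ((s w w').1.1, ((s w w').2.1.1, (s w w').2.2.1))].
pose C w := [tuple ((s w w').1.2, ((s w w').2.1.2, (s w w').2.2.2)) | w' < W].
have mJ : measurable_finite J.
  apply: measurable_finite_ffun => w'; apply: measurable_finite_pair; first by have [] := s0 w'.
  by apply: measurable_finite_pair; [have [] := s1 w'|have [] := s2 w'].
have mC : measurable_fun setT C.
  apply/measurable_fun_tnthP => w'.
  apply: (eq_measurable_fun (fun w => ((s w w').1.2, ((s w w').2.1.2, (s w w').2.2.2)))).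
    by move=> w _; rewrite /= tnth_mktuple.
  apply: measurable_fun_pair; first by have [] := s0 w'.
  by apply: measurable_fun_pair; [have [] := s1 w'|have [] := s2 w'].
have sE w : s w = fun w' => double_split_of (J w w') (tnth (C w) w').
  apply/funext => w'; rewrite /J /C ffunE tnth_mktuple /double_split_of/=.
  by case: (s w w') => [[? ?] [[? ?] [? ?]]].
have mQ : measurable_fun setT (fun w => (z w, (A w, B w), C w, v w)).
  by do 3 (apply: measurable_fun_pair => //); exact: measurable_fun_pair.
rewrite (_ : (fun w => _) = (fun w => best (z w) (cell_of (pat w).1 (pat w).2 (A w) (B w)) (fun w' => double_split_of (J w w') (tnth (C w) w')) (v w))); last by apply/funext => w; rewrite tE sE.
apply: (measurable_finite_glue (g := fun w => (pat w, J w)) (F := fun p w =>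
  best (z w) (cell_of p.1.1 p.1.2 (A w) (B w))
   (fun w' => double_split_of (p.2 w') (tnth (C w) w')) (v w))).
  exact: measurable_finite_pair.
move=> p i.
by have := mQ measurableT _ (@best_measurable _ _ _ _ best p.1.1 p.1.2 p.2 i); rewrite setTI.
Qed.

End measurable_rules.

Section random_tree.
Context {R : realType} {n W : nat} (S : rsrf_model R n W).
Context {dT : measure_display} {T : measurableType dT}.
Variables (pr : T -> Omega S) (l : nat).
Hypotheses
  (mdata : measurable_fun setT (fun w => data (pr w)))
  (mcoord : forall a w, (size a < l)%N -> measurable_finite (fun v => Defs.coord S a w (pr v)))
  (munif : forall a w, (size a < l)%N -> measurable_fun setT (fun v => unif S a w (pr v)))
  (mcart : forall a w b, (size a < l)%N ->
    measurable_fun setT (fun v => cart_seed S a w b (pr v)))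
  (mbest : forall a, (size a < l)%N -> measurable_fun setT (fun v => best_seed S a (pr v))).


Let first_split a w : (size a < l)%N ->
  random_cell (fun v => tree_cell a (pr v)) ->
  random_split (fun v => (candidate a (pr v) (tree_cell a (pr v)) w).1).
Proof.
move=> al mt; split; first exact: mcoord.
have me j : measurable_fun setT (fun v => left_end (tree_cell a (pr v) j) +
    unif S a w (pr v) * (right_end (tree_cell a (pr v) j) - left_end (tree_cell a (pr v) j))).
  have [ml mr] := random_cell_ends j mt.
  by apply: measurable_funD => //; apply: measurable_funM; [exact: munif|exact: measurable_funB].
exact: (measurable_fun_glue (mcoord w al) me).
Qed.

(** By induction on the node: below depth l the choice of a cell involves only
    the data and the draws at shorter nodes, which are the variables assumed
    measurable. Keeping the space T abstract allows the sigma-algebra of the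
    past to be used there. *)
Lemma random_tree_cell a : (size a <= l)%N ->
  random_cell (fun v => tree_cell a (pr v)).
Proof.
elim: a => [_|b a IH al]; first exact: random_cell_unit.
have mt := IH (ltnW al); have mfirst w := first_split w al mt.
have mside w c : random_cell (fun v =>
    daughter (tree_cell a (pr v)) (candidate a (pr v) (tree_cell a (pr v)) w).1 c).
  exact: random_cell_split.
have msecond w c : random_split (fun v => cart S (data (pr v))
    (daughter (tree_cell a (pr v)) (candidate a (pr v) (tree_cell a (pr v)) w).1 c)
    (cart_seed S a w c (pr v))).
  exact: (measurable_cart mdata (mside w c) _ (mcart w c al)).
have mw : measurable_finite (fun v => best S (data (pr v)) (tree_cell a (pr v))
    (candidate a (pr v) (tree_cell a (pr v))) (best_seed S a (pr v))).
  by apply: (measurable_best mdata mt) => [w|w|w|];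
    [exact: mfirst|exact: (msecond w false)|exact: (msecond w true)|exact: mbest].
apply: (random_cell_glue (t := fun w v => granddaughter (tree_cell a (pr v))
  (candidate a (pr v) (tree_cell a (pr v)) w) b) mw) => w.
rewrite /granddaughter.
have := random_cell_split b.2 (mside w b.1) (msecond w b.1).
by case: b.1.
Qed.

End random_tree.

(** * Sources of randomness *)

Section model_sources.
Context {R : realType} {n W : nat} (S : rsrf_model R n W).
Hypotheses (ind : sources_independent S) (draws : draws_law S).
Local Notation P := (Pr S).
Local Notation events := (@source_events R n W S).
Implicit Types (D : set (@source n W)).

Let preimages_setI dU (U : measurableType dU) (f : Omega S -> U) :
  setI_closed (preimage_set_system setT f measurable).
Proof.
move=> _ _ [A mA <-] [B mB <-]; exists (A `&` B); first exact: measurableI.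
by rewrite preimage_setI setIIr.
Qed.

Let preimages_setT dU (U : measurableType dU) (f : Omega S -> U) :
  preimage_set_system setT f measurable setT.
Proof. by exists setT => //; rewrite preimage_setT setIT. Qed.

Let preimages_measurable dU (U : measurableType dU) (f : {mfun Omega S >-> U}) :
  preimage_set_system setT f measurable `<=` measurable.
Proof. by move=> _ [A mA <-]; rewrite setTI; exact: measurable_funPTI. Qed.

Lemma source_events_measurable s : events s `<=` @measurable _ (Omega S).
Proof.
case: s => [i|i| |a w|a w|a w b|a] /=; try exact: preimages_measurable.
move=> _ [A _ <-]; rewrite setTI.
have -> : Defs.coord S a w @^-1` A =
    \bigcup_(j in A) Defs.coord S a w @^-1` [set j].
  by apply/seteqP; split => [v Av|v [j Aj /= jv]]; [exists (Defs.coord S a w v)|rewrite /= jv].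
apply: fin_bigcup_measurable => // j _.
by have [/(_ a w j)[]] := draws.
Qed.

Lemma source_eventsT s : events s setT.
Proof.
case: s => [i|i| |a w|a w|a w b|a] /=; try exact: preimages_setT.
by exists setT => //; rewrite preimage_setT setIT.
Qed.

Lemma source_eventsI s : setI_closed (events s).
Proof.
case: s => [i|i| |a w|a w|a w b|a] /=; try exact: preimages_setI.
move=> _ _ [A mA <-] [B mB <-]; exists (A `&` B) => //.
by rewrite preimage_setI setIIr.
Qed.

Definition gen D := events_of events D.
(** The sample space with the coarser sigma-algebra of the sources in D:
    measurability of a function on it says that the function depends on these
    sources only. *)
Definition sub_space D := g_sigma_algebraType (gen D).

Lemma gen_measurable D : gen D `<=` measurable.
Proof. by move=> A [s _]; exact: source_events_measurable. Qed.

Lemma independent_sources D1 D2 A B : D1 `&` D2 = set0 ->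
  <<s gen D1 >> A -> <<s gen D2 >> B -> P (A `&` B) = (P A * P B)%E.
Proof.
exact: (independent_sigma source_events_measurable source_eventsT source_eventsI ind).
Qed.

Lemma measurable_source D s dU (U : measurableType dU) (f : Omega S -> U) :
  D s -> events s = preimage_set_system setT f measurable ->
  measurable_fun (setT : set (sub_space D)) f.
Proof.
move=> Ds se _ B mB; apply: sub_sigma_algebra; exists s => //.
by rewrite se; exists B.
Qed.

Lemma measurable_sub_space D dU (U : measurableType dU) (f : Omega S -> U) :
  measurable_fun (setT : set (sub_space D)) f -> measurable_fun setT f.
Proof. exact: (measurable_fun_sub_sigma (@gen_measurable D)). Qed.

Lemma measurable_set_sub_space D (A : set (Omega S)) :
  measurable (A : set (sub_space D)) -> measurable A.
Proof. exact: (measurable_set_sub_sigma (@gen_measurable D)). Qed.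

Lemma measurable_sub_space_sub D1 D2 : D1 `<=` D2 ->
  measurable_fun (setT : set (sub_space D2)) (fun w => w : sub_space D1).
Proof.
move=> D12 _ B mB; rewrite setTI.
have : <<s gen D1 >> B by [].
apply: smallest_sub => //; first exact: smallest_sigma_algebra.
by move=> A [s D1s sA]; apply: sub_sigma_algebra; exists s => //; exact: D12.
Qed.

Lemma ge0_integral_sources D1 D2 dU (U : measurableType dU)
    (g : {mfun Omega S >-> U}) (H : sub_space D1 * U -> \bar R) :
  D1 `&` D2 = set0 -> measurable_fun (setT : set (sub_space D2)) g ->
  measurable_fun setT H -> (forall z, 0 <= H z)%E ->
  (\int[P]_w H (w, g w) = \int[P]_w \int[distribution P g]_y H (w, y))%E.
Proof.
move=> D12 mg mH H0; apply: (@ge0_integral_indep_sub_sigma _ _ _ _ _ P (gen D1) (gen D2)) => //.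
  exact: gen_measurable.
by move=> A B; exact: independent_sources.
Qed.

(** An event of independent sources factors out; the substitution rule is
    applied to its indicator. *)
Lemma ge0_integral_event D1 D2 (E : set (Omega S)) (f : sub_space D1 -> \bar R) :
  D1 `&` D2 = set0 -> <<s gen D2 >> E ->
  measurable_fun setT f -> (forall w, 0 <= f w)%E ->
  (\int[P]_w (f w * (\1_E w)%:E) = P E * \int[P]_w f w)%E.
Proof.
move=> D12 mE mf f0.
have mEO : measurable E by exact: (@measurable_set_sub_space D2).
have mg2 : measurable_fun (setT : set (sub_space D2)) (\1_E : _ -> R).
  exact: measurable_indic.
have mg := measurable_sub_space mg2.
pose g := HB.pack_for {mfun Omega S >-> R} (\1_E : Omega S -> R)
  (isMeasurableFun.Build _ _ _ _ _ mg).
pose H (p : sub_space D1 * R) := (f p.1 * `|p.2|%:E)%E.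
have := @ge0_integral_sources D1 D2 _ _ g H D12 mg2.
rewrite /H /=.
have -> : (fun w => f w * `|\1_E w|%:E)%E = (fun w => f w * (\1_E w : R)%:E)%E.
  by apply/funext => w; rewrite ger0_norm// indicE.
move=> ->.
- have e w : (\int[distribution P g]_y (f w * `|y|%:E) = f w * P E)%E.
    rewrite ge0_integralZl//; last by apply/measurable_EFinP; exact: normr_measurable.
    rewrite ge0_integral_distribution//; last by apply/measurable_EFinP; exact: normr_measurable.
    congr (_ * _)%E; have := integral_indic P measurableT mEO; rewrite setIT => <-.
    by apply: eq_integral => y _ /=; rewrite ger0_norm// indicE.
  under eq_integral do rewrite e.
  by rewrite ge0_integralZr 1?muleC//; exact: (@measurable_sub_space D1).
- apply: emeasurable_funM; first exact: (measurableT_comp (f := f)).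
  by apply/measurable_EFinP/measurableT_comp => //.
- by move=> z; rewrite mule_ge0.
Qed.

(** The cell of a node of length at most l is determined by the data and the
    draws at nodes of length less than l; the new point X is kept out, so that
    the risk can be integrated over it. *)
Definition past (l : nat) : set (@source n W) := fun s => match s with
  | SrcX _ | SrcEps _ => True | SrcXnew => False
  | SrcCoord a _ | SrcUnif a _ | SrcCart a _ _ | SrcBest a => (size a < l)%N : Prop end.

Lemma measurable_coord D a w : D (SrcCoord a w) ->
  forall j, measurable ((Defs.coord S a w @^-1` [set j]) : set (sub_space D)).
Proof.
move=> Ds j; apply: sub_sigma_algebra; exists (SrcCoord a w) => //.
by exists [set j] => //; rewrite setTI.
Qed.

Hypothesis reg : regression_setting S.

(** With the value 0 outside the cube the function is bounded and measurable
    on the whole space, hence has moments on every cell. *)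
Definition regression := (m S) \_ (cell_set unit_cell).

Lemma measurable_regression : measurable_fun setT regression.
Proof.
apply/(measurable_restrictT (m S) (measurable_cell_set _)).
by have [] := reg.
Qed.

Lemma regressionE x : cell_set unit_cell x -> regression x = m S x.
Proof. by move=> xu; rewrite /regression patchE mem_set. Qed.

Lemma measurable_data D : (forall i, D (SrcX i)) -> (forall i, D (SrcEps i)) ->
  measurable_fun (setT : set (sub_space D)) (@data R n W S).
Proof.
move=> DX De; apply/measurable_fun_tnthP => i.
have mX : measurable_fun (setT : set (sub_space D)) (X S i) by exact: measurable_source (DX i) _.
have me : measurable_fun (setT : set (sub_space D)) (eps S i) by exact: measurable_source (De i) _.
apply: (eq_measurable_fun (fun w : sub_space D => (X S i w, regression (X S i w) + eps S i w))).
  move=> w _; rewrite /= /data tnth_mktuple /Y regressionE//.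
  by have [_ _ + _ _] := reg; exact.
apply: measurable_fun_pair => //; apply: measurable_funD => //.
exact: (measurableT_comp measurable_regression).
Qed.

Lemma tree_cell_past l a : (size a <= l)%N ->
  random_cell (T := sub_space (past l)) (fun w => tree_cell a (w : Omega S)).
Proof.
apply: (random_tree_cell (T := sub_space (past l)) (pr := fun w => w)).
- by apply: measurable_data.
- by move=> {}a w al; exact: measurable_coord.
- by move=> {}a w al; exact: (@measurable_source (past l) (SrcUnif a w)).
- by move=> {}a w b al; exact: (@measurable_source (past l) (SrcCart a w b)).
- by move=> {}a al; exact: (@measurable_source (past l) (SrcBest a)).
Qed.

(** Conditionally on the past of the node, the coordinate of its candidate is
    uniform on the d directions and the position is uniform on [0, 1]. The
    coordinate is integrated out last: first the position, which is
    independent of the past and of the coordinate, then the event E j that the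
    coordinate is j. *)
Lemma first_split_probability l a w (delta : R)
    (Q : 'I_(ndim S) -> set (sub_space (past l) * R))
    (h : sub_space (past l) -> R) :
  (l <= size a)%N -> 0 <= delta -> (forall j, measurable (Q j)) ->
  measurable_fun setT h -> (forall v, 0 <= h v) ->
  {ae P, forall v, (delta%:E <= \sum_j ((ndim S)%:R^-1)%:E *
     lebesgue_measure (xsection (Q j) v `&` `[0%R, 1%R]))%E} ->
  (delta%:E * \int[P]_v (h v)%:E <=
   \int[P]_v (h v * \1_(Q (Defs.coord S a w v)) (v : sub_space (past l), unif S a w v))%:E)%E.
Proof.
move=> la delta0 mQ mh h0 hdelta.
pose E j : set (Omega S) := Defs.coord S a w @^-1` [set j].
have mhP := @measurable_sub_space (past l) _ _ _ mh.
have [dc du _ _] := draws.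
(* the position is independent of the past together with the coordinate *)
pose past' : set (@source n W) := past l `|` [set SrcCoord a w].
have pp' : past l `<=` past' by left.
have id' := measurable_sub_space_sub pp'.
pose G j (p : sub_space past' * R) : \bar R :=
  ((h p.1 * \1_(E j) p.1) * \1_(Q j) ((p.1 : sub_space (past l)), p.2))%:E.
have mE j : measurable (E j : set (sub_space past')).
  by apply: measurable_coord; right.
have mEO j : measurable (E j) by exact: (@measurable_set_sub_space past').
have mG j : measurable_fun setT (G j).
  apply/measurable_EFinP; apply: measurable_funM.
    apply: (measurableT_comp (f := fun v : sub_space past' => h v * \1_(E j) v)) => //.
    apply: measurable_funM; last exact: measurable_indic.
    exact: (measurableT_comp (f := h)).
  apply: (measurableT_comp (f := \1_(Q j) : sub_space (past l) * R -> R)).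
    exact: measurable_indic.
  apply: measurable_fun_pair; last exact: measurable_snd.
  exact: (measurableT_comp id' measurable_fst).
have G0 j p : (0 <= G j p)%E by rewrite lee_fin /= !indicE !mulr_ge0.
(* only the term of the coordinate actually drawn is nonzero *)
have sumE v : (h v * \1_(Q (Defs.coord S a w v)) (v : sub_space (past l), unif S a w v))%:E =
    (\sum_j G j (v, unif S a w v))%E.
  rewrite (bigD1 (Defs.coord S a w v))//= big1 ?adde0.
    by rewrite /G /= [\1_(E _) v]indicE mem_set// mulr1.
  move=> j /eqP jc; rewrite /G /= [\1_(E _) v]indicE memNset ?mulr0 ?mul0r// => e.
  by apply: jc; rewrite -e.
under [leRHS]eq_integral do rewrite sumE.
have mGu j : measurable_fun setT (fun v : Omega S => G j (v, unif S a w v)).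
  apply: (measurableT_comp (f := G j)) => //.
  apply: measurable_fun_pair => //.
  by apply: (@measurable_sub_space past'); exact: measurable_id.
rewrite ge0_integral_sum//.
have dis1 : past' `&` [set SrcUnif a w] = set0.
  apply/seteqP; split => // s [[ps|->] /= us]; last by [].
  by move: ps; rewrite us /= ltnNge la.
have dis2 : past l `&` [set SrcCoord a w] = set0.
  by apply/seteqP; split => // s [ps /= us]; move: ps; rewrite us /= ltnNge la.
pose L j (v : sub_space (past l)) := lebesgue_measure (xsection (Q j) v `&` `[0, 1]).
have LE j v : L j v = distribution P (unif S a w) (xsection (Q j) v).
  rewrite /L /distribution /pushforward du//; exact: measurable_xsection.
have mL j : measurable_fun setT (L j).
  rewrite (_ : L j = (fun v => distribution P (unif S a w) (xsection (Q j) v))); last first.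
    by apply/funext => v; exact: LE.
  exact: measurable_fun_xsection.
have L0 j v : (0 <= L j v)%E by rewrite /L.
have term j : (\int[P]_v G j (v, unif S a w v) =
    ((ndim S)%:R^-1)%:E * \int[P]_v ((h v)%:E * L j v))%E.
  rewrite (ge0_integral_sources (D1 := past') (D2 := [set SrcUnif a w]))//; last first.
    exact: (@measurable_source _ (SrcUnif a w)).
  transitivity (\int[P]_v (((h v)%:E * L j v) * (\1_(E j) v)%:E))%E.
    apply: eq_integral => v _; rewrite /G /=.
    under eq_integral do rewrite EFinM.
    rewrite ge0_integralZl//; last 2 first.
    - apply/measurable_EFinP.
      apply: (measurableT_comp (f := \1_(Q j) : sub_space (past l) * R -> R)
        (g := pair (v : sub_space (past l)))); first exact: measurable_indic.
      exact: (@pair1_measurable _ _ (sub_space (past l))).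
    - by rewrite lee_fin mulr_ge0.
    rewrite LE EFinM muleAC; congr (_ * _ * _)%E.
    have := integral_indic (distribution P (unif S a w)) measurableT
      (measurable_xsection (v : sub_space (past l)) (mQ j)).
    rewrite setIT => <-; apply: eq_integral => u _; rewrite !indicE mem_xsection.
    by [].
  rewrite (ge0_integral_event (D1 := past l) (D2 := [set SrcCoord a w]))//.
  - by have [_ ->] := dc a w j.
  - exact: measurable_coord.
  - by apply: emeasurable_funM => //; exact/measurable_EFinP.
  - by move=> v; rewrite mule_ge0// lee_fin.
rewrite (eq_bigr _ (fun j _ => term j)).
have mhL j : measurable_fun (setT : set (Omega S)) (fun v => ((h v)%:E * L j v)%E).
  apply: (@measurable_sub_space (past l)); apply: emeasurable_funM => //.
  exact/measurable_EFinP.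
have hL0 j v : (0 <= (h v)%:E * L j v)%E by rewrite mule_ge0// lee_fin.
under eq_bigr do rewrite -ge0_integralZl ?lee_fin//.
rewrite -ge0_integral_sum//; last 2 first.
- by move=> j; apply: measurable_funeM.
- by move=> j v _; rewrite mule_ge0// lee_fin.
rewrite -ge0_integralZl//; last 2 first.
- exact/measurable_EFinP.
- by move=> v _; rewrite lee_fin.
apply: ae_ge0_le_integral => //.
- by move=> v _; rewrite mule_ge0// lee_fin.
- by apply: measurable_funeM; exact/measurable_EFinP.
- by move=> v _; apply: sume_ge0 => j _; rewrite mule_ge0// lee_fin.
- by apply: emeasurable_sum => j; apply: measurable_funeM.
move: hdelta; apply: (@filterS _ _ (ae_filter_ringOfSetsType P)) => v hv _.
have -> : (\sum_j ((ndim S)%:R^-1)%:E * ((h v)%:E * L j v) =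
    (h v)%:E * \sum_j ((ndim S)%:R^-1)%:E * L j v)%E.
  rewrite ge0_sume_distrr; last by move=> j _; rewrite mule_ge0// lee_fin.
  by apply: eq_bigr => j _; rewrite muleCA.
by rewrite muleC lee_wpmul2l// lee_fin.
Qed.

End model_sources.
Arguments regression {R n W} S _.

(** * An exponential inequality *)

Section chernoff.
Context {R : realType} {n W : nat} (S : rsrf_model R n W).
Hypotheses (ind : sources_independent S) (draws : draws_law S).
Local Notation P := (Pr S).

Let mpair (i : 'I_n) : measurable_fun setT (fun w => (X S i w, eps S i w)).
Proof. exact: measurable_fun_pair. Qed.

(** Covariate and noise of one observation, bundled with the measurability
    that its law requires. *)
Definition observation (i : 'I_n) : {mfun Omega S >-> ((ndim S).-tuple R * R)%type} :=
  HB.pack_for {mfun Omega S >-> ((ndim S).-tuple R * R)%type}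
  (fun w => (X S i w, eps S i w)) (isMeasurableFun.Build _ _ _ _ _ (mpair i)).

(** Sources of the first k observations, the sigma-algebra for an induction on
    the number of factors. *)
Let before (k : nat) : set (@source n W) := fun s => match s with
  | SrcX i | SrcEps i => (i < k)%N : Prop | _ => False end.

Variables (h : (ndim S).-tuple R * R -> R) (C : R).
Hypotheses (mh : measurable_fun setT h) (hC : forall z, `|h z| <= C).
Hypothesis h_mean : forall i, (\int[P]_w (h (observation i w))%:E = 0)%E.

Let C0 : 0 <= C.
Proof. exact: (le_trans (normr_ge0 _) (hC point)). Qed.

Let mho i : measurable_fun setT (fun w => h (observation i w)).
Proof. exact: (measurableT_comp (f := h)). Qed.

Section mgf.
Variable lambda : R.
Hypothesis small : `|lambda * C| <= 2^-1.

Let g (i : 'I_n) w := expR (lambda * h (observation i w)).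

Let mexp : measurable_fun setT (fun z => expR (lambda * h z)).
Proof.
apply: (measurableT_comp (f := @expR R)); first exact: measurable_expR.
exact: measurable_funM.
Qed.

Let mgf1 i : (\int[P]_w (g i w)%:E <= (expR (2 * lambda ^+ 2 * C ^+ 2))%:E)%E.
Proof.
have ih : P.-integrable setT (EFin \o (fun w => h (observation i w))).
  exact: (bounded_integrable P (C := C)).
have ilh : P.-integrable setT (EFin \o (fun w => lambda * h (observation i w))).
  apply: (bounded_integrable P (C := `|lambda| * C)) => //; first exact: measurable_funM.
  by move=> w; rewrite normrM ler_wpM2l.
have ic : P.-integrable setT (EFin \o (fun w : Omega S => 1 + 2 * lambda ^+ 2 * C ^+ 2)).
  by apply: (bounded_integrable P (C := `|1 + 2 * lambda ^+ 2 * C ^+ 2|)).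
apply: (@le_trans _ _ (\int[P]_w ((1 + 2 * lambda ^+ 2 * C ^+ 2) + lambda * h (observation i w))%:E)%E).
  have b w : `|lambda * h (observation i w)| <= 2^-1.
    apply: le_trans small; rewrite !normrM (ger0_norm C0).
    by rewrite ler_wpM2l.
  have pt w : expR (lambda * h (observation i w)) <=
      1 + 2 * lambda ^+ 2 * C ^+ 2 + lambda * h (observation i w).
    apply: (le_trans (expR_le1D2sqr (b w))).
    have : h (observation i w) ^+ 2 <= C ^+ 2.
      by rewrite -[h _ ^+ 2]real_normK ?num_real// lerXn2r// nnegrE.
    move=> /(ler_wpM2l (sqr_ge0 lambda)); rewrite exprMn; lra.
  apply: ge0_le_integral => //.
  - by move=> w _; rewrite lee_fin expR_ge0.
  - by apply/measurable_EFinP; exact: (measurableT_comp mexp).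
  - by apply/measurable_EFinP; apply: measurable_funD => //; exact: measurable_funM.
  - by move=> w _; rewrite lee_fin; exact: pt.
under eq_integral do rewrite EFinD.
rewrite integralD// integral_cst//= probability_setT mule1.
under [X in (_ + X)%E]eq_integral do rewrite EFinM.
rewrite integralZl// h_mean mule0 adde0 lee_fin; exact: expR_ge1Dx.
Qed.

Let mgf_before (k : nat) : (k <= n)%N ->
  (\int[P]_w (\prod_(i < n | (i < k)%N) g i w)%:E <=
   (expR (2 * lambda ^+ 2 * C ^+ 2) ^+ k)%:E)%E.
Proof.
elim: k => [_|k IH kn].
  under eq_integral do rewrite big_pred0//.
  by rewrite integral_cst//= probability_setT mule1 expr0.
pose i0 := Ordinal kn.
pose H (z : sub_space S (before k) * ((ndim S).-tuple R * R)) : \bar R :=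
  ((\prod_(i < n | (i < k)%N) g i z.1)%:E * (expR (lambda * h z.2))%:E)%E.
have mobs (i : 'I_n) D : D (SrcX i) -> D (SrcEps i) ->
    measurable_fun (setT : set (sub_space S D)) (observation i).
  move=> DX De; apply: measurable_fun_pair.
    exact: (@measurable_source _ _ _ S D (SrcX i)).
  exact: (@measurable_source _ _ _ S D (SrcEps i)).
have mF : measurable_fun (setT : set (sub_space S (before k)))
    (fun w => \prod_(i < n | (i < k)%N) g i w).
  under eq_fun do rewrite big_mkcond.
  apply: measurable_prod => i _; case: (ltnP i k) => ik; last exact: measurable_cst.
  apply: (measurableT_comp (f := fun z => expR (lambda * h z))) => //.
  exact: mobs.
have -> : (\int[P]_w (\prod_(i < n | (i < k.+1)%N) g i w)%:E =
    \int[P]_w H (w : sub_space S (before k), observation i0 w))%E.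
  apply: eq_integral => w _; rewrite (bigD1 i0)//= mulrC EFinM; congr (_%:E * _)%E.
  apply: eq_bigl => i; rewrite ltnS leq_eqVlt andbC -(inj_eq val_inj)/=.
  by case: ltngtP.
rewrite (ge0_integral_sources ind draws (D2 := [set SrcX i0; SrcEps i0])).
- have -> : (\int[P]_w \int[distribution P (observation i0)]_y H (w, y) =
      \int[P]_w ((\prod_(i < n | (i < k)%N) g i w)%:E * \int[P]_v (g i0 v)%:E))%E.
    apply: eq_integral => w _; rewrite /H/= ge0_integralZl//; last 2 first.
    + exact/measurable_EFinP.
    + by rewrite lee_fin prodr_ge0// => i _; exact: expR_ge0.
    by rewrite ge0_integral_distribution//; exact/measurable_EFinP.
  rewrite ge0_integralZr//; last 3 first.
  + by apply/measurable_EFinP; exact: (measurable_sub_space draws mF).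
  + by move=> w _; rewrite lee_fin prodr_ge0// => i _; exact: expR_ge0.
  + by apply: integral_ge0 => w _; rewrite lee_fin expR_ge0.
  rewrite exprSr EFinM; apply: lee_pmul => //.
  + by apply: integral_ge0 => w _; rewrite lee_fin prodr_ge0// => i _; exact: expR_ge0.
  + by apply: integral_ge0 => w _; rewrite lee_fin expR_ge0.
  + by apply: IH; exact: ltnW.
- apply/seteqP; split => // s [bs [] /= us]; move: bs; by rewrite us /= ltnn.
- by apply: mobs; [left|right].
- apply: emeasurable_funM; apply/measurable_EFinP.
    exact: (measurableT_comp mF measurable_fst).
  exact: (measurableT_comp mexp measurable_snd).
- by move=> z; rewrite mule_ge0// lee_fin ?expR_ge0// prodr_ge0// => i _; exact: expR_ge0.
Qed.

Lemma mgf_sum : (\int[P]_w (expR (lambda * \sum_(i < n) h (observation i w)))%:E <=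
   (expR (2 * lambda ^+ 2 * C ^+ 2 * n%:R))%:E)%E.
Proof.
rewrite mulrC expRM_natl; apply: le_trans (mgf_before (leqnn n)).
rewrite le_eqVlt; apply/orP; left; apply/eqP; apply: eq_integral => w _.
rewrite mulr_sumr expR_sum; congr (_%:E); apply: eq_bigl => i.
by rewrite ltn_ord.
Qed.

End mgf.

(** Exponential Markov inequality; the exponent is minimised by lambda = r /
    (4 C^2), which is small enough for the quadratic bound of the exponential
    because r <= C. *)
Lemma chernoff_upper (r : R) : 0 < C -> 0 <= r <= C ->
  (P [set w | (n%:R * r <= \sum_(i < n) h (observation i w))%R] <=
   (expR (- (n%:R * r ^+ 2 / (8 * C ^+ 2))))%:E)%E.
Proof.
move=> Cp /andP[r0 rC].
(* minimises -lambda r + 2 lambda^2 C^2, with value -r^2 / (8 C^2) *)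
pose lambda := r / (4 * C ^+ 2).
have l0 : 0 <= lambda by rewrite divr_ge0// mulr_ge0// sqr_ge0.
have lC : lambda * C = r / (4 * C) by rewrite /lambda; field; rewrite gt_eqF.
have small : `|lambda * C| <= 2^-1.
  rewrite lC ger0_norm ?divr_ge0 ?mulr_ge0// ler_pdivrMr ?mulr_gt0//; lra.
have mS : measurable_fun setT (fun w => \sum_(i < n) h (observation i w)).
  exact: measurable_sum.
set E := [set w | _].
have mE : measurable E.
  have mler : measurable_fun setT (fun w => n%:R * r <= \sum_(i < n) h (observation i w)).
    exact: measurable_fun_ler.
  by have := mler measurableT [set true] I; rewrite setTI.
have key : ((expR (lambda * (n%:R * r)))%:E * P E <=
    (expR (2 * lambda ^+ 2 * C ^+ 2 * n%:R))%:E)%E.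
  apply: le_trans (mgf_sum small).
  have := integral_indic P measurableT mE; rewrite setIT => <-.
  rewrite -ge0_integralZl// ?lee_fin ?expR_ge0//; last by apply/measurable_EFinP; exact: measurable_indic.
  apply: ge0_le_integral => //.
  - apply: measurable_funeM; apply/measurable_EFinP; exact: measurable_indic.
  - apply/measurable_EFinP; apply: (measurableT_comp (f := @expR R)).
      exact: measurable_expR.
    exact: measurable_funM.
  - move=> w _; rewrite -EFinM lee_fin indicE.
    have [wE|_] := boolP (w \in E); last by rewrite mulr0 expR_ge0.
    by rewrite mulr1 ler_expR ler_wpM2l//; move: wE; rewrite inE.
have PE : P E = (fine (P E))%:E by rewrite fineK ?fin_num_measure.
move: key; rewrite PE -EFinM !lee_fin -ler_pdivlMl ?expR_gt0// -expRN -expRD.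
move=> /le_trans; apply; rewrite ler_expR.
rewrite le_eqVlt; apply/orP; left; apply/eqP; rewrite /lambda; field.
by rewrite gt_eqF.
Qed.

End chernoff.

(** * Concentration on one cell *)

(** Odd in e, so that a truncated symmetric noise is still centred. *)
Definition truncate (R : realType) (y e : R) : R := if `|e| <= y then e else 0.

Lemma truncateN (R : realType) (y e : R) : truncate y (- e) = - truncate y e.
Proof. by rewrite /truncate normrN; case: ifP; rewrite ?oppr0. Qed.

Lemma truncate_le (R : realType) (y e : R) : 0 <= y -> `|truncate y e| <= y.
Proof. by move=> y0; rewrite /truncate; case: ifP => //; rewrite normr0. Qed.

Lemma measurable_truncate (R : realType) (y : R) : measurable_fun setT (truncate y).
Proof.
apply: measurable_fun_ifT => //.
by apply: measurable_fun_ler => //; exact: normr_measurable.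
Qed.

Section concentration.
Context {R : realType} {n W : nat} (S : rsrf_model R n W).
Hypotheses (ind : sources_independent S) (draws : draws_law S)
  (reg : regression_setting S) (sym : noise_symmetric S).
Variables (M y : R).
Hypotheses (bounded : regression_bounded S M) (y0 : 0 <= y).
Local Notation P := (Pr S).
Local Notation d := (ndim S).

Definition law : probability (d.-tuple R) R := distribution P (Xnew S).

Let inX i w : cell_set unit_cell (X S i w).
Proof. by have [_ _ + _ _] := reg; exact. Qed.

Lemma bound_ge0 : 0 <= M.
Proof.
have x0 : cell_set unit_cell ([tuple (0 : R) | _ < d]).
  by apply/forallP => j; rewrite tnth_mktuple in_itv/= lexx ler01.
exact: le_trans (normr_ge0 _) (bounded x0).
Qed.

Lemma regression_le x : `|regression S x| <= M.
Proof.
rewrite /regression patchE; case: ifPn => [/set_mem/bounded//|_].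
by rewrite normr0 bound_ge0.
Qed.

Let mreg := measurable_regression reg.

Lemma law_X i B : measurable B -> P (X S i @^-1` B) = law B.
Proof. by move=> mB; have [_ _ _ + _] := reg; move=> /(_ i B mB). Qed.

(** A sample with bounded responses for which the exponential inequality
    holds, and which coincides with the data unless a noise is large. *)
Definition truncated_sample (w : Omega S) : sample R n d :=
  [tuple (X S i w, regression S (X S i w) + truncate y (eps S i w)) | i < n].

Lemma truncated_sample_data w : (forall i, `|eps S i w| <= y) ->
  truncated_sample w = data w.
Proof.
move=> small; apply: eq_from_tnth => i.
by rewrite !tnth_mktuple /Y regressionE// /truncate small.
Qed.

Lemma truncated_sample_le w p : p \in (truncated_sample w : seq _) ->
  `|p.2| <= M + y.
Proof.
move=> /mapP[i _ ->] /=; apply: (le_trans (ler_normD _ _)); apply: lerD.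
  exact: regression_le.
exact: truncate_le.
Qed.

Definition count_deviation (C : cell R d) (z : d.-tuple R * R) : R :=
  (in_cell C z.1)%:R - cmass law C.

Definition total_deviation (C : cell R d) (z : d.-tuple R * R) : R :=
  (in_cell C z.1)%:R * (regression S z.1 + truncate y z.2) -
  cmoment law (regression S) C.

Let measurable_in (C : cell R d) : measurable_fun setT
  (fun z : d.-tuple R * R => (in_cell C z.1)%:R : R).
Proof.
have -> : (fun z : d.-tuple R * R => (in_cell C z.1)%:R : R) =
    \1_(cell_set C) \o fst.
  apply/funext => z /=; rewrite indicE; congr (nat_of_bool _)%:R.
  by apply/idP/idP => [h|/set_mem//]; rewrite mem_set.
apply: measurableT_comp => //; apply: measurable_indic; exact: measurable_cell_set.
Qed.

Lemma measurable_count_deviation C : measurable_fun setT (count_deviation C).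
Proof. exact: measurable_funB. Qed.

Lemma measurable_total_deviation C : measurable_fun setT (total_deviation C).
Proof.
apply: measurable_funB => //; apply: measurable_funM => //.
apply: measurable_funD; first exact: (measurableT_comp mreg measurable_fst).
exact: (measurableT_comp (@measurable_truncate R y) measurable_snd).
Qed.

Lemma sum_count_deviation C w :
  \sum_(i < n) count_deviation C (observation S i w) =
  count_in (truncated_sample w) C - n%:R * cmass law C.
Proof.
rewrite count_inE [in RHS]big_mkcond [in RHS]big_tuple /count_deviation sumrB; congr (_ - _).
  by apply: eq_bigr => i _; rewrite tnth_mktuple /=; case: in_cell.
by rewrite sumr_const card_ord mulr_natl.
Qed.

Lemma sum_total_deviation C w :
  \sum_(i < n) total_deviation C (observation S i w) =
  total_in (truncated_sample w) C - n%:R * cmoment law (regression S) C.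
Proof.
rewrite /total_in [in RHS]big_mkcond [in RHS]big_tuple /total_deviation sumrB; congr (_ - _).
  apply: eq_bigr => i _; rewrite tnth_mktuple /=.
  by case: in_cell; rewrite ?mul1r ?mul0r.
by rewrite sumr_const card_ord mulr_natl.
Qed.

Let M0 := bound_ge0.
Hypothesis B1 : 1 <= M + y.
Let B := M + y.

Lemma count_deviation_le C z : `|count_deviation C z| <= 2 * B.
Proof.
apply: (@le_trans _ _ 1); last by apply: (le_trans B1); rewrite ler_peMl ?ler1n// (le_trans ler01 B1).
have p0 := cmass_ge0 law C; have p1 : cmass law C <= 1 by exact: (mass_le1 law (measurable_cell_set C)).
by rewrite /count_deviation; case: in_cell; rewrite ler_norml/=; lra.
Qed.

Lemma total_deviation_le C z : `|total_deviation C z| <= 2 * B.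
Proof.
have := cmoment_le law mreg regression_le C.
have p1 : cmass law C <= 1 by exact: (mass_le1 law (measurable_cell_set C)).
have p0 := cmass_ge0 law C.
have Mp : M * cmass law C <= M by rewrite ler_piMr.
have h : `|(in_cell C z.1)%:R * (regression S z.1 + truncate y z.2)| <= B.
  rewrite normrM; apply: (@le_trans _ _ (1 * B)); last by rewrite mul1r.
  apply: ler_pM => //; first by case: in_cell; rewrite ?normr1 ?normr0.
  apply: (le_trans (ler_normD _ _)); apply: lerD; first exact: regression_le.
  exact: truncate_le.
move=> h2; apply: (le_trans (ler_normB _ _)); have -> : 2 * B = B + B by ring.
apply: lerD => //; apply: (le_trans h2); apply: (le_trans Mp).
by rewrite /B lerDl.
Qed.

Let mX i (C : cell R d) : measurable (X S i @^-1` cell_set C).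
Proof. by apply: measurable_funPTI; exact: measurable_cell_set. Qed.

Let inE' i (C : cell R d) w :
  (in_cell C (X S i w))%:R = \1_(X S i @^-1` cell_set C) w :> R.
Proof.
rewrite indicE; congr (nat_of_bool _)%:R.
by apply/idP/idP => [h|/set_mem//]; rewrite mem_set.
Qed.

Let integrable_bounded (g : Omega S -> R) (K : R) : measurable_fun setT g ->
  (forall w, `|g w| <= K) -> P.-integrable setT (EFin \o g).
Proof. by move=> mg gK; exact: (bounded_integrable P measurableT mg gK). Qed.

Lemma count_deviation_mean C i :
  (\int[P]_w (count_deviation C (observation S i w))%:E = 0)%E.
Proof.
under eq_integral do rewrite /count_deviation/= inE' EFinB.
rewrite integralB//; last 2 first.
- apply: (integrable_bounded (K := 1)); first exact: measurable_indic.
  by move=> w; rewrite indicE; case: (_ \in _); rewrite ?normr1 ?normr0.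
- exact: (integrable_bounded (K := `|cmass law C|)).
rewrite integral_indic//= setIT law_X; last exact: measurable_cell_set.
rewrite integral_cst//= probability_setT mule1 /cmass massK ?subee//.
  by rewrite fin_num_measure//; exact: measurable_cell_set.
exact: measurable_cell_set.
Qed.

(** The noise is independent of the covariate; stated for nonnegative
    functions, to be used for the positive and the negative part. *)
Let noise_part (s : R -> R) i C :
  measurable_fun setT s -> (forall e, 0 <= s e) ->
  (\int[P]_w (s (eps S i w) * \1_(X S i @^-1` cell_set C) w)%:E =
   law (cell_set C) * \int[P]_w (s (eps S i w))%:E)%E.
Proof.
move=> ms s0; under eq_integral do rewrite EFinM.
rewrite (ge0_integral_event ind draws (D1 := [set SrcEps i]) (D2 := [set SrcX i])).
- by rewrite law_X//; exact: measurable_cell_set.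
- by apply/seteqP; split => // ? [/= ->].
- apply: sub_sigma_algebra; exists (SrcX i) => //.
  by exists (cell_set C); [exact: measurable_cell_set|rewrite setTI].
- apply/measurable_EFinP; apply: (measurableT_comp (f := s)) => //.
  exact: (@measurable_source _ _ _ S [set SrcEps i] (SrcEps i)).
- by move=> w; rewrite lee_fin.
Qed.

Let noise_reflect (s : R -> R) i : measurable_fun setT s -> (forall e, 0 <= s e) ->
  (\int[P]_w (s (eps S i w))%:E = \int[P]_w (s (- eps S i w))%:E)%E.
Proof.
move=> ms s0.
have mN : measurable_fun setT (fun w => - eps S i w).
  exact: (measurableT_comp (@oppr_measurable R setT)).
pose N := HB.pack_for {mfun Omega S >-> R} (fun w => - eps S i w)
  (isMeasurableFun.Build _ _ _ _ _ mN).
transitivity (\int[distribution P (eps S i)]_e (s e)%:E)%E.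
  by rewrite ge0_integral_distribution//; exact/measurable_EFinP.
transitivity (\int[distribution P N]_e (s e)%:E)%E; last first.
  by rewrite ge0_integral_distribution//; exact/measurable_EFinP.
by apply: eq_measure_integral => A mA _; exact: (sym.2 i A mA).
Qed.

(** The term in m has the mean of the moment of C since X_i is distributed as
    X; the noise term vanishes because its positive and negative parts have
    the same integral by symmetry. *)
Lemma total_deviation_mean C i :
  (\int[P]_w (total_deviation C (observation S i w))%:E = 0)%E.
Proof.
have mC := measurable_cell_set C.
pose g w := \1_(X S i @^-1` cell_set C) w * regression S (X S i w).
pose tp w := truncate y (eps S i w) * \1_(X S i @^-1` cell_set C) w.
have mi : measurable_fun setT (\1_(X S i @^-1` cell_set C) : Omega S -> R).
  exact: measurable_indic.
have mg : measurable_fun setT g.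
  by apply: measurable_funM => //; exact: (measurableT_comp mreg).
have mt : measurable_fun setT tp.
  by apply: measurable_funM => //; exact: (measurableT_comp (@measurable_truncate R y)).
have i1 w : `|\1_(X S i @^-1` cell_set C) w| <= 1 :> R.
  by rewrite indicE; case: (_ \in _); rewrite ?normr1 ?normr0.
have ig : P.-integrable setT (EFin \o g).
  apply: (integrable_bounded (K := 1 * M)) => // w.
  by rewrite normrM ler_pM// regression_le.
have it : P.-integrable setT (EFin \o tp).
  apply: (integrable_bounded (K := y * 1)) => // w.
  by rewrite normrM ler_pM// truncate_le.
have igt : P.-integrable setT (EFin \o (fun w => g w + tp w)).
  by have := integrableD measurableT ig it; apply: eq_integrable.
transitivity (\int[P]_w ((g w + tp w) - cmoment law (regression S) C)%:E)%E.
  apply: eq_integral => w _; rewrite /total_deviation/= inE' /g /tp.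
  by congr (_%:E); ring.
under eq_integral do rewrite EFinB.
rewrite integralB//; last exact: (integrable_bounded (K := `|cmoment law (regression S) C|)).
under eq_integral do rewrite EFinD.
rewrite integralD//.
have -> : (\int[P]_w (tp w)%:E = 0)%E.
  rewrite integralE.
  have -> : (\int[P]_w (fun x => (tp x)%:E)^\+ w =
      law (cell_set C) * \int[P]_w (Num.max (truncate y (eps S i w)) 0)%:E)%E.
    rewrite -(noise_part (s := fun e => Num.max (truncate y e) 0)); last 2 first.
    - by apply: measurable_maxr => //; exact: measurable_truncate.
    - by move=> e; rewrite le_max lexx orbT.
    apply: eq_integral => w _; rewrite /tp funeposE -EFin_max indicE.
    by case: (_ \in _); rewrite ?mulr1// ?mulr0 maxxx.
  have -> : (\int[P]_w (fun x => (tp x)%:E)^\- w =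
      law (cell_set C) * \int[P]_w (Num.max (truncate y (eps S i w)) 0)%:E)%E.
    rewrite (noise_reflect (s := fun e => Num.max (truncate y e) 0)); last 2 first.
    - by apply: measurable_maxr => //; exact: measurable_truncate.
    - by move=> e; rewrite le_max lexx orbT.
    rewrite -(noise_part (s := fun e => Num.max (truncate y (- e)) 0)); last 2 first.
    - apply: measurable_maxr => //; apply: (measurableT_comp (@measurable_truncate R y)).
      exact: oppr_measurable.
    - by move=> e; rewrite le_max lexx orbT.
    apply: eq_integral => w _; rewrite /tp funenegE -EFinN -EFin_max truncateN indicE.
    by case: (_ \in _); rewrite ?mulr1// ?mulr0 ?oppr0 maxxx.
  rewrite subee// fin_numM//; first by rewrite fin_num_measure.
  have := @integrable_fin_num _ _ _ P setT measurableT
    (fun w => (Num.max (truncate y (eps S i w)) 0)%:E); apply.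
  apply: (integrable_bounded (K := y)).
    apply: (measurableT_comp (f := fun e => Num.max (truncate y e) 0)) => //.
    by apply: measurable_maxr => //; exact: measurable_truncate.
  move=> w; have := truncate_le (eps S i w) y0; rewrite ler_norml => /andP[h1 h2].
  by rewrite ler_norml maxEle; case: ifP => _; rewrite ?h1 ?h2 ?oppr_le0 ?y0.
rewrite adde0.
have -> : (\int[P]_w (g w)%:E = \int[law]_(x in cell_set C) (regression S x)%:E)%E.
  have mG : measurable_fun setT (fun x => (\1_(cell_set C) x * regression S x)%:E).
    by apply/measurable_EFinP; apply: measurable_funM => //; exact: measurable_indic.
  transitivity (\int[distribution P (X S i)]_x (\1_(cell_set C) x * regression S x)%:E)%E.
    by rewrite integral_distribution//.
  transitivity (\int[law]_x (\1_(cell_set C) x * regression S x)%:E)%E.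
    by apply: eq_measure_integral => A mA _; exact: law_X.
  rewrite [RHS]integral_mkcond; apply: eq_integral => x _.
  by rewrite patchE indicE; case: (_ \in _); rewrite ?mul1r ?mul0r.
have ir := bounded_integrable law mC mreg regression_le.
have cfin : (\int[law]_(x in cell_set C) (regression S x)%:E \is a fin_num)%E.
  exact: (integrable_fin_num mC ir).
rewrite /cmoment /moment /Rintegral integral_cst//= probability_setT mule1.
by rewrite fineK// subee.
Qed.

(** Kept as four one-sided events, so that a single upper tail bound applied
    to both signs covers them all. *)
Definition deviating (r : R) (C : cell R d) : set (Omega S) :=
  [set w | n%:R * r <= \sum_(i < n) count_deviation C (observation S i w)] `|`
  [set w | n%:R * r <= \sum_(i < n) - count_deviation C (observation S i w)] `|`
  ([set w | n%:R * r <= \sum_(i < n) total_deviation C (observation S i w)] `|`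
   [set w | n%:R * r <= \sum_(i < n) - total_deviation C (observation S i w)]).

Let measurable_upper (r : R) (h : d.-tuple R * R -> R) : measurable_fun setT h ->
  measurable [set w | n%:R * r <= \sum_(i < n) h (observation S i w)].
Proof.
move=> mh.
have mS : measurable_fun setT (fun w => \sum_(i < n) h (observation S i w)).
  by apply: measurable_sum => i; exact: (measurableT_comp mh).
have mler : measurable_fun setT (fun w => n%:R * r <= \sum_(i < n) h (observation S i w)).
  exact: measurable_fun_ler.
by have := mler measurableT [set true] I; rewrite setTI.
Qed.

Let mcN C : measurable_fun setT (fun z => - count_deviation C z).
Proof. exact: (measurableT_comp (@oppr_measurable R setT) (measurable_count_deviation C)). Qed.

Let mtN C : measurable_fun setT (fun z => - total_deviation C z).
Proof. exact: (measurableT_comp (@oppr_measurable R setT) (measurable_total_deviation C)). Qed.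

Lemma measurable_deviating r C : measurable (deviating r C).
Proof.
apply: measurableU; apply: measurableU.
- exact: (measurable_upper r (measurable_count_deviation C)).
- exact: (measurable_upper r (mcN C)).
- exact: (measurable_upper r (measurable_total_deviation C)).
- exact: (measurable_upper r (mtN C)).
Qed.

Lemma deviating_prob r C : 0 <= r <= 1 ->
  (P (deviating r C) <= (4 * expR (- (n%:R * r ^+ 2 / (32 * B ^+ 2))))%:E)%E.
Proof.
move=> /andP[r0 r1].
have B0 : 0 < 2 * B by rewrite mulr_gt0// (lt_le_trans ltr01).
have rB : 0 <= r <= 2 * B.
  by rewrite r0 (le_trans r1)// (le_trans B1)// ler_peMl ?ler1n// (le_trans ler01 B1).
have e32 : 8 * (2 * B) ^+ 2 = 32 * B ^+ 2 by ring.
have one (h : d.-tuple R * R -> R) : measurable_fun setT h -> (forall z, `|h z| <= 2 * B) ->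
    (forall i, (\int[P]_w (h (observation S i w))%:E = 0)%E) ->
    (P [set w | (n%:R * r <= \sum_(i < n) h (observation S i w))%R] <=
     (expR (- (n%:R * r ^+ 2 / (32 * B ^+ 2))))%:E)%E.
  by move=> mh hB h0; have := chernoff_upper ind draws mh hB h0 B0 rB; rewrite e32.
have meanN (h : d.-tuple R * R -> R) i : measurable_fun setT h -> (forall z, `|h z| <= 2 * B) ->
    (\int[P]_w (h (observation S i w))%:E = 0)%E ->
    (\int[P]_w (- h (observation S i w))%:E = 0)%E.
  move=> mh hB h0.
  have ih : P.-integrable setT (EFin \o (fun w => h (observation S i w))).
    by apply: (integrable_bounded (K := 2 * B)) => //; exact: (measurableT_comp mh).
  under eq_integral do rewrite -mulN1r EFinM.
  by rewrite integralZl// h0 mule0.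
have c1 := one _ (measurable_count_deviation C) (count_deviation_le C) (count_deviation_mean C).
have c2 := one _ (mcN C) _ _.
have t1 := one _ (measurable_total_deviation C) (total_deviation_le C) (total_deviation_mean C).
have t2 := one _ (mtN C) _ _.
have -> : (4 * expR (- (n%:R * r ^+ 2 / (32 * B ^+ 2))))%:E =
    (((expR (- (n%:R * r ^+ 2 / (32 * B ^+ 2))))%:E + (expR (- (n%:R * r ^+ 2 / (32 * B ^+ 2))))%:E) +
     ((expR (- (n%:R * r ^+ 2 / (32 * B ^+ 2))))%:E + (expR (- (n%:R * r ^+ 2 / (32 * B ^+ 2))))%:E))%E.
  by rewrite -!EFinD; congr (_%:E); ring.
have m1 := measurable_upper r (measurable_count_deviation C).
have m2 := measurable_upper r (mcN C).
have m3 := measurable_upper r (measurable_total_deviation C).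
have m4 := measurable_upper r (mtN C).
apply: (le_trans (measureU2 _ (measurableU _ _ m1 m2) (measurableU _ _ m3 m4))).
apply: leeD; apply: (le_trans (measureU2 _ _ _)) => //; apply: leeD.
- exact: c1.
- apply: c2 => [z|i]; first by rewrite normrN; exact: count_deviation_le.
  apply: meanN; [exact: measurable_count_deviation|exact: count_deviation_le|exact: count_deviation_mean].
- exact: t1.
- apply: t2 => [z|i]; first by rewrite normrN; exact: total_deviation_le.
  apply: meanN; [exact: measurable_total_deviation|exact: total_deviation_le|exact: total_deviation_mean].
Qed.

Lemma not_deviating_close r C w : (0 < n)%N -> ~ deviating r C w ->
  sample_close (truncated_sample w) r law (regression S) C.
Proof.
move=> n0 ndev; have nR0 : (0 : R) < n%:R by rewrite ltr0n.
have [[h1 h2] [h3 h4]] : ((\sum_(i < n) count_deviation C (observation S i w) < n%:R * r) /\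
   (\sum_(i < n) - count_deviation C (observation S i w) < n%:R * r)) /\
   ((\sum_(i < n) total_deviation C (observation S i w) < n%:R * r) /\
   (\sum_(i < n) - total_deviation C (observation S i w) < n%:R * r)).
  by split; split; rewrite ltNge; apply/negP => h; apply: ndev;
    [left; left|left; right|right; left|right; right].
move: h1 h2 h3 h4; rewrite !sumrN sum_count_deviation sum_total_deviation.
have e (a b : R) : a / n%:R - b = (a - n%:R * b) / n%:R.
  by field; rewrite gt_eqF.
move=> h1 h2 h3 h4; split; rewrite e ler_norml ler_pdivrMr// ler_pdivlMr//;
  apply/andP; split; lra.
Qed.

End concentration.

(** * Nodes of the tree *)

Lemma big_tuple_cons (T : finType) (V : nmodType) (l : nat) (F : seq T -> V) :
  \sum_(a : l.+1.-tuple T) F a = \sum_(a : l.-tuple T) \sum_(b : T) F (b :: a).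
Proof.
rewrite pair_bigA /=.
rewrite (reindex (fun p : l.-tuple T * T => [tuple of p.2 :: p.1])) //=.
exists (fun a : l.+1.-tuple T => ([tuple of behead a], thead a)) => [[a b] _|a _] /=.
  by congr pair; exact: val_inj.
by rewrite [RHS]tuple_eta.
Qed.

Lemma sum_bool2 (V : nmodType) (F : bool * bool -> V) :
  \sum_(b : bool * bool) F b = F (false, false) + F (false, true) +
    (F (true, false) + F (true, true)).
Proof.
transitivity (\sum_(b1 : bool) \sum_(b2 : bool) F (b1, b2)).
  by rewrite pair_bigA; apply: eq_bigr => -[].
by rewrite !big_bool/= addrC; congr (_ + _); rewrite addrC.
Qed.

Section tree.
Context {R : realType} {n W : nat} (S : rsrf_model R n W).
Local Notation d := (ndim S).
Implicit Types (a : node) (w : Omega S).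

Definition chosen_split a w : double_split R d :=
  let t := tree_cell a w in
  candidate a w t (best S (data w) t (candidate a w t) (best_seed S a w)).

Lemma tree_cell_cons b a w :
  tree_cell (b :: a) w = granddaughter (tree_cell a w) (chosen_split a w) b.
Proof. by []. Qed.

(** Each level of the tree adds two half-spaces; uniform control over all
    intersections of a bounded number of half-spaces thus covers the data-
    dependent cells of the tree. *)
Lemma tree_cell_cuts a w :
  exists2 s : seq (halfspace R d), tree_cell a w = cuts s & size s = (size a).*2.
Proof.
elim: a => [|b a [s IH sz]]; first by exists [::].
rewrite tree_cell_cons IH granddaughter_cuts; eexists; first by [].
by rewrite /= sz doubleS.
Qed.

Lemma tree_cell_sub a w : cell_set (tree_cell a w) `<=` cell_set unit_cell.
Proof.
have [s -> _] := tree_cell_cuts a w; move=> x.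
by rewrite /cell_set/= in_cuts => /andP[].
Qed.

Section additive.
Variables (V : nmodType) (F : cell R d -> V).
Hypothesis FD : forall t c, F t = F (daughter t c false) + F (daughter t c true).

Lemma additive_granddaughters t (s : double_split R d) :
  \sum_(b : bool * bool) F (granddaughter t s b) = F t.
Proof. by rewrite sum_bool2 /granddaughter/= -!FD. Qed.

Lemma additive_tree l w : \sum_(a : l.-tuple (bool * bool)) F (tree_cell a w) = F unit_cell.
Proof.
elim: l => [|l IH].
  rewrite (eq_bigr (fun=> F unit_cell)) => [|a _]; last by rewrite (tuple0 a).
  by rewrite sumr_const card_tuple expn0 mulr1n.
rewrite (big_tuple_cons l (fun a => F (tree_cell a w))) -IH; apply: eq_bigr => a _.
exact: additive_granddaughters.
Qed.

End additive.

Lemma tree_partition l w x :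
  \sum_(a : l.-tuple (bool * bool)) ((in_cell (tree_cell a w) x)%:R : R) =
  (in_cell unit_cell x)%:R.
Proof.
apply: (additive_tree (F := fun t => (in_cell t x)%:R)) => t c.
rewrite !in_daughter; case: in_cell => //=; last by rewrite addr0.
by case: (_ <= _); rewrite /= ?addr0 ?add0r.
Qed.

(** A sum over the leaves selects the only leaf that contains the point. *)
Lemma tree_select l w x (F : R -> R) (G : l.-tuple (bool * bool) -> R) : F 0 = 0 ->
  F (\sum_(a : l.-tuple (bool * bool)) G a * (in_cell (tree_cell a w) x)%:R) =
  \sum_(a : l.-tuple (bool * bool)) F (G a) * (in_cell (tree_cell a w) x)%:R.
Proof.
move=> F0; have := tree_partition l w x.
have [/forallP none|] := boolP [forall a : l.-tuple (bool * bool), ~~ in_cell (tree_cell a w) x].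
  move=> _; rewrite !big1 ?F0// => a _; rewrite (negbTE (none a)) mulr0//.
move=> /forallPn[a0]; rewrite negbK => a0x.
rewrite (bigD1 a0)//= a0x => h.
have z (v : l.-tuple (bool * bool)) : v != a0 -> in_cell (tree_cell v w) x = false.
  move=> va0; apply/negbTE/negP => vx.
  have : (1 : R) + 1 <= (in_cell unit_cell x)%:R.
    rewrite -h lerD2l (bigD1 v)//= vx lerDl sumr_ge0//.
  by case: in_cell => /=; lra.
rewrite (bigD1 a0)//= a0x mulr1 big1 ?addr0; last by move=> v /z ->; rewrite mulr0.
by rewrite (bigD1 a0)//= a0x mulr1 big1 ?addr0// => v /z ->; rewrite mulr0.
Qed.

(** An almost sure event on which every cell of the tree is a rectangle of
    positive measure, as the condition on random splits presupposes. *)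
Definition interior_draws w := forall a (i : 'I_W), 0 < unif S a i w < 1.

Lemma rectangular_sides (t : cell R d) j : rectangular t ->
  (exists cl cr lo hi, t = sides cl cr lo hi) ->
  left_end (t j) < right_end (t j) /\
  lebesgue_measure [set` t j] = (right_end (t j) - left_end (t j))%:E /\
  [set` t j] `<=` `[left_end (t j), right_end (t j)].
Proof.
move=> rt [cl [cr [lo [hi tE]]]]; have [_] := rt j; rewrite tE /sides/=.
rewrite lebesgue_measure_itv /= lte_fin.
case: ifPn => [lh _|_]; last by rewrite ltxx.
split => //; split => // x /=; rewrite in_itv /= in_itv /= => /andP[h1 h2].
by rewrite (lteifW h1) (lteifW h2).
Qed.

Lemma cuts_sides (s : seq (halfspace R d)) :
  exists cl cr lo hi, cuts s = sides cl cr lo hi.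
Proof.
have h : random_cell (fun _ : unit => cuts s).
  elim: s => [|[[j c] b] s IH]; first exact: random_cell_unit.
  exact: (random_cell_daughter b IH (measurable_finite_cst j) (measurable_cst c)).
have [cl [cr [lo [hi [_ _ _ _ e]]]]] := h.
by exists (cl^~ tt), (cr^~ tt), (lo^~ tt), (hi^~ tt); exact: (e tt).
Qed.

Lemma rectangular_interior_daughter (t : cell R d) (j : 'I_d) u b : rectangular t ->
  (exists cl cr lo hi, t = sides cl cr lo hi) -> 0 < u < 1 ->
  rectangular (daughter t (j, left_end (t j) + u * (right_end (t j) - left_end (t j))) b).
Proof.
move=> rt st /andP[u0 u1]; have [lr [_ tsub]] := rectangular_sides j rt st.
have len : 0 < right_end (t j) - left_end (t j) by rewrite subr_gt0.
set c := _ + _.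
have lc : left_end (t j) < c by rewrite ltrDl mulr_gt0.
have cr : c < right_end (t j).
  by rewrite /c -ltrBrDl -[ltRHS]mul1r ltr_pM2r.
move=> i; rewrite /daughter /=; case: eqVneq => [->|_]; last exact: rt.
split; first by move=> x /=; rewrite in_itvI => /andP[h _]; exact: (rt j).1.
move: lc cr; clearbody c; case: st => [cl [cr' [lo [hi ->]]]]; rewrite /sides /= => lc cr.
case: b; rewrite ?itv_meet_le ?itv_meet_gt lebesgue_measure_itv /= lte_fin.
  by rewrite (max_idPr (ltW lc)) cr -EFinD lte_fin subr_gt0.
by rewrite (min_idPr (ltW cr)) lc -EFinD lte_fin subr_gt0.
Qed.

Lemma rectangular_unit : rectangular (unit_cell : cell R d).
Proof. by move=> j; split => //; rewrite /unit_cell lebesgue_measure_itv/= lte_fin ltr01 oppr0 adde0 lte_fin ltr01. Qed.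

Lemma rectangular_first_split a w i b : rectangular (tree_cell a w) ->
  interior_draws w ->
  rectangular (daughter (tree_cell a w) (candidate a w (tree_cell a w) i).1 b).
Proof.
move=> rt int; apply: rectangular_interior_daughter => //.
by have [s -> _] := tree_cell_cuts a w; exact: cuts_sides.
Qed.

Lemma rectangular_tree a w : interior_draws w -> rectangular (tree_cell a w).
Proof.
move=> int; elim: a => [|b a IH]; first exact: rectangular_unit.
rewrite tree_cell_cons /chosen_split; set i := best S _ _ _ _.
have rb := rectangular_first_split i b.1 IH int.
have [[_ pos] _] := cart_splitP (cart S) (data w) (cart_seed S a i b.1 w) rb.
rewrite /granddaughter; apply: rectangular_daughter => //.
by move: (pos b.2); rewrite /candidate/=; case: b.1.
Qed.

End tree.

Section tree_scores.
Context {R : realType} {n W : nat} (S : rsrf_model R n W).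
Hypotheses (reg : regression_setting S).
Variables (M B rad : R).
Hypotheses (bounded : regression_bounded S M) (n0 : (0 < n)%N) (MB : M <= B).
Local Notation d := (ndim S).
Local Notation law := (law S).
Local Notation f := (regression S).
Implicit Types (a : node) (w : Omega S).

Definition tree_score := cell_score (cmass law) (cmoment law f).
Definition tree_double_score := double_score (cmass law) (cmoment law f).
Definition node_dispersion a w : R := dispersion law f (cell_set (tree_cell a w)).

Let mf := measurable_regression reg.
Let fM := regression_le bounded.
Let M0 := bound_ge0 bounded.

Lemma node_dispersion_ge0 a w : 0 <= node_dispersion a w.
Proof. exact: (dispersion_ge0 law mf fM (measurable_cell_set _)). Qed.

Lemma node_dispersion_le a w :
  node_dispersion a w <= M ^+ 2 * cmass law (tree_cell a w).
Proof. exact: (dispersion_le law mf fM (measurable_cell_set _)). Qed.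

Let moment2D t c : moment2 law f (cell_set t) =
  moment2 law f (cell_set (daughter t c false)) +
  moment2 law f (cell_set (daughter t c true)).
Proof.
rewrite (cell_set_daughters t c) (moment2U law mf fM)//; try exact: measurable_cell_set.
exact: cell_set_daughtersI.
Qed.

(** Second moments are additive over a split, so that only the scores that are
    subtracted from them change. *)
Lemma node_dispersion_children a w :
  \sum_(b : bool * bool) node_dispersion (b :: a) w = node_dispersion a w -
    (tree_double_score (tree_cell a w) (chosen_split a w) - tree_score (tree_cell a w)).
Proof.
have e : tree_double_score (tree_cell a w) (chosen_split a w) =
    \sum_(b : bool * bool) tree_score (tree_cell (b :: a) w).
  by rewrite sum_bool2.
rewrite e /node_dispersion /dispersion sumrB.
rewrite -(additive_granddaughters moment2D (tree_cell a w) (chosen_split a w)).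
rewrite /tree_score /cell_score /cmass /cmoment; ring.
Qed.

Lemma tree_score_le_double t s : tree_score t <= tree_double_score t s.
Proof.
have h1 := cell_score_le_split M0 (cmass_ge0 law) (cmoment_le law mf fM) (cmassD law)
  (cmomentD law mf fM).
apply: (le_trans (h1 t s.1)).
exact: (split_score_le_double M0 (cmass_ge0 law) (cmoment_le law mf fM) (cmassD law)
  (cmomentD law mf fM)).
Qed.

Lemma node_dispersion_children_le a w :
  \sum_(b : bool * bool) node_dispersion (b :: a) w <= node_dispersion a w.
Proof. by rewrite node_dispersion_children gerBl subr_ge0 tree_score_le_double. Qed.

Lemma sum_cmass_tree l w :
  \sum_(a : l.-tuple (bool * bool)) cmass law (tree_cell a w) = 1.
Proof.
have h : law (cell_set unit_cell) = 1%E.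
  rewrite -[RHS](probability_setT (Pr S)); congr (Pr S _).
  by apply/seteqP; split => // v _; have [_ + _ _ _] := reg; exact.
by rewrite (additive_tree (cmassD law)) /cmass /mass h.
Qed.

Hypothesis law_null : forall t : cell R d, lebesgue_tuple d (cell_set t) = 0%E ->
  law (cell_set t) = 0%E.

(** Valid for each candidate and arbitrary completions, in particular for the
    ones that the condition on random splits provides. *)
Lemma chosen_split_nearly_best (K : nat) a w (i : 'I_W) :
  interior_draws w ->
  (forall p, p \in (data w : seq _) -> `|p.2| <= B) ->
  (forall s : seq (halfspace R d), (size s <= K)%N ->
    sample_close (data w) rad law f (cuts s)) ->
  ((size a).*2.+2 <= K)%N ->
  forall c1 c2, tree_double_score (tree_cell a w)
      ((candidate a w (tree_cell a w) i).1, (c1, c2)) <=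
    tree_double_score (tree_cell a w) (chosen_split a w) +
      8 * ((2 * B + B ^+ 2) * rad).
Proof.
move=> int dB close aK c1 c2.
have B0 : 0 <= B by exact: le_trans MB.
pose cs b := cart S (data w) (daughter (tree_cell a w) (candidate a w (tree_cell a w) i).1 b)
  (cart_seed S a i b w).
apply: (greedy_double_score n0 B0 dB mf fM MB law_null (c := cs)).
- move=> b; apply: cart_splitP; apply: rectangular_first_split => //.
  exact: rectangular_tree.
- exact: best_indexP.
- move=> s b; have [q -> sz] := tree_cell_cuts a w.
  by rewrite granddaughter_cuts; apply: close => /=; rewrite sz.
Qed.

End tree_scores.

(** * Good first splits *)

Section good_first_split.
Context {R : realType} {n W : nat} (S : rsrf_model R n W).
Hypotheses (ind : sources_independent S) (draws : draws_law S)
  (reg : regression_setting S).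
Variables (M B rad fmax alpha1 delta : R) (N : nat).
Hypotheses (bounded : regression_bounded S M) (N0 : (0 < N)%N) (MB : M <= B)
  (B1 : 1 <= B) (fmax0 : 0 <= fmax) (rad_grid : 2 * B * (fmax / N%:R) <= rad)
  (alpha0 : 1 <= alpha1) (delta0 : 0 <= delta).
Local Notation d := (ndim S).
Local Notation law := (law S).
Local Notation f := (regression S).
Local Notation score2 := (tree_double_score (S := S)).
Local Notation score1 := (tree_score (S := S)).
Hypothesis law_slab : forall q : halfspace R d,
  cmass law (cuts (slab N q)) <= fmax / N%:R.
Hypothesis first_split : random_split_condition law (m S) alpha1 delta.
Implicit Types (t : cell R d) (c : split_point R d).

Let rho := (2 * B + B ^+ 2) * rad.
Let mf := measurable_regression reg.
Let fM := regression_le bounded.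
Let M0 := bound_ge0 bounded.
Let fN0 : 0 <= fmax / N%:R. Proof. by rewrite divr_ge0. Qed.
Let B0 : 0 <= B. Proof. exact: le_trans B1. Qed.
Let rad0 : 0 <= rad. Proof. by apply: le_trans rad_grid; rewrite !mulr_ge0. Qed.
Let rho0 : 0 <= rho.
Proof. by rewrite mulr_ge0// addr_ge0 ?mulr_ge0 ?sqr_ge0. Qed.

Definition grid_split c : split_point R d := (c.1, grid_point N (grid_index N c.2)).

Let score_close u c b : cell_set u `<=` cell_set unit_cell ->
  score1 (daughter u c b) <= score1 (daughter u (grid_split c) b) + rho.
Proof.
move=> uu; rewrite -lerBlDl; apply: (le_trans (ler_norm _)).
have mc (v : cell R d) : measurable (cell_set v) by exact: measurable_cell_set.
have [|h1 h2] := @mass_moment_close _ _ _ law f M mf fM (cell_set (daughter u c b))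
  (cell_set (daughter u (grid_split c) b)) (cell_set (cuts (slab N (c, b)))) (mc _) (mc _) (mc _).
  have e x : ~ cell_set (cuts (slab N (c, b))) x ->
      in_cell (daughter u c b) x = in_cell (daughter u (grid_split c) b) x.
    move=> nx; rewrite !in_daughter; have [xu|//] := boolP (in_cell u x).
    apply: contrapT => /eqP ne; apply: nx; apply: (grid_cut_slab N0) => //.
    exact: uu.
  by apply/seteqP; split => x [xs nx]; split => //; move: xs; rewrite /cell_set/= e.
have hs := law_slab (c, b); rewrite -/(cmass _ _) in h1.
apply: (score_lipschitz B0 (cmass_ge0 _ _) (cmass_ge0 _ _)).
- by apply: (le_trans (cmoment_le law mf fM _)); rewrite ler_wpM2r ?cmass_ge0.
- by apply: (le_trans (cmoment_le law mf fM _)); rewrite ler_wpM2r ?cmass_ge0.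
- apply: (le_trans h1); apply: (le_trans hs); apply: le_trans rad_grid.
  by rewrite ler_peMl// mulr_ege1// ler1n.
- apply: (le_trans h2); apply: le_trans rad_grid; apply: ler_pM => //.
  + by rewrite mulr_ge0.
  + exact: cmass_ge0.
  + by rewrite ler_wpM2l.
Qed.

Lemma grid_double_score t c0 c1 c2 : cell_set t `<=` cell_set unit_cell ->
  score2 t (c0, (c1, c2)) <= score2 t (c0, (grid_split c1, grid_split c2)) + 4 * rho.
Proof.
move=> tu; rewrite /tree_double_score /double_score /split_score /=.
have du b : cell_set (daughter t c0 b) `<=` cell_set unit_cell.
  exact: subset_trans (@daughter_sub _ _ _ _ _) tu.
have := score_close c1 false (du false); have := score_close c1 true (du false).
have := score_close c2 false (du true); have := score_close c2 true (du true).
rewrite /tree_score; lra.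
Qed.

Let cond_mean_eq A : A `<=` cell_set unit_cell ->
  cond_mean law (m S) A = cond_mean law f A.
Proof.
move=> Au; rewrite /cond_mean; congr (_ / _); apply: eq_Rintegral => x /set_mem/Au.
by move=> xu; rewrite regressionE.
Qed.

Lemma dispersion_cond_variance t : cell_set t `<=` cell_set unit_cell ->
  cmass law t * cond_variance law (m S) (cell_set t) = dispersion law f (cell_set t).
Proof.
move=> tu; rewrite -(cmass_cond_variance law mf fM); congr (_ * _).
rewrite /cond_variance cond_mean_eq//; congr (_ / _).
by apply: eq_Rintegral => x /set_mem/tu xu; rewrite regressionE.
Qed.

Lemma cmass_double_split t s : cell_set t `<=` cell_set unit_cell ->
  cmass law t * impurity_decrease law (m S) t (granddaughters t s) =
  score2 t s - score1 t.
Proof.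
move=> tu; rewrite /tree_double_score /tree_score -(cmass_impurity_decrease law mf fM)//.
congr (_ * _); rewrite /impurity_decrease !big_cons !big_nil.
have gu b : cell_set (granddaughter t s b) `<=` cell_set unit_cell.
  exact: subset_trans (subset_trans (@daughter_sub _ _ _ _ _) (@daughter_sub _ _ _ _ _)) tu.
by rewrite !cond_mean_eq.
Qed.

Let grid2 := (('I_d * 'I_N.+3) * ('I_d * 'I_N.+3))%type.
Let point (g : 'I_d * 'I_N.+3) : split_point R d := (g.1, grid_point N g.2).

(** Second splits range over the grid, up to a loss of score of 4 rho, because
    the set of good first splits is then a finite union of measurable sets,
    whereas a supremum over all second splits would be an uncountable one. *)
Definition good_at t c0 : Prop := exists g : grid2,
  dispersion law f (cell_set t) <=
    alpha1 * (score2 t (c0, (point g.1, point g.2)) - score1 t + 4 * rho).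

(** The supremum over all completions is at most the maximum over completions
    on the grid plus the cost of moving two cuts. *)
Lemma best_decrease_good t c0 : (0 < d)%N -> cell_set t `<=` cell_set unit_cell ->
  ((cond_variance law (m S) (cell_set t))%:E <=
    alpha1%:E * best_decrease law (m S) t c0)%E -> good_at t c0.
Proof.
move=> d0 tu h.
have a0 : 0 <= alpha1 by exact: le_trans alpha0.
pose F (g : grid2) := score2 t (c0, (point g.1, point g.2)).
pose g0 : grid2 := ((Ordinal d0, ord0), (Ordinal d0, ord0)).
pose g := [arg max_(g > g0) F g]%O.
have gmax g' : F g' <= F g by rewrite /g; case: arg_maxP => // i _; exact.
exists g; rewrite -/(F g).
have Fs : 0 <= F g - score1 t.
  by rewrite subr_ge0; exact: (tree_score_le_double reg bounded).
(* a cell of mass 0 has no dispersion, so that every first split is good *)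
have [p0|pn0] := eqVneq (cmass law t) 0.
  have := dispersion_le law mf fM (measurable_cell_set t).
  rewrite -/(cmass law t) p0 mulr0 => /le_trans; apply.
  by rewrite mulr_ge0// addr_ge0// mulr_ge0.
have pp : 0 < cmass law t by rewrite lt_neqAle eq_sym pn0 cmass_ge0.
pose Z := (F g - score1 t + 4 * rho) / cmass law t.
have best : (best_decrease law (m S) t c0 <= Z%:E)%E.
  apply: ge_ereal_sup => _ [c1 _ [c2 _ <-]].
  rewrite /double_split_decrease; case: ifP => _; last exact: leNye.
  rewrite lee_fin /Z ler_pdivlMr// mulrC cmass_double_split//.
  have := grid_double_score c0 c1 c2 tu.
  have gi c : (grid_index N c.2 < N.+3)%N.
    exact: ltn_trans (grid_index_lt N0 _) (ltnSn _).
  have := gmax ((c1.1, Ordinal (gi c1)), (c2.1, Ordinal (gi c2))).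
  rewrite /F /point /grid_split /=; lra.
have : ((cond_variance law (m S) (cell_set t))%:E <= alpha1%:E * Z%:E)%E.
  by apply: (le_trans h); rewrite lee_wpmul2l// lee_fin.
rewrite -EFinM lee_fin => /(ler_wpM2l (cmass_ge0 law t)).
rewrite dispersion_cond_variance// => /le_trans; apply.
have -> : cmass law t * (alpha1 * Z) = alpha1 * (F g - score1 t + 4 * rho).
  by rewrite /Z; field.
exact: lexx.
Qed.

Variable a : node.
Let T := sub_space S (past (size a)).

Let first_point (j : 'I_d) (v : T) (u : R) : R :=
  left_end (tree_cell a (v : Omega S) j) +
  u * (right_end (tree_cell a (v : Omega S) j) - left_end (tree_cell a (v : Omega S) j)).

(** In terms of the draw itself, a number in [0, 1], rather than of the split
    point, in order to be measurable jointly with the past. *)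
Definition good_draws (j : 'I_d) : set (T * R) :=
  [set p | good_at (tree_cell a (p.1 : Omega S)) (j, first_point j p.1 p.2)].

Let rt : random_cell (fun v : T => tree_cell a (v : Omega S)).
Proof. exact: (tree_cell_past reg (leqnn _)). Qed.

Lemma measurable_good_draws j : measurable (good_draws j).
Proof.
have rt1 : random_cell (fun p : T * R => tree_cell a (p.1 : Omega S)).
  exact: (random_cell_comp rt measurable_fst).
have [ml mr] := random_cell_ends j rt1.
have mp : measurable_fun setT (fun p : T * R => first_point j p.1 p.2).
  apply: measurable_funD => //; apply: measurable_funM => //.
  exact: measurable_funB.
have mc0 : random_split (fun p : T * R => (j, first_point j p.1 p.2)).
  by split => //; exact: measurable_finite_cst.
have mg g : random_split (fun p : T * R => point g).
  by split; [exact: measurable_finite_cst|exact: measurable_cst].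
have msc (t : T * R -> cell R d) : random_cell t ->
    measurable_fun setT (fun p => score1 (t p)).
  by move=> rct; exact: (measurable_cscore law mf fM rct).
have mds g : measurable_fun setT (fun p : T * R =>
    score2 (tree_cell a (p.1 : Omega S)) ((j, first_point j p.1 p.2), (point g.1, point g.2))).
  have r2 b1 g' b2 := random_cell_split b2 (random_cell_split b1 rt1 mc0) (mg g').
  by apply: measurable_funD; apply: measurable_funD; (apply: msc; exact: r2).
have -> : good_draws j = \bigcup_(g in [set: grid2]) [set p |
    dispersion law f (cell_set (tree_cell a (p.1 : Omega S))) <=
    alpha1 * (score2 (tree_cell a (p.1 : Omega S))
       ((j, first_point j p.1 p.2), (point g.1, point g.2)) -
       score1 (tree_cell a (p.1 : Omega S)) + 4 * rho)].
  by apply/seteqP; split => [p [g pg]|p [g _ pg]]; exists g.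
apply: fin_bigcup_measurable => [|g _]; first exact: finite_finset.
have mle : measurable_fun setT (fun p : T * R =>
    dispersion law f (cell_set (tree_cell a (p.1 : Omega S))) <=
    alpha1 * (score2 (tree_cell a (p.1 : Omega S))
       ((j, first_point j p.1 p.2), (point g.1, point g.2)) -
       score1 (tree_cell a (p.1 : Omega S)) + 4 * rho)).
  apply: measurable_fun_ler; first exact: (measurable_dispersion law mf fM rt1).
  apply: measurable_funM => //; apply: measurable_funD => //.
  by apply: measurable_funB; [exact: mds|exact: msc].
by have := mle measurableT [set true] I; rewrite setTI.
Qed.

Lemma good_fraction (v : T) : (0 < d)%N -> rectangular (tree_cell a (v : Omega S)) ->
  (delta%:E <= \sum_j ((d)%:R^-1)%:E *
     lebesgue_measure (xsection (good_draws j) v `&` `[0%R, 1%R]))%E.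
Proof.
move=> d0 rect; apply: (le_trans (first_split rect)).
rewrite /random_split_prob; apply: lee_sum => j _.
apply: lee_wpmul2l; first by rewrite lee_fin invr_ge0.
have sd : exists cl cr lo hi, tree_cell a (v : Omega S) = sides cl cr lo hi.
  by have [s -> _] := tree_cell_cuts a (v : Omega S); exact: cuts_sides.
have [lr [lE tsub]] := rectangular_sides j rect sd.
rewrite lE /=; set lo := left_end _ in lr lE tsub *.
set hi := right_end _ in lr lE tsub *.
have len : 0 < hi - lo by rewrite subr_gt0.
(* the good draws in terms of the split point lo + u (hi - lo) *)
pose A := affine_map (- lo / (hi - lo)) (hi - lo)^-1 @^-1` xsection (good_draws j) v.
have mA : measurable A.
  rewrite -[A]setTI; apply: measurable_affine_map => //.
  by apply: measurable_xsection; exact: measurable_good_draws.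
have -> : xsection (good_draws j) v = affine_map lo (hi - lo) @^-1` A.
  apply/seteqP; split => u; rewrite /A /= /affine_map.
    by rewrite (_ : - lo / _ + _ = u)//; field; rewrite gt_eqF.
  by rewrite (_ : - lo / _ + _ = u)//; field; rewrite gt_eqF.
rewrite lebesgue_measure_affine// lee_wpmul2r// ?lee_fin ?invr_ge0 ?(ltW len)//.
apply: lebesgue_measure_le => x [xt xE]; split; last first.
  by rewrite /= addrC subrK; exact: tsub.
rewrite /A /= /affine_map; apply/mem_set/best_decrease_good => //=.
  exact: tree_cell_sub.
rewrite /first_point -/lo -/hi (_ : lo + _ = x) //; field; rewrite gt_eqF//.
Qed.

End good_first_split.

(** * Decay of the dispersion *)

(** The errors form a geometric series of ratio 1 - k. *)
Lemma linear_recursion_le (R : realFieldType) (v : nat -> R) (k e A : R) (L : nat) :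
  0 < k <= 1 -> v 0%N <= A -> 0 <= e ->
  (forall l, (l < L)%N -> v l.+1 + k * v l <= v l + e) ->
  v L <= (1 - k) ^+ L * A + e / k.
Proof.
move=> /andP[k0 k1] vA e0 rec.
suff h l : (l <= L)%N -> v l <= (1 - k) ^+ l * A + e / k by exact: h.
elim: l => [_|l IH lL].
  by rewrite expr0 mul1r (le_trans vA)// lerDl divr_ge0// ltW.
have k1' : 0 <= 1 - k by rewrite subr_ge0.
have := ler_wpM2l k1' (IH (ltnW lL)); have := rec l lL.
have -> : (1 - k) * ((1 - k) ^+ l * A + e / k) = (1 - k) ^+ l.+1 * A + e / k - e.
  by rewrite exprS; field; rewrite gt_eqF.
lra.
Qed.

Section dispersion_decay.
Context {R : realType} {n W : nat} (S : rsrf_model R n W).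
Hypotheses (ind : sources_independent S) (draws : draws_law S)
  (reg : regression_setting S).
Variables (M B rad fmax alpha1 delta : R) (N K : nat).
Hypotheses (bounded : regression_bounded S M) (n0 : (0 < n)%N) (N0 : (0 < N)%N)
  (MB : M <= B)
  (B1 : 1 <= B) (fmax0 : 0 <= fmax) (rad_grid : 2 * B * (fmax / N%:R) <= rad)
  (alpha0 : 1 <= alpha1) (delta0 : 0 < delta <= 1) (W0 : (0 < W)%N).
Local Notation P := (Pr S).
Local Notation d := (ndim S).
Local Notation law := (law S).
Local Notation f := (regression S).
Hypothesis d0 : (0 < d)%N.
Hypothesis law_slab : forall q : halfspace R d,
  cmass law (cuts (slab N q)) <= fmax / N%:R.
Hypothesis law_null : forall t : cell R d, lebesgue_tuple d (cell_set t) = 0%E ->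
  law (cell_set t) = 0%E.
Hypothesis first_split : random_split_condition law (m S) alpha1 delta.
Variable bad : set (Omega S).
Hypotheses (mbad : measurable bad)
  (bounded_data : forall w, ~ bad w -> forall p, p \in (data w : seq _) -> `|p.2| <= B)
  (close_data : forall w, ~ bad w -> forall s : seq (halfspace R d), (size s <= K)%N ->
    sample_close (data w) rad law f (cuts s))
  (interior : {ae P, forall w, interior_draws w}).

Let rho := (2 * B + B ^+ 2) * rad.
Let mf := measurable_regression reg.
Let fM := regression_le bounded.
Let M0 := bound_ge0 bounded.
Let a0 : 0 < alpha1. Proof. exact: lt_le_trans alpha0. Qed.
Let rho0 : 0 <= rho.
Proof.
have B0 : 0 <= B by exact: le_trans B1.
have r0 : 0 <= rad by apply: le_trans rad_grid; rewrite !mulr_ge0// invr_ge0.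
by rewrite mulr_ge0// addr_ge0 ?mulr_ge0 ?sqr_ge0.
Qed.
Let i0 : 'I_W := Ordinal W0.

Definition dispersion_at (l : nat) (w : Omega S) : R :=
  \sum_(a : l.-tuple (bool * bool)) node_dispersion a w.

Let mD a : measurable_fun (setT : set (sub_space S (past (size a))))
  (fun w => node_dispersion a (w : Omega S)).
Proof. exact: (measurable_dispersion law mf fM (tree_cell_past reg (leqnn _))). Qed.

Let mDO a : measurable_fun setT (fun w => node_dispersion (S := S) a w).
Proof. exact: (measurable_sub_space draws (@mD a)). Qed.

Let D0 a w := node_dispersion_ge0 (S := S) reg bounded a w.

Lemma measurable_dispersion_at l : measurable_fun setT (fun w => dispersion_at l w).
Proof. exact: measurable_sum. Qed.

Lemma dispersion_at_ge0 l w : 0 <= dispersion_at l w.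
Proof. by apply: sumr_ge0 => a _; exact: D0. Qed.

Lemma dispersion_at_le l w : dispersion_at l w <= M ^+ 2.
Proof.
apply: (@le_trans _ _ (\sum_(a : l.-tuple (bool * bool)) M ^+ 2 * cmass law (tree_cell a w))).
  by apply: ler_sum => a _; exact: node_dispersion_le.
by rewrite -mulr_sumr sum_cmass_tree// mulr1.
Qed.

Let Q a : 'I_d -> set (sub_space S (past (size a)) * R) :=
  @good_draws R n W S B rad alpha1 N a.

(** One candidate is enough for the recursion, because the chosen split is
    nearly as good as each of the candidates; the first one is taken. *)
Let good a w : R :=
  \1_(Q (Defs.coord S a i0 w)) (w : sub_space S (past (size a)), unif S a i0 w).

Let good01 a w : good a w = 0 \/ good a w = 1.
Proof. by rewrite /good indicE; case: (_ \in _); [right|left]. Qed.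

(** On a good draw the comparison of the chosen split with the best completion
    turns the gain of the latter into a gain of the former; on a bad draw a
    split still does not increase the dispersion. *)
Let node_step a w : interior_draws w -> ~ bad w -> ((size a).*2.+2 <= K)%N ->
  \sum_(b : bool * bool) node_dispersion (b :: a) w +
    alpha1^-1 * (node_dispersion a w * good a w) <= node_dispersion a w + 12 * rho.
Proof.
move=> int nb aK; have le := node_dispersion_children_le reg bounded a w.
have r12 : 0 <= 12 * rho by rewrite mulr_ge0.
have [wQ|wnQ] := pselect ((Q (Defs.coord S a i0 w)) (w : sub_space S (past (size a)), unif S a i0 w)).
  have -> : good a w = 1 by rewrite /good indicE mem_set.
  case: wQ => g /= hg; rewrite mulr1.
  have := chosen_split_nearly_best reg bounded n0 MB law_null i0 int
    (bounded_data nb) (close_data nb) aK (g.1.1, grid_point N g.1.2) (g.2.1, grid_point N g.2.2).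
  move: hg; rewrite -/(node_dispersion a w) -ler_pdivrMl// -/rho => hg hc.
  rewrite (node_dispersion_children reg bounded).
  rewrite /candidate/= in hc.
  move: hg hc; rewrite /node_dispersion; lra.
have -> : good a w = 0 by rewrite /good indicE memNset.
by rewrite !mulr0 addr0 (le_trans le)// lerDl.
Qed.

(** On the bad event the dispersion may fail to decrease as wanted, but the
    loss is at most M^2. *)
Let level_step l w : interior_draws w -> (l.*2.+2 <= K)%N ->
  dispersion_at l.+1 w +
    \sum_(a : l.-tuple (bool * bool)) alpha1^-1 * (node_dispersion a w * good a w) <=
  dispersion_at l w + ((4 ^ l)%:R * (12 * rho) + M ^+ 2 * \1_bad w).
Proof.
move=> int lK; rewrite /dispersion_at (big_tuple_cons l (fun a => node_dispersion a w)).
have r12 : 0 <= 12 * rho by rewrite mulr_ge0.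
have [wb|nb] := pselect (bad w).
  rewrite indicE mem_set// mulr1 addrA; apply: lerD; last first.
    apply: le_trans (dispersion_at_le l w); apply: ler_sum => a _.
    have := D0 a w; case: (good01 a w) => -> Da; rewrite ?mulr0// mulr1.
    by rewrite ler_piMl// invf_le1.
  apply: (@le_trans _ _ (dispersion_at l w)); last by rewrite lerDl mulr_ge0.
  by apply: ler_sum => a _; exact: (node_dispersion_children_le reg bounded a w).
rewrite indicE memNset// mulr0 addr0 -big_split/=.
have -> : (4 ^ l)%:R * (12 * rho) = \sum_(a : l.-tuple (bool * bool)) (12 * rho).
  by rewrite sumr_const card_tuple card_prod card_bool mulr_natl.
rewrite -big_split/=; apply: ler_sum => a _; apply: node_step => //.
by rewrite size_tuple.
Qed.

(** The draw is good with conditional probability at least delta given the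
    past, which determines the dispersion of the node. *)
Let split_gain a : (delta%:E * \int[P]_w (node_dispersion a w)%:E <=
  \int[P]_w (node_dispersion a w * good a w)%:E)%E.
Proof.
have [dp _] := andP delta0.
have h := @first_split_probability _ _ _ S ind draws (size a) a i0 delta (@Q a)
  (fun w => node_dispersion a w) (leqnn _) (ltW dp).
refine (h _ _ _ _) => {h}.
- by move=> j; exact: (measurable_good_draws reg B rad alpha1 N bounded j).
- exact: (@mD a).
- by move=> v; exact: D0.
move: interior; apply: (@filterS _ _ (ae_filter_ringOfSetsType P)) => w int.
apply: (good_fraction reg bounded N0 MB B1 fmax0 rad_grid alpha0 law_slab first_split d0).
exact: rectangular_tree.
Qed.

Let E l := (\int[P]_w (dispersion_at l w)%:E)%E.

Let E_ge0 l : (0 <= E l)%E.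
Proof. by apply: integral_ge0 => w _; rewrite lee_fin dispersion_at_ge0. Qed.

Let E_le l : (E l <= (M ^+ 2)%:E)%E.
Proof.
apply: (@le_trans _ _ (\int[P]_w (M ^+ 2)%:E)%E).
  apply: ge0_le_integral => //.
  - by move=> w _; rewrite lee_fin dispersion_at_ge0.
  - by apply/measurable_EFinP; exact: measurable_dispersion_at.
  - by move=> w _; rewrite lee_fin dispersion_at_le.
by rewrite integral_cst//= probability_setT mule1.
Qed.

Let expected_step l : (l.*2.+2 <= K)%N ->
  (E l.+1 + (delta / alpha1)%:E * E l <=
   E l + ((4 ^ l)%:R * (12 * rho) + M ^+ 2 * fine (P bad))%:E)%E.
Proof.
move=> lK; have [dp _] := andP delta0.
have mgood a : measurable_fun setT (fun w => node_dispersion a w * good a w).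
  have mQ j : measurable (@Q a j) by exact: (measurable_good_draws reg B rad alpha1 N bounded j).
  apply: measurable_funM; first exact: (@mDO a).
  pose F j (w : Omega S) : R :=
    \1_(@Q a j) (w : sub_space S (past (size a)), unif S a i0 w).
  refine (@measurable_fun_glue _ _ _ (Defs.coord S a i0) _ _ F _ _).
    by move=> j; have [/(_ a i0 j)[]] := draws.
  rewrite /F.
  move=> j; apply: (measurableT_comp (f := \1_(@Q a j) : sub_space S (past (size a)) * R -> R)).
    by apply: measurable_indic; exact: mQ.
  apply: measurable_fun_pair => //.
  exact: (measurable_sub_space draws (@measurable_id _ (sub_space S (past (size a))) setT)).
have g0 a w : 0 <= node_dispersion a w * good a w.
  by rewrite mulr_ge0 ?D0//; case: (good01 a w) => ->.
pose G w := \sum_(a : l.-tuple (bool * bool)) alpha1^-1 * (node_dispersion a w * good a w).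
have mG : measurable_fun setT G.
  by apply: measurable_sum => a; apply: measurable_funM.
have G0 w : 0 <= G w.
  by apply: sumr_ge0 => a _; rewrite mulr_ge0 ?g0// invr_ge0 ltW.
have r12 : 0 <= 12 * rho by rewrite mulr_ge0.
have lhs : (\int[P]_w (dispersion_at l.+1 w + G w)%:E = E l.+1 + \int[P]_w (G w)%:E)%E.
  under eq_integral do rewrite EFinD.
  rewrite ge0_integralD//.
  - by move=> w _; rewrite lee_fin dispersion_at_ge0.
  - by apply/measurable_EFinP; exact: measurable_dispersion_at.
  - by move=> w _; rewrite lee_fin.
  - exact/measurable_EFinP.
have mrhs : measurable_fun setT (fun w => (4 ^ l)%:R * (12 * rho) + M ^+ 2 * \1_bad w : R).
  apply: measurable_funD => //; apply: measurable_funM => //.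
have rhs0 w : 0 <= (4 ^ l)%:R * (12 * rho) + M ^+ 2 * \1_bad w.
  by apply: addr_ge0; apply: mulr_ge0 => //; rewrite ?sqr_ge0 ?indicE.
have rhs : (\int[P]_w (dispersion_at l w +
     ((4 ^ l)%:R * (12 * rho) + M ^+ 2 * \1_bad w))%:E =
    E l + ((4 ^ l)%:R * (12 * rho) + M ^+ 2 * fine (P bad))%:E)%E.
  under eq_integral do rewrite EFinD.
  rewrite ge0_integralD//; last 4 first.
  - by move=> w _; rewrite lee_fin dispersion_at_ge0.
  - by apply/measurable_EFinP; exact: measurable_dispersion_at.
  - by move=> w _; rewrite lee_fin.
  - exact/measurable_EFinP.
  congr (_ + _)%E.
  under eq_integral do rewrite EFinD.
  rewrite ge0_integralD//; last 3 first.
  - by move=> w _; rewrite lee_fin mulr_ge0.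
  - by move=> w _; rewrite lee_fin mulr_ge0 ?sqr_ge0// indicE.
  - by apply/measurable_EFinP; apply: measurable_funM.
  rewrite integral_cst//= probability_setT mule1 EFinD; congr (_ + _)%E.
  under eq_integral do rewrite EFinM.
  rewrite ge0_integralZl//; last 2 first.
  - exact/measurable_EFinP/measurable_indic.
  - by rewrite lee_fin sqr_ge0.
  have Pb : (P bad = (fine (P bad))%:E)%E by rewrite fineK// fin_num_measure.
  by rewrite integral_indic//= setIT Pb -EFinM.
have key : (\int[P]_w (dispersion_at l.+1 w + G w)%:E <=
    \int[P]_w (dispersion_at l w +
     ((4 ^ l)%:R * (12 * rho) + M ^+ 2 * \1_bad w))%:E)%E.
  apply: ae_ge0_le_integral => //.
  - by move=> w _; rewrite lee_fin addr_ge0 ?dispersion_at_ge0.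
  - by apply/measurable_EFinP; apply: measurable_funD => //; exact: measurable_dispersion_at.
  - by move=> w _; rewrite lee_fin addr_ge0 ?dispersion_at_ge0.
  - by apply/measurable_EFinP; apply: measurable_funD => //; exact: measurable_dispersion_at.
  - move: interior; apply: (@filterS _ _ (ae_filter_ringOfSetsType P)) => w int _.
    by rewrite lee_fin; exact: level_step.
rewrite -rhs; apply: le_trans key; rewrite lhs leeD2l//.
have -> : (\int[P]_w (G w)%:E = \sum_(a : l.-tuple (bool * bool))
    ((alpha1^-1)%:E * \int[P]_w (node_dispersion a w * good a w)%:E))%E.
  rewrite /G; under eq_integral do rewrite -sumEFin.
  rewrite ge0_integral_sum//; last 2 first.
  - by move=> a; apply/measurable_EFinP; exact: measurable_funM.
  - by move=> a w _; rewrite lee_fin mulr_ge0// invr_ge0 ltW.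
  apply: eq_bigr => a _; under eq_integral do rewrite EFinM.
  rewrite ge0_integralZl//.
  - exact/measurable_EFinP.
  - by move=> w _; rewrite lee_fin.
  - by rewrite lee_fin invr_ge0 ltW.
have -> : (E l = \sum_(a : l.-tuple (bool * bool)) \int[P]_w (node_dispersion a w)%:E)%E.
  rewrite /E /dispersion_at; under eq_integral do rewrite -sumEFin.
  rewrite ge0_integral_sum//.
  - by move=> a; apply/measurable_EFinP; exact: (@mDO a).
  - by move=> a w _; rewrite lee_fin D0.
rewrite ge0_sume_distrr; last first.
  by move=> a _; apply: integral_ge0 => w _; rewrite lee_fin D0.
apply: lee_sum => a _; rewrite mulrC EFinM -muleA.
by rewrite lee_wpmul2l ?lee_fin ?invr_ge0 ?(ltW a0)//; exact: split_gain.
Qed.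

Lemma dispersion_decay (L : nat) : (L.*2 <= K)%N ->
  (\int[P]_w (dispersion_at L w)%:E <=
   ((1 - delta / alpha1) ^+ L * M ^+ 2 +
    ((4 ^ L)%:R * (12 * rho) + M ^+ 2 * fine (P bad)) / (delta / alpha1))%:E)%E.
Proof.
move=> LK; have Efin l : E l = (fine (E l))%:E.
  rewrite fineK// ge0_fin_numE//; exact: le_lt_trans (E_le l) (ltry _).
rewrite -/(E L) Efin lee_fin.
have [dp d1] := andP delta0.
have P0 : 0 <= fine (P bad) by rewrite fine_ge0.
apply: (@linear_recursion_le _ (fun l => fine (E l))).
- by rewrite divr_gt0//= ler_pdivrMr// mul1r; exact: le_trans d1 alpha0.
- by rewrite -lee_fin -Efin.
- have r12 : 0 <= 12 * rho by rewrite mulr_ge0.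
  by apply: addr_ge0; apply: mulr_ge0 => //; exact: sqr_ge0.
- move=> l lL; rewrite -lee_fin !EFinD EFinM -!Efin.
  apply: (le_trans (expected_step _)).
    by apply: leq_trans LK; rewrite -doubleS leq_double.
  rewrite EFinD; apply: leeD => //; apply: leeD => //; rewrite lee_fin.
  apply: ler_wpM2r.
    by rewrite mulr_ge0.
  by rewrite ler_nat leq_exp2l// ltnW.
Qed.

End dispersion_decay.

(** * Decomposition of the risk *)

Lemma measurable_cell_average (R : realType) (n d : nat) dT (T : measurableType dT)
    (z : T -> sample R n d) (t : T -> cell R d) :
  measurable_fun setT z -> random_cell t ->
  measurable_fun setT (fun v => cell_average (z v) (t v)).
Proof.
move=> mz mt.
have mzi i : measurable_fun setT (fun v => tnth (z v) i).
  exact: (measurableT_comp (measurable_tnth i) mz).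
have mz1 i : measurable_fun setT (fun v => (tnth (z v) i).1).
  exact: (measurableT_comp measurable_fst (mzi i)).
have mz2 i : measurable_fun setT (fun v => (tnth (z v) i).2).
  exact: (measurableT_comp measurable_snd (mzi i)).
have min i : measurable_fun setT (fun v => in_cell (t v) (tnth (z v) i).1).
  apply: (measurableT_comp (f := fun p : T * d.-tuple R => in_cell (t p.1) p.2)
    (g := fun v => (v, (tnth (z v) i).1))); first exact: measurable_in_random_cell.
  exact: measurable_fun_pair.
have -> : (fun v => cell_average (z v) (t v)) = (fun v =>
   (\sum_(i < n) (if in_cell (t v) (tnth (z v) i).1 then (tnth (z v) i).2 else 0)) *
   (\sum_(i < n) (if in_cell (t v) (tnth (z v) i).1 then 1 else 0)) `^ (- 1)).
  apply/funext => v; rewrite /cell_average -/(count_in (z v) (t v)) count_inE.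
  rewrite big_mkcond big_tuple [in X in _ / X]big_mkcond [in X in _ / X]big_tuple.
  by rewrite powR_inv1// sumr_ge0// => i _; case: ifP.
apply: measurable_funM; first by apply: measurable_sum => i; exact: measurable_fun_ifT.
apply: (measurableT_comp (f := fun x : R => x `^ (- 1))); first exact: measurable_powR.
by apply: measurable_sum => i; exact: measurable_fun_ifT.
Qed.

Section risk.
Context {R : realType} {n W : nat} (S : rsrf_model R n W).
Hypotheses (ind : sources_independent S) (draws : draws_law S)
  (reg : regression_setting S).
Variables (M : R).
Hypotheses (bounded : regression_bounded S M) (n0 : (0 < n)%N).
Local Notation P := (Pr S).
Local Notation d := (ndim S).
Local Notation law := (law S).
Local Notation f := (regression S).

Let mf := measurable_regression reg.
Let fM := regression_le bounded.
Let M0 := bound_ge0 bounded.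

Definition node_error (a : node) (w : Omega S) : R :=
  cmass law (tree_cell a w) * (cmoment law f (tree_cell a w) / cmass law (tree_cell a w) -
    cell_average (data w) (tree_cell a w)) ^+ 2.

Let average a w := cell_average (data w) (tree_cell (S := S) a w).

Let measurable_estimator k :
  measurable_fun setT (fun p : sub_space S (past k./2) * d.-tuple R =>
    tree_estimator k (p.1 : Omega S) p.2).
Proof.
apply: measurable_sum => a; apply: measurable_funM.
  have mc := tree_cell_past reg (l := k./2) (a := a).
  rewrite size_tuple in mc.
  apply: (measurableT_comp (f := fun v : sub_space S (past k./2) =>
    cell_average (data (v : Omega S)) (tree_cell a (v : Omega S)))) => //.
  apply: measurable_cell_average; last exact: mc.
  exact: (measurable_data reg).
have -> : (fun p : sub_space S (past k./2) * d.-tuple R =>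
    (in_cell (tree_cell a (p.1 : Omega S)) p.2)%:R : R) =
    (fun p => if in_cell (tree_cell a (p.1 : Omega S)) p.2 then 1 else 0).
  by apply/funext => p; case: in_cell.
apply: measurable_fun_ifT => //.
apply: (measurable_in_random_cell (t := fun v : sub_space S (past k./2) => tree_cell a (v : Omega S))).
by apply: (tree_cell_past reg); rewrite size_tuple.
Qed.

(** The new point is independent of the data and of the draws, and these
    determine the tree. *)
Lemma risk_fubini k : rsrf_risk S k =
  (\int[P]_w \int[law]_x ((f x - tree_estimator k w x) ^+ 2)%:E)%E.
Proof.
rewrite /rsrf_risk unlock.
pose H (p : sub_space S (past k./2) * d.-tuple R) : \bar R :=
  ((f p.2 - tree_estimator k (p.1 : Omega S) p.2) ^+ 2)%:E.
transitivity (\int[P]_w H (w : sub_space S (past k./2), Xnew S w))%E.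
  apply: eq_integral => w _; rewrite /H /= regressionE//.
  by have [_ + _ _ _] := reg; exact.
rewrite (ge0_integral_sources ind draws (D2 := [set SrcXnew]))//.
- by apply/seteqP; split => // s [+ /= us]; rewrite us.
- exact: (@measurable_source _ _ _ S [set SrcXnew] SrcXnew).
- apply/measurable_EFinP; apply: measurable_funX; apply: measurable_funB.
    exact: (measurableT_comp mf measurable_snd).
  exact: measurable_estimator.
- by move=> p; rewrite lee_fin sqr_ge0.
Qed.

Lemma integrated_error k w :
  (\int[law]_x ((f x - tree_estimator k w x) ^+ 2)%:E =
   (dispersion_at k./2 w + \sum_(a : (k./2).-tuple (bool * bool)) node_error a w)%:E)%E.
Proof.
have mc a : measurable (cell_set (tree_cell (S := S) a w)) by exact: measurable_cell_set.
have pt x : (f x - tree_estimator k w x) ^+ 2 =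
    \sum_(a : (k./2).-tuple (bool * bool))
      (f x - average a w) ^+ 2 * \1_(cell_set (tree_cell a w)) x.
  have iE a : (in_cell (tree_cell (S := S) a w) x)%:R = \1_(cell_set (tree_cell a w)) x :> R.
    rewrite indicE; congr (nat_of_bool _)%:R.
    by apply/idP/idP => [h|/set_mem//]; rewrite mem_set.
  under [RHS]eq_bigr do rewrite -iE.
  have [xu|xnu] := boolP (in_cell unit_cell x).
    (* normalised to vanish at 0, as the selection of the leaf of x requires *)
    pose F (u : R) := (f x - u) ^+ 2 - f x ^+ 2.
    have := @tree_select _ _ _ S k./2 w x F (fun a => average a w).
    rewrite /F subr0 subrr => /(_ erefl).
    under [in X in _ = X -> _]eq_bigr do rewrite mulrBl.
    rewrite sumrB -mulr_sumr tree_partition xu mulr1 => /(congr1 (fun u => u + f x ^+ 2)).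
    by rewrite !subrK.
  have nin a : in_cell (tree_cell (S := S) a w) x = false.
    by apply/negbTE; apply: contra xnu; exact: tree_cell_sub.
  rewrite big1; last by move=> a _; rewrite nin mulr0.
  rewrite /tree_estimator big1; last by move=> a _; rewrite nin mulr0.
  by rewrite /regression patchE memNset ?subr0 ?expr0n//; exact/negP.
under eq_integral do rewrite pt -sumEFin.
have mg a : measurable_fun setT (fun x => (f x - average a w) ^+ 2).
  by apply: measurable_funX; exact: measurable_funB.
rewrite ge0_integral_sum//; last 2 first.
- by move=> a; apply/measurable_EFinP; apply: measurable_funM.
- by move=> a x _; rewrite lee_fin mulr_ge0 ?sqr_ge0// indicE.
rewrite /dispersion_at -big_split/= -sumEFin; apply: eq_bigr => a _.
rewrite /node_dispersion /node_error -(Rintegral_sqr_sub_mean law mf fM)//.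
rewrite /Rintegral fineK; last first.
  have := @integrable_fin_num _ _ _ law _ (mc a)
     (fun x => ((f x - average a w) ^+ 2)%:E); apply.
  apply: (bounded_integrable law (C := (M + `|average a w|) ^+ 2)) => //.
  move=> x; rewrite normrX lerXn2r ?nnegrE ?addr_ge0//.
  by apply: (le_trans (ler_normB _ _)); rewrite lerD2r.
rewrite [RHS]integral_mkcond; apply: eq_integral => x _.
by rewrite patchE indicE; case: (_ \in _); rewrite ?mulr1 ?mulr0.
Qed.

Lemma cell_average_le (z : sample R n d) (b : R) t : 0 <= b ->
  (forall p, p \in (z : seq _) -> `|p.2| <= b) -> `|cell_average z t| <= b.
Proof.
move=> b0 zb; rewrite /cell_average -/(count_in z t) -/(total_in z t).
have [->|c0] := eqVneq (count_in z t) 0; first by rewrite invr0 mulr0 normr0.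
have cp : 0 < count_in z t by rewrite lt_neqAle eq_sym c0 count_in_ge0.
by rewrite normrM normfV (gtr0_norm cp) ler_pdivrMr// total_in_le.
Qed.

Lemma node_error_close (B rad : R) a w : M <= B -> 0 <= B ->
  (forall p, p \in (data w : seq _) -> `|p.2| <= B) ->
  sample_close (data w) rad law f (tree_cell a w) ->
  node_error a w <= 2 * B * (1 + B) * rad.
Proof.
move=> MB B0 dB [h1 h2]; have nR0 : (0 : R) < n%:R by rewrite ltr0n.
rewrite /node_error.
have -> : cell_average (data w) (tree_cell a w) =
    (total_in (data w) (tree_cell a w) / n%:R) / (count_in (data w) (tree_cell a w) / n%:R).
  by rewrite invf_div mulrA divfK// gt_eqF.
apply: mean_deviation => //.
- exact: cmass_ge0.
- by rewrite divr_ge0// count_in_ge0.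
- by apply: (le_trans (cmoment_le law mf fM _)); rewrite ler_wpM2r// cmass_ge0.
- rewrite normrM normfV (gtr0_norm nR0) mulrA ler_wpM2r// ?invr_ge0 ?(ltW nR0)//.
  exact: total_in_le.
- by rewrite distrC.
- by rewrite distrC.
Qed.

(** A bound that holds whatever the sample is, for the event on which
    concentration fails. *)
Lemma sum_node_error_le (b : R) l w : 0 <= b -> (forall i, `|eps S i w| <= b) ->
  \sum_(a : l.-tuple (bool * bool)) node_error a w <= 8 * M ^+ 2 + 2 * b ^+ 2.
Proof.
move=> b0 eb.
have dB p : p \in (data w : seq _) -> `|p.2| <= M + b.
  move=> /mapP[i _ ->] /=; apply: (le_trans (ler_normD _ _)); apply: lerD; last exact: eb.
  by apply: bounded; have [_ _ + _ _] := reg; exact.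
apply: (@le_trans _ _ (\sum_(a : l.-tuple (bool * bool)) (2 * M + b) ^+ 2 * cmass law (tree_cell a w))).
  apply: ler_sum => a _; rewrite /node_error mulrC ler_wpM2r ?cmass_ge0//.
  set u := _ / _; set v := cell_average _ _.
  have uM : `|u| <= M.
    rewrite /u; have [->|p0] := eqVneq (cmass law (tree_cell a w)) 0.
      by rewrite invr0 mulr0 normr0.
    have pp : 0 < cmass law (tree_cell a w) by rewrite lt_neqAle eq_sym p0 cmass_ge0.
    by rewrite normrM normfV (gtr0_norm pp) ler_pdivrMr// cmoment_le.
  have vb : `|v| <= M + b by apply: cell_average_le => //; rewrite addr_ge0.
  rewrite -[(u - v) ^+ 2]real_normK ?num_real// lerXn2r ?nnegrE//.
    by rewrite addr_ge0// mulr_ge0.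
  apply: (le_trans (ler_normB _ _)); lra.
rewrite -mulr_sumr sum_cmass_tree// mulr1.
rewrite -subr_ge0; have -> : 8 * M ^+ 2 + 2 * b ^+ 2 - (2 * M + b) ^+ 2 = (2 * M - b) ^+ 2.
  by ring.
exact: sqr_ge0.
Qed.

End risk.

(** * Density, uniform draws and tails of the noise *)

Section density.
Context {R : realType} {n W : nat} (S : rsrf_model R n W) (fmin fmax : R).
Hypotheses (fmin0 : 0 < fmin) (dens : density_bounded S fmin fmax).
Local Notation d := (ndim S).

Lemma density_max_gt0 : 0 < fmax.
Proof.
have [g [_ gb _]] := dens.
have x0 : cell_set unit_cell ([tuple (0 : R) | _ < d]).
  by apply/forallP => j; rewrite tnth_mktuple in_itv/= lexx ler01.
have /andP[h1 h2] := gb _ x0.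
exact: lt_le_trans fmin0 (le_trans h1 h2).
Qed.

Lemma law_le_lebesgue (A : set (d.-tuple R)) : measurable A ->
  (law S A <= fmax%:E * lebesgue_tuple d A)%E.
Proof.
move=> mA; have [g [mg gb gE]] := dens.
have mAu : measurable (A `&` cell_set unit_cell).
  by apply: measurableI => //; exact: measurable_cell_set.
have fm0 := density_max_gt0.
have -> : law S A = Pr S (Xnew S @^-1` A) by [].
rewrite gE//; apply: (@le_trans _ _
  (\int[lebesgue_tuple d]_(x in A `&` cell_set unit_cell) fmax%:E)%E).
  apply: ge0_le_integral => //.
  - move=> x [_ /gb/andP[h _]]; rewrite lee_fin.
    exact: le_trans (ltW fmin0) h.
  - by apply/measurable_EFinP; exact: measurable_funTS.
  - by move=> x [_ /gb/andP[_ h]]; rewrite lee_fin.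
rewrite integral_cst//; apply: lee_wpmul2l; first by rewrite lee_fin ltW.
by apply: le_measure; rewrite ?inE//; exact: subIsetl.
Qed.

Lemma law_null (t : cell R d) : lebesgue_tuple d (cell_set t) = 0%E ->
  law S (cell_set t) = 0%E.
Proof.
move=> t0; apply/eqP; rewrite eq_le measure_ge0 andbT.
by apply: (le_trans (law_le_lebesgue (measurable_cell_set t))); rewrite t0 mule0.
Qed.

(** A slab has width 1 / N in one direction and at most 1 in the others. *)
Lemma law_slab (N : nat) (q : halfspace R d) : (0 < N)%N ->
  cmass (law S) (cuts (slab N q)) <= fmax / N%:R.
Proof.
move=> N0; have fm0 := density_max_gt0.
rewrite -lee_fin /cmass massK; last exact: measurable_cell_set.
apply: (le_trans (law_le_lebesgue (measurable_cell_set _))).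
rewrite EFinM; apply: lee_wpmul2l; first by rewrite lee_fin ltW.
rewrite lebesgue_tuple_cell (bigD1 q.1.1)//= big1 ?mule1; last first.
  move=> j jq; rewrite /cuts/= /daughter/= (negbTE jq) /unit_cell.
  by rewrite lebesgue_measure_itv/= lte_fin ltr01 oppr0 adde0.
set i := grid_index N q.1.2.
have gg : @grid_point R N i < grid_point N i.+1.
  by rewrite -subr_gt0 grid_pointS invr_gt0 ltr0n.
apply: (@le_trans _ _ (lebesgue_measure `]@grid_point R N i, grid_point N i.+1]%classic)).
  apply: lebesgue_measure_le => x /=; rewrite /daughter/= eqxx !in_itvI.
  by move=> /andP[/andP[_ h1] h2]; move: h1 h2; rewrite !in_itv/= andbT => -> ->.
by rewrite lebesgue_measure_itv/= lte_fin gg -EFinB grid_pointS.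
Qed.

End density.

Section almost_sure_interior.
Context {R : realType} {n W : nat} (S : rsrf_model R n W).
Hypothesis draws : draws_law S.
Local Notation P := (Pr S).

(** There are countably many nodes, and each draw hits 0 or 1 with probability
    0. *)
Lemma ae_interior_draws : {ae P, forall w, interior_draws w}.
Proof.
pose F (k : nat) : set (Omega S) := match unpickle k with
  | Some p => ~` (unif S p.1 p.2 @^-1` `]0, 1[)
  | None => set0 end.
have F0 k : P.-negligible (F k).
  rewrite /F; case: unpickle => [[a i]|]; last exact: negligible_set0.
  have mU : measurable (unif S a i @^-1` `]0, 1[) by exact: measurable_funPTI.
  apply/negligibleP; first exact: measurableC.
  suff : P (~` (unif S a i @^-1` `]0, 1[)) = 0%E by [].
  rewrite probability_setC//.
  have [_ + _ _] := draws; move=> /(_ a i `]0, 1[%classic (measurable_itv _)) ->.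
  have -> : `]0, 1[%classic `&` `[0, 1]%classic = `]0, 1[%classic :> set R.
    by apply/setIidPl => x /=; rewrite !in_itv/= => /andP[/ltW -> /ltW ->].
  by rewrite lebesgue_measure_itv/= lte_fin ltr01 oppr0 adde0 subee.
have := negligible_bigcup F0; apply: negligibleS => w /= nint.
apply: contrapT => nF; apply: nint => a i.
apply: contrapT => h; apply: nF; exists (pickle (a, i)) => //.
by rewrite /F pickleK /= in_itv.
Qed.

End almost_sure_interior.

Section noise.
Context {R : realType} {n W : nat} (S : rsrf_model R n W) (q Ceps y : R).
Hypotheses (mom : noise_moment_le S q Ceps) (y0 : 0 < y) (q2 : 2 <= q).
Local Notation P := (Pr S).

Let q0 : 0 <= q. Proof. by apply: le_trans q2. Qed.

Lemma measurable_noise_power i : measurable_fun setT (fun w => `|eps S i w| `^ q).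
Proof.
apply: (measurableT_comp (f := fun x : R => x `^ q)); first exact: measurable_powR.
exact: measurableT_comp.
Qed.

Lemma noise_power_integral i : (\int[P]_w (`|eps S i w| `^ q)%:E <= Ceps%:E)%E.
Proof. by have := mom i; rewrite unlock. Qed.

Lemma measurable_large_noise i : measurable [set w | y < `|eps S i w|].
Proof.
have mlt : measurable_fun setT (fun w => y < `|eps S i w|).
  by apply: measurable_fun_ltr => //; exact: measurableT_comp.
by have := mlt measurableT [set true] I; rewrite setTI.
Qed.

Lemma large_noise_prob i : (P [set w | (y < `|eps S i w|)%R] <= (Ceps / y `^ q)%:E)%E.
Proof.
set E := [set w | _]; have mE : measurable E := measurable_large_noise i.
have yq : 0 < y `^ q by exact: powR_gt0.
have key : ((y `^ q)%:E * P E <= Ceps%:E)%E.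
  apply: le_trans (noise_power_integral i).
  have := integral_indic P measurableT mE; rewrite setIT => <-.
  rewrite -ge0_integralZl//; [|exact/measurable_EFinP/measurable_indic|by rewrite lee_fin ltW].
  apply: ge0_le_integral => //.
  - by move=> w _; rewrite mule_ge0// lee_fin// ltW.
  - by apply: measurable_funeM; apply/measurable_EFinP; exact: measurable_indic.
  - by apply/measurable_EFinP; exact: measurable_noise_power.
  - move=> w _; rewrite -EFinM lee_fin indicE.
    have [wE|_] := boolP (w \in E); last by rewrite mulr0 powR_ge0.
    rewrite mulr1 ge0_ler_powR ?nnegrE ?(ltW y0)//.
    by move: wE; rewrite inE => /ltW.
have PE : P E = (fine (P E))%:E by rewrite fineK ?fin_num_measure.
by move: key; rewrite PE -EFinM !lee_fin ler_pdivlMr// mulrC.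
Qed.

(** Beyond y, the square of a noise is at most its q-th power times y^(2-q).
    The sum over all observations dominates every single one and has a small
    expectation, which controls the risk when large noises occur. *)
Definition noise_excess (w : Omega S) : R :=
  \sum_(i < n) `|eps S i w| `^ q * y `^ (2 - q).

Lemma noise_excess_ge0 w : 0 <= noise_excess w.
Proof. by apply: sumr_ge0 => i _; rewrite mulr_ge0 ?powR_ge0. Qed.

Lemma noise_le_excess i w : `|eps S i w| ^+ 2 <= y ^+ 2 + noise_excess w.
Proof.
have [small|large] := leP `|eps S i w| y.
  apply: (@le_trans _ _ (y ^+ 2)); last by rewrite lerDl noise_excess_ge0.
  by rewrite lerXn2r// nnegrE// ltW.
apply: (@le_trans _ _ (noise_excess w)); last by rewrite lerDr sqr_ge0.
rewrite /noise_excess (bigD1 i)//=; apply: (@le_trans _ _ (`|eps S i w| `^ q * y `^ (2 - q))); last first.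
  by rewrite lerDl sumr_ge0// => j _; rewrite mulr_ge0 ?powR_ge0.
set e := `|eps S i w| in large *.
have e0 : 0 < e by exact: lt_trans large.
have -> : e ^+ 2 = e `^ q * e `^ (2 - q).
  by rewrite -powRD ?subrKC ?powR_mulrn ?(ltW e0)//; rewrite (gt_eqF e0) implybT.
apply: ler_wpM2l; first exact: powR_ge0.
have -> : 2 - q = - (q - 2) by ring.
rewrite !powRN lef_pV2 ?posrE ?powR_gt0//.
by rewrite ge0_ler_powR ?nnegrE ?subr_ge0 ?(ltW e0) ?(ltW y0)// ltW.
Qed.

Lemma measurable_noise_excess : measurable_fun setT noise_excess.
Proof.
by apply: measurable_sum => i; apply: measurable_funM => //; exact: measurable_noise_power.
Qed.

Lemma noise_excess_integral :
  (\int[P]_w (noise_excess w)%:E <= (n%:R * Ceps * y `^ (2 - q))%:E)%E.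
Proof.
rewrite /noise_excess; under eq_integral do rewrite -sumEFin.
rewrite ge0_integral_sum//; last 2 first.
- by move=> i; apply/measurable_EFinP; apply: measurable_funM => //; exact: measurable_noise_power.
- by move=> i w _; rewrite lee_fin mulr_ge0 ?powR_ge0.
have -> : (n%:R * Ceps * y `^ (2 - q))%:E = (\sum_(i < n) (Ceps * y `^ (2 - q))%:E)%E.
  by rewrite sumEFin sumr_const card_ord -mulrA mulr_natl.
apply: lee_sum => i _; under eq_integral do rewrite EFinM.
rewrite ge0_integralZr//; last 2 first.
- by apply/measurable_EFinP; exact: measurable_noise_power.
- by rewrite lee_fin powR_ge0.
by rewrite EFinM; apply: lee_wpmul2r; [rewrite lee_fin powR_ge0|exact: noise_power_integral].
Qed.

End noise.

(** * A bound at finite sample size *)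

Section finite_sample.
Context {R : realType} {n W : nat} (S : rsrf_model R n W).
Hypotheses (ind : sources_independent S) (draws : draws_law S)
  (reg : regression_setting S) (sym : noise_symmetric S).
Variables (M alpha1 delta fmin fmax q Ceps y r0 : R) (L : nat).
Hypotheses (bounded : regression_bounded S M)
  (dens : density_bounded S fmin fmax) (mom : noise_moment_le S q Ceps)
  (first_split : random_split_condition (law S) (m S) alpha1 delta).
Hypotheses (n0 : (0 < n)%N) (W0 : (0 < W)%N) (alpha0 : 1 <= alpha1)
  (delta0 : 0 < delta <= 1) (fmin0 : 0 < fmin) (q2 : 2 <= q) (L0 : (0 < L)%N)
  (y1 : 1 <= y) (r01 : 0 <= r0 <= 1).
Local Notation P := (Pr S).
Local Notation d := (ndim S).
Let K := L.*2.
Let B := M + y.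
Let rad := B * (3 * K%:R + 1) * (r0 + fmax / n%:R).

Let M0 := bound_ge0 bounded.
Let y0 : 0 < y. Proof. exact: lt_le_trans y1. Qed.
Let B1 : 1 <= B. Proof. by rewrite /B (le_trans y1)// lerDr. Qed.
Let B0 : 0 <= B. Proof. exact: le_trans B1. Qed.
Let fm0 : 0 < fmax := density_max_gt0 fmin0 dens.
Let MB : M <= B. Proof. by rewrite /B lerDl ltW. Qed.

Lemma ndim_gt0 : (0 < d)%N.
Proof.
pose z : sample R n d := [tuple ([tuple 0 | _ < d], 0) | _ < n].
have := (cart S z unit_cell 0).1; move: (d) => [[[]]|] //.
Qed.

Let grid := K.-tuple ('I_d * 'I_n.+3 * bool).

(** Outside this event the data coincide with the truncated sample and are
    close to the law on all grid cells. *)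
Definition unusual : set (Omega S) :=
  (\bigcup_(g in [set: grid]) deviating (S := S) y r0 (cuts (map (@on_grid R d n) g))) `|`
  (\bigcup_(i in [set: 'I_n]) [set w | y < `|eps S i w|]).

Lemma measurable_unusual : measurable unusual.
Proof.
apply: measurableU; apply: fin_bigcup_measurable => [|g _]; try exact: finite_finset.
  exact: measurable_deviating.
exact: measurable_large_noise.
Qed.

Let measure_finite_union (I : finType) (F : I -> set (Omega S)) (e : R) :
  (forall i, measurable (F i)) -> (forall i, (P (F i) <= e%:E)%E) ->
  (P (\bigcup_(i in [set: I]) F i) <= (#|I|%:R * e)%:E)%E.
Proof.
move=> mF Fe.
have -> : \bigcup_(i in [set: I]) F i = \big[setU/set0]_(i : I) F i.
  rewrite -bigcup_seq; congr bigcup.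
  by apply/seteqP; split => i //= _; rewrite mem_index_enum.
apply: (@le_trans _ _ (\sum_(i : I) P (F i))%E).
  elim: (index_enum I) => [|i l IH]; first by rewrite !big_nil measure0.
  rewrite !big_cons; apply: (le_trans (measureU2 _ (mF i) _)); last exact: leeD.
  exact: bigsetU_measurable.
apply: (@le_trans _ _ (\sum_(i : I) e%:E)%E); first exact: lee_sum.
by rewrite sumEFin sumr_const mulr_natl.
Qed.

Let e1 := expR (- (n%:R * r0 ^+ 2 / (32 * B ^+ 2))).

Definition unusual_bound : R :=
  ((d * n.+3 * 2) ^ K)%:R * (4 * e1) + n%:R * (Ceps / y `^ q).

Lemma unusual_prob : fine (P unusual) <= unusual_bound.
Proof.
have mu := measurable_unusual.
have m1 : measurable (\bigcup_(g in [set: grid]) deviating (S := S) y r0 (cuts (map (@on_grid R d n) g))).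
  by apply: fin_bigcup_measurable => [|g _]; [exact: finite_finset|exact: measurable_deviating].
have m2 : measurable (\bigcup_(i in [set: 'I_n]) [set w | y < `|eps S i w|]).
  by apply: fin_bigcup_measurable => [|g _]; [exact: finite_finset|exact: measurable_large_noise].
rewrite -lee_fin fineK ?fin_num_measure// /unusual_bound EFinD.
apply: (le_trans (measureU2 _ m1 m2)); apply: leeD.
  have := measure_finite_union (F := fun g : grid => deviating (S := S) y r0 (cuts (map (@on_grid R d n) g)))
    (e := 4 * e1); rewrite card_tuple !card_prod !card_ord card_bool; apply.
    by move=> g; exact: measurable_deviating.
  move=> g; apply: (deviating_prob ind draws reg sym bounded (ltW y0) _ (cuts (map (@on_grid R d n) g)) r01); exact: B1.
have := measure_finite_union (F := fun i : 'I_n => [set w | y < `|eps S i w|])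
    (e := Ceps / y `^ q); rewrite card_ord; apply.
  by move=> i; exact: measurable_large_noise.
by move=> i; exact: large_noise_prob.
Qed.

Let usual_noise w i : ~ unusual w -> `|eps S i w| <= y.
Proof. by move=> nw; rewrite leNgt; apply/negP => h; apply: nw; right; exists i. Qed.

Let usual_data w : ~ unusual w -> forall p, p \in (data w : seq _) -> `|p.2| <= B.
Proof.
move=> nw p; rewrite -(truncated_sample_data reg (y := y)); last by move=> i; exact: usual_noise.
by apply: truncated_sample_le => //; exact: ltW.
Qed.

Let usual_close w : ~ unusual w -> forall s : seq (halfspace R d), (size s <= K)%N ->
  sample_close (data w) rad (law S) (regression S) (cuts s).
Proof.
move=> nw s sK.
have K_gt0 : (0 < K)%N by rewrite /K double_gt0.
apply: (cuts_sample_close n0 B1 (ltW fm0) (usual_data nw) (measurable_regression reg)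
  (regression_le bounded) MB n0 K_gt0 ndim_gt0 (fun p => law_slab fmin0 dens p n0) _ sK) => g.
rewrite -(truncated_sample_data reg (y := y)); last by move=> i; exact: usual_noise.
by apply: not_deviating_close => // dev; apply: nw; left; exists g.
Qed.

Let rho := (2 * B + B ^+ 2) * rad.

Let fn0 : 0 <= fmax / n%:R. Proof. by rewrite divr_ge0// ltW. Qed.

Let rad_grid : 2 * B * (fmax / n%:R) <= rad.
Proof.
have [r00 _] := andP r01.
rewrite /rad (mulrC 2) -!mulrA; apply: ler_wpM2l => //; apply: ler_pM => //.
  have : (1 : R) <= K%:R by rewrite ler1n /K double_gt0.
  lra.
by rewrite lerDr.
Qed.

Let rad0 : 0 <= rad.
Proof. by apply: le_trans rad_grid; apply: mulr_ge0 => //; rewrite mulr_ge0. Qed.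

Let slack0 : 0 <= 2 * B * (1 + B) * rad.
Proof. by apply: mulr_ge0 => //; rewrite !mulr_ge0// addr_ge0. Qed.

(** In this order: initial dispersion after L double splits, accumulated
    errors of the recursion, estimation error on the usual event, on the
    unusual event with moderate noise, and the contribution of large noises. *)
Definition risk_bound : R :=
  (1 - delta / alpha1) ^+ L * M ^+ 2 +
    ((4 ^ L)%:R * (12 * rho) + M ^+ 2 * unusual_bound) / (delta / alpha1) +
  (4 ^ L)%:R * (2 * B * (1 + B) * rad) +
  (8 * M ^+ 2 + 2 * y ^+ 2) * unusual_bound +
  2 * (n%:R * Ceps * y `^ (2 - q)).

(** On the unusual event the crude bound is used with the largest noise, whose
    square is at most y^2 plus the excess. *)
Let error_le w : \sum_(a : L.-tuple (bool * bool)) node_error a w <=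
  (4 ^ L)%:R * (2 * B * (1 + B) * rad) +
  ((8 * M ^+ 2 + 2 * y ^+ 2) * \1_unusual w + 2 * noise_excess (S := S) q y w).
Proof.
have ex0 := noise_excess_ge0 (S := S) q y w.
have c0 := slack0.
have [wu|nwu] := pselect (unusual w).
  rewrite indicE mem_set// mulr1.
  (* a common bound of all noises *)
  pose b := Num.sqrt (y ^+ 2 + noise_excess (S := S) q y w).
  have b2 : b ^+ 2 = y ^+ 2 + noise_excess (S := S) q y w.
    by rewrite sqr_sqrtr// addr_ge0 ?sqr_ge0.
  have := @sum_node_error_le _ _ _ S reg M bounded b L w (sqrtr_ge0 _).
  have eb i : `|eps S i w| <= b.
    rewrite -[leLHS]sqrtr_sqr ler_wsqrtr//.
    have := noise_le_excess (S := S) y0 q2 i w; by rewrite real_normK ?num_real.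
  move=> /(_ eb) /le_trans; apply; rewrite b2.
  have : 0 <= (4 ^ L)%:R * (2 * B * (1 + B) * rad) by rewrite mulr_ge0.
  lra.
rewrite indicE memNset// mulr0 add0r.
apply: (@le_trans _ _ ((4 ^ L)%:R * (2 * B * (1 + B) * rad))); last by rewrite lerDl mulr_ge0.
have -> : (4 ^ L)%:R * (2 * B * (1 + B) * rad) =
    \sum_(a : L.-tuple (bool * bool)) (2 * B * (1 + B) * rad).
  by rewrite sumr_const card_tuple card_prod card_bool mulr_natl.
apply: ler_sum => a _; apply: (node_error_close reg bounded n0 MB B0 (usual_data nwu)).
have [s -> sz] := tree_cell_cuts a w; apply: usual_close => //.
by rewrite sz size_tuple.
Qed.

Lemma risk_le_bound (k : nat) : k./2 = L -> (rsrf_risk S k <= risk_bound%:E)%E.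
Proof.
move=> kL; rewrite risk_fubini//.
under eq_integral do rewrite (integrated_error reg bounded) kL.
have mdisp := measurable_dispersion_at draws reg bounded L.
have disp0 := dispersion_at_ge0 reg bounded L.
have mdata : measurable_fun setT (fun w => data (S := S) w).
  by apply: (@measurable_sub_space _ _ _ S draws setT); exact: measurable_data.
have merr : measurable_fun setT (fun w : Omega S => \sum_(a : L.-tuple (bool * bool)) node_error a w).
  apply: measurable_sum => a.
  have rt : random_cell (fun w : Omega S => tree_cell a w).
    have := random_cell_comp (tree_cell_past reg (leqnn (size a)))
      (measurable_sub_space draws (@measurable_id _ (sub_space S (past (size a))) setT)).
    by [].
  have mp := measurable_cmass (law S) rt.
  apply: measurable_funM => //; apply: measurable_funX; apply: measurable_funB.
    have -> : (fun w => cmoment (law S) (regression S) (tree_cell (S := S) a w) /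
        cmass (law S) (tree_cell a w)) =
      (fun w => cmoment (law S) (regression S) (tree_cell a w) *
        (cmass (law S) (tree_cell a w)) `^ (- 1)).
      by apply/funext => w; rewrite powR_inv1// cmass_ge0.
    apply: measurable_funM.
      exact: (measurable_cmoment (law S) (measurable_regression reg) (regression_le bounded) rt).
    by apply: (measurableT_comp (f := fun x : R => x `^ (- 1))); [exact: measurable_powR|].
  exact: measurable_cell_average.
have err0 (w : Omega S) : 0 <= \sum_(a : L.-tuple (bool * bool)) node_error a w.
  by apply: sumr_ge0 => a _; rewrite mulr_ge0 ?cmass_ge0 ?sqr_ge0.
have mu := measurable_unusual.
pose A := (4 ^ L)%:R * (2 * B * (1 + B) * rad).
have A0 : 0 <= A by rewrite /A mulr_ge0.
pose C := 8 * M ^+ 2 + 2 * y ^+ 2.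
have C0 : 0 <= C by rewrite addr_ge0// mulr_ge0// sqr_ge0.
have mex := measurable_noise_excess (S := S) q y.
have ex0 := noise_excess_ge0 (S := S) q y.
under eq_integral do rewrite EFinD.
rewrite ge0_integralD//; last 4 first.
- by move=> w _; rewrite lee_fin disp0.
- exact/measurable_EFinP.
- by move=> w _; rewrite lee_fin.
- exact/measurable_EFinP.
have -> : (risk_bound%:E = ((1 - delta / alpha1) ^+ L * M ^+ 2 +
    ((4 ^ L)%:R * (12 * rho) + M ^+ 2 * unusual_bound) / (delta / alpha1))%:E +
    (A + (C * unusual_bound + 2 * (n%:R * Ceps * y `^ (2 - q))))%:E)%E.
  by rewrite -EFinD /risk_bound; congr EFin; rewrite /A /C; ring.
apply: leeD.
  apply: (le_trans (dispersion_decay ind draws reg bounded n0 n0 MB B1 (ltW fm0)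
    rad_grid alpha0 delta0 W0 ndim_gt0 (fun p => law_slab fmin0 dens p n0)
    (law_null fmin0 dens) first_split mu usual_data usual_close
    (ae_interior_draws draws) (leqnn _))).
  rewrite lee_fin lerD2l; apply: ler_wpM2r.
    have [dp _] := andP delta0; by rewrite invr_ge0 divr_ge0// ltW// (lt_le_trans ltr01).
  by rewrite lerD2l ler_wpM2l ?sqr_ge0// unusual_prob.
apply: (@le_trans _ _ (\int[P]_w (A + (C * \1_unusual w + 2 * noise_excess (S := S) q y w))%:E)%E).
  apply: ge0_le_integral => //.
  - by move=> w _; rewrite lee_fin.
  - exact/measurable_EFinP.
  - apply/measurable_EFinP; apply: measurable_funD => //; apply: measurable_funD.
      by apply: measurable_funM => //; exact: measurable_indic.
    exact: measurable_funM.
  - by move=> w _; rewrite lee_fin; exact: error_le.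
have i1 : (\int[P]_w (C * \1_unusual w)%:E <= (C * unusual_bound)%:E)%E.
  under eq_integral do rewrite EFinM.
  rewrite ge0_integralZl//; last by exact/measurable_EFinP/measurable_indic.
  have Pb : (P unusual = (fine (P unusual))%:E)%E by rewrite fineK// fin_num_measure.
  by rewrite integral_indic//= setIT Pb -EFinM lee_fin ler_wpM2l// unusual_prob.
have i2 : (\int[P]_w (2 * noise_excess (S := S) q y w)%:E <= (2 * (n%:R * Ceps * y `^ (2 - q)))%:E)%E.
  under eq_integral do rewrite EFinM.
  rewrite ge0_integralZl//; last 2 first.
  - exact/measurable_EFinP.
  - by move=> w _; rewrite lee_fin.
  by rewrite EFinM; apply: lee_wpmul2l; [rewrite lee_fin|exact: noise_excess_integral].
have mC : measurable_fun setT (fun w => C * \1_unusual w : R).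
  by apply: measurable_funM => //; exact: measurable_indic.
have mE : measurable_fun setT (fun w => 2 * noise_excess (S := S) q y w).
  exact: measurable_funM.
have CI0 w : 0 <= C * \1_unusual w by rewrite mulr_ge0// indicE.
have E0 w : 0 <= 2 * noise_excess (S := S) q y w by rewrite mulr_ge0.
under eq_integral do rewrite EFinD.
rewrite ge0_integralD//; last 2 first.
- by move=> w _; rewrite lee_fin addr_ge0.
- by apply/measurable_EFinP; exact: measurable_funD.
rewrite integral_cst//= probability_setT mule1 EFinD; apply: leeD => //.
under eq_integral do rewrite EFinD.
rewrite ge0_integralD//; last 4 first.
- by move=> w _; rewrite lee_fin.
- exact/measurable_EFinP.
- by move=> w _; rewrite lee_fin.
- exact/measurable_EFinP.
by rewrite EFinD; exact: leeD.
Qed.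

End finite_sample.

(** * Size of the bound *)

Section rate.
Context {R : realType} {n W : nat} (S : rsrf_model R n W).
Variables (M alpha1 delta fmax q Ceps y D : R) (e L : nat).
Hypotheses (M0 : 0 <= M) (p01 : 0 < delta / alpha1 <= 1) (fm0 : 0 <= fmax) (q66 : 66 <= q) (L0 : (0 < L)%N).
Hypotheses (y1 : 1 <= y) (My : M <= y) (yn : y ^+ 32 = n%:R).
Hypotheses (D1 : 1 <= D) (dD : (ndim S)%:R <= D * y ^+ e).
Hypothesis leaves : (4 ^ L)%:R <= y ^+ 8.
Local Notation K := L.*2.
Let s := Num.sqrt y.
Let C1 := 8 * D + (e + 32)%:R * 2.
Hypothesis y_large : 256 * (32 * C1) <= y.

Let y0 : 0 < y. Proof. exact: lt_le_trans y1. Qed.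
Let s2 : s ^+ 2 = y. Proof. by rewrite sqr_sqrtr// ltW. Qed.
Let s1 : 1 <= s. Proof. by rewrite -[1]sqrtr1 ler_wsqrtr. Qed.

(** Powers of y are compared with exponentials of the square root s of y,
    which dominates the logarithm of y. *)
Let y_expR : y <= expR (2 * s).
Proof.
have := expR_ge1Dx s; rewrite expRM_natl -s2 => h.
by rewrite lerXn2r// ?nnegrE ?(le_trans _ s1)// ?expR_ge0// (le_trans _ h)// lerDr.
Qed.

Let depth_le : K%:R <= 32 * s.
Proof.
have h2 : expR 2^-1 <= 2 :> R.
  have := expR_ge1Dx (- 2^-1 : R); rewrite expRN => h.
  have h1 : 2^-1 <= (expR 2^-1)^-1 :> R by apply: le_trans h; lra.
  by move: h1; rewrite lef_pV2 ?posrE ?expR_gt0.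
have : expR (2^-1 * K%:R) <= expR (16 * s).
  apply: (@le_trans _ _ (2 ^+ K)).
    by rewrite expRM_natr lerXn2r// nnegrE ?expR_ge0.
  apply: (@le_trans _ _ (y ^+ 8)).
    by rewrite -natrX -muln2 mulnC expnM.
  have -> : 16 * s = (2 * s) * 8%:R by ring.
  by rewrite expRM_natr lerXn2r// nnegrE ?expR_ge0// ltW.
rewrite ler_expR; lra.
Qed.

(** The logarithm of the number of grid cells is at most depth times log(d n),
    both factors being O(s); hence O(y), which is negligible with respect to
    the exponent y^2 / 128 of the tail bound. *)
Let grid_card_le : ((ndim S * n.+3 * 2) ^ K)%:R <= expR (32 * C1 * y).
Proof.
have yk (k : nat) : 1 <= y ^+ k by exact: exprn_ege1.
have base : (ndim S * n.+3 * 2)%:R <= expR (C1 * s).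
  apply: (@le_trans _ _ (8 * D * y ^+ (e + 32))).
    rewrite !natrM exprD; have n3 : n.+3%:R <= 4 * y ^+ 32.
      by rewrite -addn3 natrD -yn; have := yk 32%N; lra.
    have h := ler_pM (ler0n _ _) (ler0n _ _) dD n3; move: h; lra.
  have -> : C1 * s = 8 * D * s + (2 * s) * (e + 32)%:R by rewrite /C1; ring.
  rewrite expRD expRM_natr; apply: ler_pM => //.
  - by rewrite mulr_ge0// (le_trans _ D1).
  - by rewrite exprn_ge0// ltW.
  - apply: le_trans (expR_ge1Dx _).
    have : 8 * D * 1 <= 8 * D * s by apply: ler_wpM2l => //; have := D1; lra.
    by lra.
  - by rewrite lerXn2r// nnegrE ?expR_ge0// ltW.
rewrite natrX; apply: (@le_trans _ _ (expR (C1 * s) ^+ K)).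
  by rewrite lerXn2r// nnegrE ?expR_ge0.
rewrite -expRM_natr ler_expR -s2.
have C0 : 0 <= C1 by rewrite /C1 addr_ge0// mulr_ge0// (le_trans _ D1).
have s0 : 0 <= s by exact: le_trans s1.
have := ler_wpM2l (mulr_ge0 C0 s0) depth_le; lra.
Qed.

Let expRN_le (x : R) : 0 < x -> expR (- x) <= 2 / x ^+ 2.
Proof.
move=> x0; have := expR_ge1Dxn 1 (ltW x0); rewrite expRN => h.
rewrite -[leRHS]invrK lef_pV2 ?posrE ?expR_gt0 ?invr_gt0 ?divr_gt0 ?exprn_gt0//.
by rewrite invf_div; apply: le_trans h; rewrite lerDr.
Qed.

Let V := 2 ^+ 19 + `|Ceps|.
Let V0 : 0 <= V. Proof. by rewrite /V addr_ge0. Qed.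

Let pow_le (a b : nat) : (b <= a)%N -> y ^- a <= y ^- b.
Proof. by move=> ab; rewrite lef_pV2 ?posrE ?exprn_gt0// ler_weXn2l. Qed.

(** With n = y^32 and r0 = y^(-14), the exponent n r0^2 / (32 B^2) is at least
    y^2 / 128 because B <= 2 y. A moment of order 66 makes the other term at
    most a multiple of y^(32 - 66). *)
Let unusual_bound_le : unusual_bound S M q Ceps y (y ^- 14) L <= V * y ^- 4.
Proof.
rewrite /unusual_bound /V [leRHS]mulrDl; apply: lerD.
  apply: (@le_trans _ _ (expR (32 * C1 * y) * (4 * expR (- (y ^+ 2 / 128))))).
    apply: ler_pM; [by []|by rewrite mulr_ge0// expR_ge0|exact: grid_card_le|].
    apply: ler_wpM2l => //; rewrite ler_expR lerN2.
    have -> : n%:R * (y ^- 14) ^+ 2 = y ^+ 4 by rewrite -yn; field; exact: lt0r_neq0.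
    have b0 : 0 < M + y by have := M0; have := y0; lra.
    rewrite ler_pdivlMr; last by rewrite mulr_gt0// exprn_gt0.
    have : (M + y) ^+ 2 <= (2 * y) ^+ 2.
      by rewrite lerXn2r// ?nnegrE; have := My; have := y0; lra.
    move=> /(ler_wpM2l (sqr_ge0 y)); lra.
  rewrite mulrCA -expRD.
  apply: (@le_trans _ _ (4 * expR (- (y ^+ 2 / 256)))).
    apply: ler_wpM2l => //; rewrite ler_expR.
    have := ler_wpM2r (ltW y0) y_large; lra.
  have := expRN_le (x := y ^+ 2 / 256).
  rewrite divr_gt0 ?exprn_gt0// => /(_ isT).
  have -> : 2 / (y ^+ 2 / 256) ^+ 2 = 2 ^+ 17 * y ^- 4 by field; exact: lt0r_neq0.
  lra.
have yq : y ^+ 66 <= y `^ q by rewrite -powR_mulrn ?ler_powR// ltW.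
apply: (@le_trans _ _ (y ^+ 32 * (`|Ceps| * y ^- 66))).
  rewrite -yn; apply: ler_wpM2l; first by rewrite exprn_ge0// ltW.
  apply: (@le_trans _ _ (`|Ceps| / y `^ q)).
    by rewrite ler_wpM2r ?ler_norm// invr_ge0 powR_ge0.
  by rewrite ler_wpM2l// lef_pV2 ?posrE ?powR_gt0 ?exprn_gt0.
have -> : y ^+ 32 * (`|Ceps| * y ^- 66) = `|Ceps| * y ^- 34 by field; exact: lt0r_neq0.
by rewrite ler_wpM2l// pow_le.
Qed.

Let rad_le : (M + y) * (3 * K%:R + 1) * (y ^- 14 + fmax / n%:R) <= 256 * (1 + fmax) * y ^- 12.
Proof.
have k1 : (1 : R) <= K%:R by rewrite ler1n double_gt0.
have sy : s <= y by rewrite -s2 expr2 ler_peMl// (le_trans _ s1).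
have u0 : 0 <= y ^- 14 by rewrite invr_ge0 exprn_ge0// ltW.
have h1 : y ^- 14 + fmax / n%:R <= (1 + fmax) * y ^- 14.
  by rewrite -yn mulrDl mul1r lerD2l ler_wpM2l// pow_le.
have h2 : 3 * K%:R + 1 <= 128 * y by have := depth_le; lra.
have h3 : M + y <= 2 * y by have := My; lra.
have -> : 256 * (1 + fmax) * y ^- 12 = 2 * y * (128 * y) * ((1 + fmax) * y ^- 14).
  by field; exact: lt0r_neq0.
apply: ler_pM h1; last (apply: ler_pM h2 => //).
- by rewrite mulr_ge0// ?addr_ge0// ltW.
- by rewrite addr_ge0// divr_ge0.
- by rewrite addr_ge0// ltW.
Qed.

Definition rate_constant : R :=
  (12 * (2048 * (1 + fmax)) + M ^+ 2 * V) / (delta / alpha1) +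
  4096 * (1 + fmax) + (8 * M ^+ 2 + 2) * V + 2 * `|Ceps|.

Lemma risk_bound_le : risk_bound S M alpha1 delta fmax q Ceps y (y ^- 14) L <=
  (1 - delta / alpha1) ^+ L * M ^+ 2 + rate_constant * y ^- 2.
Proof.
have [p0 _] := andP p01.
have ub := unusual_bound_le; have rl := rad_le.
rewrite /risk_bound -3!addrA lerD2l /rate_constant.
set rad := (M + y) * _ * _ in rl *; set U := unusual_bound _ _ _ _ _ _ _ in ub *.
have B1 : 1 <= M + y by have := M0; have := y1; lra.
have B2 : M + y <= 2 * y by have := My; lra.
have BB : (M + y) ^+ 2 <= 4 * y ^+ 2.
  have := ler_pM (le_trans ler01 B1) (le_trans ler01 B1) B2 B2; lra.
have rad0 : 0 <= rad.
  rewrite /rad; apply: mulr_ge0.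
    by rewrite mulr_ge0 ?(le_trans ler01 B1)// addr_ge0// mulr_ge0.
  by rewrite addr_ge0 ?divr_ge0// invr_ge0 exprn_ge0// ltW.
have F0 : 0 <= 1 + fmax by rewrite addr_ge0.
have L4 : (0 : R) <= (4 ^ L)%:R by [].
have u2 : 0 <= y ^- 2 by rewrite invr_ge0 sqr_ge0.
have U2 : U <= V * y ^- 2 by apply: (le_trans ub); rewrite ler_wpM2l ?pow_le.
have U3 : y ^+ 2 * U <= V * y ^- 2.
  apply: (le_trans (ler_wpM2l (sqr_ge0 y) ub)).
  by rewrite le_eqVlt; apply/orP; left; apply/eqP; field; exact: lt0r_neq0.
have t1 : (4 ^ L)%:R * ((2 * (M + y) + (M + y) ^+ 2) * rad) <= 2048 * (1 + fmax) * y ^- 2.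
  have c : 2 * (M + y) + (M + y) ^+ 2 <= 8 * y ^+ 2.
    have := ler_wpM2r (ltW y0) y1; have := BB; have := B2; lra.
  have c0 : 0 <= 2 * (M + y) + (M + y) ^+ 2.
    by rewrite addr_ge0 ?sqr_ge0// mulr_ge0// (le_trans ler01).
  have -> : 2048 * (1 + fmax) * y ^- 2 = y ^+ 8 * (8 * y ^+ 2 * (256 * (1 + fmax) * y ^- 12)).
    by field; exact: lt0r_neq0.
  by apply: ler_pM => //; [rewrite mulr_ge0|apply: ler_pM].
have t2 : (4 ^ L)%:R * (2 * (M + y) * (1 + (M + y)) * rad) <= 4096 * (1 + fmax) * y ^- 2.
  have c : 2 * (M + y) * (1 + (M + y)) <= 16 * y ^+ 2.
    have := ler_wpM2r (le_trans ler01 B1) B1; have := BB; lra.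
  have c0 : 0 <= 2 * (M + y) * (1 + (M + y)) by have := B1; nra.
  have -> : 4096 * (1 + fmax) * y ^- 2 = y ^+ 8 * (16 * y ^+ 2 * (256 * (1 + fmax) * y ^- 12)).
    by field; exact: lt0r_neq0.
  by apply: ler_pM => //; [rewrite mulr_ge0|apply: ler_pM].
have t3 : n%:R * Ceps * y `^ (2 - q) <= `|Ceps| * y ^- 2.
  have q64 : y `^ (2 - q) <= y ^- 64.
    have -> : y ^- 64 = y `^ (- 64%:R) by rewrite powRN powR_mulrn// ltW.
    by rewrite ler_powR//; have := q66; lra.
  apply: (@le_trans _ _ (y ^+ 32 * `|Ceps| * y ^- 64)).
    rewrite -yn; apply: (@le_trans _ _ (y ^+ 32 * `|Ceps| * y `^ (2 - q))).
      by rewrite ler_wpM2r ?powR_ge0// ler_wpM2l ?ler_norm// exprn_ge0// ltW.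
    by rewrite ler_wpM2l// mulr_ge0// exprn_ge0// ltW.
  have -> : y ^+ 32 * `|Ceps| * y ^- 64 = `|Ceps| * y ^- 32 by field; exact: lt0r_neq0.
  by rewrite ler_wpM2l ?pow_le.
have M2 := ler_wpM2l (sqr_ge0 M) U2.
have t4 : ((4 ^ L)%:R * (12 * ((2 * (M + y) + (M + y) ^+ 2) * rad)) + M ^+ 2 * U) / (delta / alpha1) <=
    ((12 * (2048 * (1 + fmax)) + M ^+ 2 * V) / (delta / alpha1)) * y ^- 2.
  rewrite [leRHS]mulrAC; apply: ler_wpM2r; first by rewrite invr_ge0 ltW.
  rewrite [leRHS]mulrDl; apply: lerD; last by rewrite -[leRHS]mulrA.
  by rewrite mulrCA -[leRHS]mulrA ler_wpM2l.
have t5 : (8 * M ^+ 2 + 2 * y ^+ 2) * U <= (8 * M ^+ 2 + 2) * V * y ^- 2.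
  rewrite [leLHS]mulrDl -![in leRHS]mulrA [leRHS]mulrDl; apply: lerD.
    by rewrite -[leLHS]mulrA -[leRHS]mulrA ler_wpM2l.
  by rewrite -[leLHS]mulrA ler_wpM2l.
have t6 : 2 * (n%:R * Ceps * y `^ (2 - q)) <= 2 * `|Ceps| * y ^- 2.
  by rewrite -[leRHS]mulrA ler_wpM2l.
apply: (le_trans (lerD t4 (lerD t2 (lerD t5 t6)))).
by rewrite -!mulrDl !addrA.
Qed.

End rate.

(** * Consistency *)

Section root.
Context {R : realType}.

(** The truncation level y as a function of n; the exponent leaves room for
    all polynomial losses in y. *)
Definition root32 (n : nat) : R := n%:R `^ (32%:R^-1).

Lemma root32K n : root32 n ^+ 32 = n%:R.
Proof. by rewrite -powR_mulrn ?powR_ge0// -powRrM mulVf// powRr1. Qed.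

Lemma root32_ge (A : R) : \forall n \near \oo, A <= root32 n.
Proof.
near=> n; apply: (le_trans (ler_norm A)).
rewrite -(@ler_pXn2r _ 32) ?nnegrE ?powR_ge0// root32K.
by near: n; exact: nbhs_infty_ger.
Unshelve. all: by end_near. Qed.

(** Reduces the polynomial growth of the dimension to an integral power of y. *)
Lemma powR_root32 n (a : R) (e : nat) : (0 < n)%N -> 32 * a <= e%:R -> n%:R `^ a <= root32 n ^+ e.
Proof.
move=> n0 ae; rewrite -powR_mulrn ?powR_ge0// -powRrM ler_powR ?ler1n//.
by rewrite mulrC ler_pdivlMr// mulrC.
Qed.

(** This is where the depth is limited: y^8 = n^(1/4) bounds the number 2^k of
    leaves. *)
Lemma depth_leaves n k : (0 < n)%N -> k%:R < 4^-1 * (ln n%:R / ln 2) :> R ->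
  2 ^+ k <= root32 n ^+ 8.
Proof.
move=> n0 kn; have n1 : 0 < (n%:R : R) by rewrite ltr0n.
have l2 : 0 < ln 2 :> R by rewrite ln_gt0// ltr1n.
have key : (2 ^+ k) ^+ 4 <= n%:R :> R.
  rewrite -(@lnK _ 2) ?posrE// -(lnK n1) -!expRM_natr ler_expR.
  move: kn; rewrite -(ltr_pM2r l2); have -> : 4^-1 * (ln n%:R / ln 2) * ln 2 = ln n%:R / 4 :> R.
    by field; exact: lt0r_neq0.
  lra.
rewrite -(@ler_pXn2r _ 4) ?nnegrE ?exprn_ge0 ?powR_ge0//.
by rewrite -[leRHS]exprM root32K.
Qed.

End root.

Theorem corollary11 (R : realType) (W : nat)
    (alpha1 delta fmin fmax K0 M : R) :
  (0 < W)%N -> 1 <= alpha1 -> 0 < delta <= 1 -> 0 < fmin -> 0 < K0 ->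
  (delta < 1 -> - 2 * ln 2 / ln (1 - delta) <= W%:R) ->
  exists2 q0 : R, 0 < q0 &
    forall (q Ceps : R) (model : forall n, rsrf_model R n W) (k : nat -> nat),
      q0 <= q ->
      (forall n, regression_setting (model n)) ->
      (forall n, sources_independent (model n)) ->
      (forall n, draws_law (model n)) ->
      (forall n, random_split_condition
        (distribution (Pr (model n)) (Xnew (model n))) (m (model n))
        alpha1 delta) ->
      (forall n, density_bounded (model n) fmin fmax) ->
      (fun n => (ndim (model n))%:R : R^o) =O_\oo (fun n => n%:R `^ K0) ->
      (forall n, noise_symmetric (model n)) ->
      (forall n, noise_moment_le (model n) q Ceps) ->
      (forall n, regression_bounded (model n) M) ->
      (forall n, ~~ odd (k n)) ->
      k n @[n --> \oo] --> \oo ->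
      (\forall n \near \oo, (k n)%:R < 4^-1 * (ln n%:R / ln 2) :> R) ->
      rsrf_risk (model n) (k n) @[n --> \oo] --> 0%E.
Proof.
move=> W0 alpha0 delta0 fmin0 K00 _; exists 66 => // q Ceps model k q66 reg ind draws split_cond
  dens dimO sym mom bounded k_even k_oo k_small.
have [delta_gt0 delta_le1] := andP delta0.
have alpha_gt0 : 0 < alpha1 by exact: lt_le_trans alpha0.
have p01 : 0 < delta / alpha1 <= 1.
  by rewrite divr_gt0//= ler_pdivrMr// mul1r (le_trans delta_le1).
have M0 : 0 <= M by exact: bound_ge0 (bounded 0%N).
have fm0 : 0 < fmax by exact: density_max_gt0 fmin0 (dens 0%N).
have [D0 D0_gt0 dimD] : exists2 D0 : R, 0 < D0 &
    \forall n \near \oo, (ndim (model n))%:R <= D0 * n%:R `^ K0.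
  have /eqO_exP[D0 D00 h] := dimO; exists D0 => //.
  near=> n; have : `|(ndim (model n))%:R : R^o| <= D0 * `|n%:R `^ K0| by near: n; exact: h.
  by rewrite !ger0_norm ?powR_ge0.
(* at least 1, as is required of the constant in the bound of the dimension *)
pose D := 1 + D0.
pose e := Num.bound (32 * K0).
have eK : 32 * K0 <= e%:R by rewrite ltW// archi_boundP// mulr_ge0// ltW.
pose L n := (k n)./2.
have L_oo : L n @[n --> \oo] --> \oo.
  apply/cvgnyPge => A; have /cvgnyPge/(_ A.*2) := k_oo.
  by apply: filterS => n h; rewrite /L -(doubleK A) half_leq.
pose b n : R := (1 - delta / alpha1) ^+ L n * M ^+ 2 +
  rate_constant M alpha1 delta fmax Ceps / root32 n ^+ 2.
have c1 : (1 - delta / alpha1) ^+ L n @[n --> \oo] --> (0 : R).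
  apply: (@cvg_comp _ _ _ L (fun l => (1 - delta / alpha1) ^+ l) _ _ _ L_oo).
  by apply: cvg_expr; have [p0 p1] := andP p01; rewrite ger0_norm; lra.
have c2 : (root32 n ^+ 2)^-1 @[n --> \oo] --> (0 : R).
  apply/gtr0_cvgV0.
    by apply: filterS (root32_ge 1) => n h; rewrite exprn_gt0// (lt_le_trans _ h).
  apply/cvgryPge => A; apply: filterS2 (root32_ge A) (root32_ge 1) => n hA h1.
  by rewrite (le_trans hA)// expr2 ler_peMl// (le_trans _ h1).
have b0 : b n @[n --> \oo] --> (0 : R).
  have := cvgD (cvgM c1 (@cvg_cst _ (M ^+ 2) _ _ _)) (cvgM (@cvg_cst _ (rate_constant M alpha1 delta fmax Ceps) _ _ _) c2).
  rewrite mul0r mulr0 addr0 => h. exact: h.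
apply: (@squeeze_cvge _ _ _ _ (fun=> 0%E) _ (fun n => (b n)%:E)); last 2 first.
- exact: cvg_cst.
- by apply: cvg_EFin => //; exact: nearW.
near=> n; apply/andP; split.
  by rewrite /rsrf_risk unlock integral_ge0// => w _; rewrite lee_fin sqr_ge0.
have n0 : (0 < n)%N by near: n; exact: nbhs_infty_gt.
have y1 : 1 <= root32 n :> R by near: n; exact: root32_ge.
have y0 : 0 < root32 n :> R by exact: lt_le_trans y1.
have L0 : (0 < L n)%N by near: n; have /cvgnyPge/(_ 1%N) := L_oo.
have KL : (k n) = (L n).*2 by rewrite /L even_halfK.
have leaves : (4 ^ L n)%:R <= root32 n ^+ 8 :> R.
  have -> : (4 ^ L n)%:R = 2 ^+ k n :> R by rewrite KL -natrX -muln2 mulnC expnM.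
  by apply: depth_leaves => //; near: n.
have dD : (ndim (model n))%:R <= D * root32 n ^+ e.
  have h : (ndim (model n))%:R <= D0 * n%:R `^ K0 by near: n.
  apply: (le_trans h); apply: ler_pM; rewrite ?powR_ge0 ?(ltW D0_gt0)//.
    by rewrite /D lerDr.
  exact: powR_root32.
apply: (@le_trans _ _ (risk_bound (model n) M alpha1 delta fmax q Ceps (root32 n)
    (root32 n ^- 14) (L n))%:E).
  apply: (risk_le_bound (ind n) (draws n) (reg n) (sym n) (bounded n) (dens n) (mom n)
    (split_cond n)) => //.
  - by apply: le_trans q66; rewrite ler_nat.
  - apply/andP; split; first by rewrite invr_ge0 exprn_ge0// ltW.
    by rewrite invf_le1 ?exprn_gt0// exprn_ege1.
rewrite lee_fin; apply: (risk_bound_le Ceps M0 p01 (ltW fm0) q66 L0 y1 _ (root32K n) _ dD leaves).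
- by near: n; exact: root32_ge.
- by rewrite /D lerDl ltW.
- by near: n; exact: root32_ge.
Unshelve. all: by end_near. Qed.
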